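(* Let $\mathbb{F}$ be an algebraically closed field of characteristic $0$ and $n\ge 2$. Every fine grading on the Lie superalgebra $P(n)$ is equivalent to a unique $\Gamma_P(\ell)$. Moreover, every grading $\Gamma_P(\ell)$ is fine, and $G_{(\ell)}$ is its universal group.
   Context: $M(n+1,n+1)$ is the associative superalgebra $M_{2n+2}(\mathbb{F})$ whose even (odd) part consists of the block-diagonal (block-off-diagonal) matrices with blocks of size $n+1$; $M(n+1,n+1)^{(-)}$ is the same superspace with the supercommutator. $P(n)$ is the Lie subsuperalgebra of $M(n+1,n+1)^{(-)}$ $$P(n)=\left\{\begin{pmatrix}a&b\\c&-a^{\top}\end{pmatrix}\ \Big|\ a,b,c\in M_{n+1}(\mathbb{F}),\ \mathrm{tr}\,a=0,\ b=b^{\top},\ c=-c^{\top}\right\}.$$ Only gradings by abelian groups are considered; components of a grading on a superalgebra are $\mathbb{Z}_2$-graded subspaces. A grading $\Gamma'$ is a refinement of $\Gamma$ if every component of $\Gamma'$ is contained in a component of $\Gamma$, proper if some nonzero containment is strict; a grading is fine if it has no proper refinement. Two gradings $A=\bigoplus_{g\in G}A_g$, $B=\bigoplus_{h\in K}B_h$ with supports $S$, $S'$ are equivalent if there are an isomorphism of superalgebras $\varphi:A\to B$ and a bijection $\alpha:S\to S'$ with $\varphi(A_s)=B_{\alpha(s)}$. The universal (abelian) group of a grading with support $S$ is the abelian group generated by $S$ with defining relations $s_1s_2=s_3$ whenever $0\neq A_{s_1}A_{s_2}\subseteq A_{s_3}$ (product meaning the bracket here). Standard realization. Let $T$ be a finite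 subgroup of an abelian group $G$ with a nondegenerate alternating bicharacter $\beta:T\times T\to\mathbb{F}^\times$. Write $T=A\times B$ with $\beta$ trivial on $A\times A$ and on $B\times B$. The standard realization of the graded division algebra associated to $(T,\beta)$ is $D=\mathrm{End}(\mathbb{F}B)$, written as matrices in the basis $\{e_b\}_{b\in B}$, with one-dimensional components $D_{ab}=\mathbb{F}X_{ab}$, $X_{ab}=\sum_{b'\in B}\beta(a,bb')E_{bb',b'}$ ($a\in A$, $b\in B$). The grading $\Gamma_P(T,\beta,\gamma,g_0)$. Let $T\subseteq G$ be a finite elementary $2$-subgroup, $\beta$ a nondegenerate alternating bicharacter on $T$, $\gamma=(g_1,\dots,g_k)$ a tuple of elements of $G$ with $k\sqrt{|T|}=n+1$, and $g_0\in G$. With $D$ a standard realization associated to $(T,\beta)$, identify each of the four blocks of $M(n+1,n+1)$ with $M_k(\mathbb{F})\otimes D$ via the Kronecker product, and grade $M(n+1,n+1)$ by: $\deg(E_{ij}\otimes d)=g_i(\deg d)g_j^{-1}$ in the upper left block; $g_i(\deg d)g_jg_0^{-1}$ in the upper right block; $g_i^{-1}(\deg d)g_j^{-1}g_0$ in the lower left block; $g_i^{-1}(\deg d)g_j$ in the lower right block. $P(n)$ is a graded subspace, and $\Gamma_P(T,\beta,\gamma,g_0)$ is the restriction to $P(n)$. The grading $\Gamma_P(\ell)$. For an integer $\ell\ge 0$, let $T_{(\ell)}=\mathbb{Z}_2^{2\ell}$ with the nondegenerate alternating bicharacter $\beta_{(\ell)}(x,y)=(-1)^{\sum_{i=1}^{2\ell}x_iy_{2\ell-i+1}}$.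 For every $\ell\ge0$ such that $2^\ell$ divides $n+1$, put $k=(n+1)/2^\ell$, let $e_1,\dots,e_k$ be the standard basis of $\mathbb{Z}^k$ and $\langle e_0\rangle$ the infinite cyclic group generated by a new symbol $e_0$. $\Gamma_P(\ell)=\Gamma_P(\ell,k)$ is the $T_{(\ell)}\times\mathbb{Z}^k\times\langle e_0\rangle$-grading $\Gamma_P(T_{(\ell)},\beta_{(\ell)},(e_1,\dots,e_k),e_0)$ on $P(n)$. The subgroup generated by its support is $G_{(\ell)}=(T_{(\ell)}\times\mathbb{Z}^k_0)\oplus\langle 2e_1-e_0\rangle\cong\mathbb{Z}_2^{2\ell}\times\mathbb{Z}^k$, where $\mathbb{Z}^k_0=\{x\in\mathbb{Z}^k: x_1+\dots+x_k=0\}$. *)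

(* Defs.v *)
From HB Require Import structures.
From mathcomp Require Import all_boot all_order all_algebra.
From mathcomp Require Import mxtens freeg.

Set Implicit Arguments.
Unset Strict Implicit.
Unset Printing Implicit Defensive.

Import GRing.Theory.
Local Open Scope ring_scope.

(* A finite-dimensional superalgebra is given inside an ambient algebra       *)
(* (V, mul) by its even part L false and its odd part L true.                 *)
Section Gradings.
Variables (F : fieldType) (V : vectType F) (mul : V -> V -> V).
Variable L : bool -> {vspace V}.

Definition total_space : {vspace V} := (L false + L true)%VS.

Definition in_support (G : zmodType) (Gam : G -> {vspace V}) : pred G :=
  fun g => Gam g != 0%VS.

Definition support (G : zmodType) (Gam : G -> {vspace V}) : Type :=
  {g : G | in_support Gam g}.

(* The support of a grading on a finite-dimensional space is finite, hence    *)
(* the sequence S.                                                            *)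
Definition is_grading (G : zmodType) (Gam : G -> {vspace V}) : Prop :=
  [/\ exists S : seq G,
        [/\ uniq S, {subset in_support Gam <= S},
            directv (\sum_(g <- S) Gam g)
          & (\sum_(g <- S) Gam g)%VS = total_space],
      forall g, Gam g = (Gam g :&: L false + Gam g :&: L true)%VS
    & forall g h x y, x \in Gam g -> y \in Gam h -> mul x y \in Gam (g + h)].

Definition refinement (H G : zmodType) (Gam' : H -> {vspace V})
    (Gam : G -> {vspace V}) : Prop :=
  forall h, exists g, (Gam' h <= Gam g)%VS.

Definition proper_refinement (H G : zmodType) (Gam' : H -> {vspace V})
    (Gam : G -> {vspace V}) : Prop :=
  refinement Gam' Gam /\
  exists h g, [/\ Gam' h != 0%VS, (Gam' h <= Gam g)%VS & Gam' h != Gam g].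

Definition fine (G : zmodType) (Gam : G -> {vspace V}) : Prop :=
  is_grading Gam /\
  forall (H : zmodType) (Gam' : H -> {vspace V}),
    is_grading Gam' -> ~ proper_refinement Gam' Gam.

(* Only the restriction of phi to total_space is meaningful; injectivity      *)
(* there follows from the equality of dimensions.                             *)
Definition is_automorphism (phi : 'End(V)) : Prop :=
  (forall i : bool, (phi @: L i)%VS = L i) /\
  {in total_space &, {morph phi : x y / mul x y}}.

Definition equivalent (G K : zmodType) (Gam : G -> {vspace V})
    (Del : K -> {vspace V}) : Prop :=
  exists (phi : 'End(V)) (alpha : support Gam -> support Del),
    [/\ is_automorphism phi, bijective alpha
      & forall s, (phi @: Gam (val s))%VS = Del (val (alpha s))].

Inductive generated_subgroup (W : zmodType) (X : W -> Prop) : W -> Prop :=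
| gen_incl x : X x -> generated_subgroup X x
| gen_zero : generated_subgroup X 0
| gen_sub x y : generated_subgroup X x -> generated_subgroup X y ->
    generated_subgroup X (x - y).

Section UniversalGroup.
Variables (G : zmodType) (Gam : G -> {vspace V}).

Let S : choiceType := {g : G | in_support Gam g}.

Definition universal_relator (w : {freeg S / int}) : Prop :=
  exists s1 s2 s3 : S,
    [/\ exists x y, [/\ x \in Gam (val s1), y \in Gam (val s2) & mul x y != 0],
        forall x y, x \in Gam (val s1) -> y \in Gam (val s2) ->
          mul x y \in Gam (val s3)
      & w = << s1 >> + << s2 >> - << s3 >>].

Definition free_eval (w : {freeg S / int}) : G :=
  \sum_(s <- dom w) val s *~ coeff s w.

(* The subgroup U of G is presented by the support as set of generators and   *)
(* the universal relators: the canonical homomorphism from the free abelian   *)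
(* group on the support to G has image U, and its kernel is the subgroup      *)
(* generated by the relators.                                                 *)
Definition is_universal_group (U : G -> Prop) : Prop :=
  (forall u, U u <-> exists w, free_eval w = u) /\
  (forall w, free_eval w = 0 <-> generated_subgroup universal_relator w).

End UniversalGroup.
End Gradings.

Section PeriplecticSuperalgebra.
Variables (F : fieldType) (m : nat).
Implicit Type x : 'M[F]_(m + m).

Definition parity_part (i : bool) x : 'M[F]_(m + m) :=
  if i then block_mx 0 (ursubmx x) (dlsubmx x) 0
  else block_mx (ulsubmx x) 0 0 (drsubmx x).

Definition supercommutator x y : 'M[F]_(m + m) :=
  \sum_(i : bool) \sum_(j : bool)
    (parity_part i x *m parity_part j y
     - (-1) ^+ (i && j) *: (parity_part j y *m parity_part i x)).

Definition P_equations x : F^o * 'M[F]_m * 'M[F]_m * 'M[F]_m :=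
  (\tr (ulsubmx x), drsubmx x + (ulsubmx x)^T,
   ursubmx x - (ursubmx x)^T, dlsubmx x + (dlsubmx x)^T).

Fact P_equations_is_linear : linear P_equations.
Proof.
move=> c x y; congr (_, _, _, _).
- have -> : ulsubmx (c *: x + y) = c *: ulsubmx x + ulsubmx y.
    by apply/matrixP => i j; rewrite !mxE.
  by rewrite mxtraceD mxtraceZ.
- by apply/matrixP => i j; rewrite !mxE mulrDr addrACA.
- by apply/matrixP => i j; rewrite !mxE mulrBr opprD addrACA.
- by apply/matrixP => i j; rewrite !mxE mulrDr addrACA.
Qed.

HB.instance Definition _ :=
  GRing.isLinear.Build F 'M[F]_(m + m) (F^o * 'M[F]_m * 'M[F]_m * 'M[F]_m)%type
    _ P_equations P_equations_is_linear.

Fact parity_part_is_linear i : linear (parity_part i).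
Proof.
by case: i => c x y; rewrite /parity_part scale_block_mx add_block_mx
  !scaler0 !addr0; congr block_mx; apply/matrixP => i j; rewrite !mxE.
Qed.

HB.instance Definition _ i :=
  GRing.isLinear.Build F 'M[F]_(m + m) 'M[F]_(m + m) _ (parity_part i)
    (parity_part_is_linear i).

Definition P_space : {vspace 'M[F]_(m + m)} := lker (linfun P_equations).

Definition P_part (i : bool) : {vspace 'M[F]_(m + m)} :=
  (P_space :&: limg (linfun (parity_part i)))%VS.

Lemma mem_P_space x :
  reflect (exists a b c, [/\ x = block_mx a b c (- a^T),
             \tr a = 0, b = b^T & c = - c^T])
          (x \in P_space).
Proof.
rewrite memv_ker lfunE /= /P_equations; apply: (iffP eqP).
  case=> tr0 /eqP; rewrite addr_eq0 => /eqP dE /eqP.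
  rewrite subr_eq0 => /eqP bE /eqP; rewrite addr_eq0 => /eqP cE.
  by exists (ulsubmx x), (ursubmx x), (dlsubmx x); rewrite -dE submxK.
case=> a [b] [c] [-> tra bE cE].
rewrite block_mxKul block_mxKur block_mxKdl block_mxKdr tra addNr.
by rewrite -bE subrr {1}cE addNr.
Qed.

Lemma mem_P_part i x : (x \in P_part i) = (x \in P_space) && (parity_part i x == x).
Proof.
rewrite memv_cap; congr (_ && _); apply/memv_imgP/eqP => [[y _ ->] | <-].
  rewrite lfunE; case: i => /=; rewrite /parity_part.
    by rewrite block_mxKur block_mxKdl.
  by rewrite block_mxKul block_mxKdr.
by exists x; rewrite ?memvf // lfunE.
Qed.

End PeriplecticSuperalgebra.

Section StandardRealization.
Variables (F : fieldType) (T : finZmodType) (beta : T -> T -> F).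
Variables A B : {set T}.

(* T is the direct sum of its subgroups A and B, on both of which beta is     *)
(* trivial.                                                                   *)
Definition isotropic_decomposition : Prop :=
  [/\ zmod_closed A, zmod_closed B,
      forall t, exists! ab : T * T,
        [/\ ab.1 \in A, ab.2 \in B & t = ab.1 + ab.2],
      {in A &, forall x y, beta x y = 1}
    & {in B &, forall x y, beta x y = 1}].

(* End(FB), written in the basis (e_b) ordered by the enumeration of B.       *)
Definition X_mx (a b : T) : 'M[F]_#|B| :=
  \matrix_(i, j)
    (beta a (b + enum_val j) *+ (enum_val i == b + enum_val j)).

Variables (G : zmodType) (iota : T -> G).
Variables (k : nat) (gam : 'I_k -> G) (g0 : G) (m : nat).

(* E_ij (x) X_ab in M_m(F), where m = k * #|B|; conform_mx only transports    *)
(* along that equality.                                                       *)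
Definition kron (i j : 'I_k) (a b : T) : 'M[F]_m :=
  conform_mx (0 : 'M[F]_m) (delta_mx i j *t X_mx a b).

(* The lines <[(E_ij (x) X_ab) in each of the four blocks]> of degree g.      *)
Definition lines_of_degree (g : G) (i j : 'I_k) (a b : T) :
    {vspace 'M[F]_(m + m)} :=
  let E := kron i j a b in
  let t := iota (a + b) in
  let line (d : G) (x : 'M[F]_(m + m)) : {vspace 'M[F]_(m + m)} :=
    if d == g then <[x]>%VS else 0%VS in
  (line (gam i + t - gam j)%R (block_mx E 0 0 0)
   + line (gam i + t + gam j - g0)%R (block_mx 0 E 0 0)
   + line (- gam i + t - gam j + g0)%R (block_mx 0 0 E 0)
   + line (- gam i + t + gam j)%R (block_mx 0 0 0 E))%VS.

Definition M_component (g : G) : {vspace 'M[F]_(m + m)} :=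
  (\sum_(i < k) \sum_(j < k) \sum_(a in A) \sum_(b in B)
    lines_of_degree g i j a b)%VS.

Definition Gamma_P (g : G) : {vspace 'M[F]_(m + m)} :=
  (M_component g :&: P_space F m)%VS.

End StandardRealization.

Definition T_l (l : nat) : finZmodType := 'rV['F_2]_(2 * l).

Definition beta_l (F : fieldType) (l : nat) (x y : T_l l) : F :=
  (-1) ^+ (\sum_(i < 2 * l) x ord0 i * y ord0 (rev_ord i))%N.

Section GammaPl.
Variables l k : nat.

(* T_(l) x Z^k x <e_0>, with e_0 = (0, 0, 1).                                 *)
Definition group_l : zmodType := (T_l l * 'rV[int]_k * int)%type.

Definition gam_l (i : 'I_k) : group_l := (0, delta_mx ord0 i, 0).
Definition e0_l : group_l := (0, 0, 1).

Definition Gamma_Pl (F : fieldType) (A B : {set T_l l}) (m : nat) :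
    group_l -> {vspace 'M[F]_(m + m)} :=
  @Gamma_P F (T_l l) (@beta_l F l) A B group_l (fun t => (t, 0, 0)) k gam_l e0_l m.

(* (T_(l) x Z^k_0) (+) <2 e_1 - e_0>; the indices of 'I_k start at 0.         *)
Definition G_l (u : group_l) : Prop :=
  exists (t : T_l l) (z : 'rV[int]_k) (c : int) (i : 'I_k),
    [/\ \sum_j z ord0 j = 0, i = 0 :> nat
      & u = (t, z, 0) + (gam_l i *+ 2 - e0_l) *~ c].

End GammaPl.

(* Main.v *)
(* Every automorphism of P(n) is conjugation Ad x by diag(x, x^-T) for some x in
   GL_{n+1}: it sends the square-zero rank one elements of the even part, on
   which (ad a)^3 = 0 on the symmetric block, to elements of the same kind, and
   this determines it on the symmetric block by rank one matrices v v^T. Since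
   x is determined up to sign, the matrices acting on each component of a
   grading by scalars commute up to sign, and those given by finitely many
   characters separate the components. Such a family of diagonalizable matrices
   is, in a suitable basis, contained in the matrices diag(lam) (x) X_t with t
   in an elementary 2-group T_(l), and the joint eigenspaces of all of these are
   the components of Gamma_P(l). Hence every grading is a coarsening of some
   Gamma_P(l) up to Ad x. Conversely a matrix commuting up to sign with every
   diag(lam) (x) X_t is itself of this form; this gives the fineness of
   Gamma_P(l), shows that all characters of its universal group come from the
   grading group, and recovers (T_(l), beta_(l)) as the commutator form of the
   matrices acting by scalars on the components. *)
Require Import Defs.
From HB Require Import structures.
From mathcomp Require Import all_boot all_order all_algebra.
From mathcomp Require Import mxtens freeg.
From Stdlib Require Import Classical ClassicalEpsilon.

Set Implicit Arguments.
Unset Strict Implicit.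
Unset Printing Implicit Defensive.

Import Order.TTheory GRing.Theory Num.Theory.
Local Open Scope ring_scope.

(** * Characters of abelian groups *)

Section Characters.
Variables (F : closedFieldType) (M : zmodType).

(** The group of a grading is an arbitrary abelian group, so its dual is never formed: a character
    is extended only over the finitely many degrees of the support, one at a time, which is possible
    because nonzero elements of F have roots of all orders. The matrix x is found from the symmetric
    block alone; once an automorphism is trivial there and on the even part, bracket relations force
    it to be trivial on the skew block. Diagonalizability of x is not formal, since only its action
    on P(n) is known to be diagonal: translating one eigenvector of x by homogeneous even elements
    produces enough eigenvectors. To bring a family commuting up to sign into standard form, a
    maximal compatible system of paired anticommuting involutions, a frame, is split off; corrected
    by products from the frame, the members of the family commute with one another and with the
    frame, and joint eigenvectors give the tensor decomposition. As A and B are arbitrary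
    complementary isotropic subgroups, they are first identified with F_2^l and its dual through
    beta. *)

Definition subgroup (H : M -> Prop) :=
  H 0 /\ forall x y, H x -> H y -> H (x - y).

(** Total functions constrained on a subgroup only, so that extending a character changes no
    type. *)
Definition character_on (H : M -> Prop) (f : M -> F) :=
  (forall x, H x -> f x != 0) /\ forall x y, H x -> H y -> f (x + y) = f x * f y.

Lemma subgroupN H x : subgroup H -> H x -> H (- x).
Proof. by case=> H0 HB Hx; rewrite -sub0r; apply: HB. Qed.

Lemma subgroupD H x y : subgroup H -> H x -> H y -> H (x + y).
Proof.
by move=> sH Hx Hy; rewrite -[y]opprK; apply: sH.2 => //; exact: subgroupN.
Qed.

Lemma subgroupMz H x n : subgroup H -> H x -> H (x *~ n).
Proof.
move=> sH Hx; have Hn k : H (x *+ k).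
  elim: k => [|k IHk]; first by rewrite mulr0n; exact: sH.1.
  by rewrite mulrS; exact: subgroupD.
case: n => n; first exact: Hn.
by rewrite NegzE mulrNz; apply: subgroupN => //; apply: Hn.
Qed.

Lemma character_on0 H f : subgroup H -> character_on H f -> f 0 = 1.
Proof.
move=> sH [f0 fD]; have H0 := sH.1.
by apply: (mulfI (f0 _ H0)); rewrite -fD // addr0 mulr1.
Qed.

Lemma character_onN H f x : subgroup H -> character_on H f -> H x ->
  f (- x) = (f x)^-1.
Proof.
move=> sH cf Hx; apply: (mulfI (cf.1 _ Hx)); rewrite mulfV ?cf.1 //.
by rewrite -cf.2 ?subrr ?(character_on0 sH) //; exact: subgroupN.
Qed.

Lemma character_onMz H f x n : subgroup H -> character_on H f -> H x ->
  f (x *~ n) = f x ^ n.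
Proof.
move=> sH cf Hx; have fMn k : f (x *+ k) = f x ^+ k.
  elim: k => [|k IHk]; first by rewrite mulr0n expr0 (character_on0 sH).
  by rewrite mulrS exprS cf.2 ?IHk //; apply: (subgroupMz k).
case: n => n; first exact: fMn.
rewrite NegzE mulrNz (character_onN sH) //; last exact: (subgroupMz n.+1).
by rewrite fMn exprnN.
Qed.

(** The extension lives on H + Zx and sends h + nx to f h * z^n. Two such expressions of one element
    differ by a multiple of x lying in H, where the hypothesis on z makes the values agree. *)
Lemma character_extend_value H f x z :
    subgroup H -> character_on H f -> z != 0 ->
    (forall n : int, H (x *~ n) -> f (x *~ n) = z ^ n) ->
  exists H' f', [/\ subgroup H', character_on H' f',
    forall y, H y -> H' y /\ f' y = f y, H' x & f' x = z].
Proof.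
move=> sH cf z0 fxz.
pose H' y := exists h (n : int), H h /\ y = h + x *~ n.
pose f' y := epsilon (inhabits (0 : F))
  (fun c => exists h (n : int), [/\ H h, y = h + x *~ n & c = f h * z ^ n]).
have f'E h (n : int) : H h -> f' (h + x *~ n) = f h * z ^ n.
  move=> Hh; rewrite /f'; set Q := (X in epsilon _ X).
  have : Q (epsilon (inhabits 0) Q).
    by apply: epsilon_spec; exists (f h * z ^ n), h, n.
  case=> h' [n' [Hh' e ->]].
  have e' : h' - h = x *~ (n - n').
    rewrite mulrzBr; apply/eqP; rewrite subr_eq addrAC eq_sym subr_eq addrC e.
    by rewrite addrC.
  have Hd := sH.2 _ _ Hh' Hh; move: (Hd); rewrite e' => /fxz; rewrite -e'.
  rewrite cf.2 ?(character_onN sH) //; last exact: subgroupN.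
  move=> fe; have -> : f h' = z ^ (n - n') * f h.
    by rewrite -fe mulfVK ?cf.1.
  by rewrite mulrAC -expfzDr // subrK mulrC.
exists H', f'; split.
- split; first by exists 0, 0; rewrite mulr0z addr0; split; [exact: sH.1|].
  move=> _ _ [h [n [Hh ->]]] [h' [n' [Hh' ->]]]; exists (h - h'), (n - n').
  by split; [exact: sH.2 | rewrite mulrzBr opprD addrACA].
- split=> [_ [h [n [Hh ->]]]|_ _ [h [n [Hh ->]]] [h' [n' [Hh' ->]]]].
    by rewrite f'E // mulf_neq0 ?cf.1 ?expfz_neq0.
  rewrite addrACA -mulrzDr !f'E ?cf.2 ?expfzDr //; first by rewrite mulrACA.
  exact: subgroupD.
- move=> y Hy; have -> : y = y + x *~ 0 by rewrite mulr0z addr0.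
  by rewrite f'E // expr0z mulr1 mulr0z addr0; split=> //; exists y, 0;
    rewrite mulr0z addr0.
- by exists 0, 1; rewrite mulr1z add0r; split; [exact: sH.1|].
- have -> : x = 0 + x *~ 1 by rewrite mulr1z add0r.
  by rewrite f'E ?(character_on0 sH) //; [rewrite mul1r expr1z | exact: sH.1].
Qed.

(** The order of x modulo H: the least d > 0 with dx in H, if there is one, divides every n with nx
    in H, because the remainder of n modulo d has the same property. *)
Lemma order_modP H x : subgroup H ->
  (exists2 d, (0 < d)%N & H (x *+ d) /\
     forall n : int, H (x *~ n) -> (d %| n)%Z) \/
  (forall n : int, H (x *~ n) -> n = 0).
Proof.
move=> sH; pose P d := (0 < d)%N &&
  (if excluded_middle_informative (H (x *+ d)) then true else false).
have PE d : P d <-> (0 < d)%N /\ H (x *+ d).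
  rewrite /P; case: excluded_middle_informative => Hd /=.
    by rewrite andbT; split=> [|[]].
  by rewrite andbF; split=> [|[_ /Hd]].
case: (classic (exists d, P d)) => [exP | noP].
  left; have exP' : exists d, P d by [].
  case: (ex_minnP exP') => d /PE[d_gt0 Hd] dmin; exists d => //; split=> // n Hn.
  have Hr : H (x *~ (n %% d)%Z).
    have -> : (n %% d)%Z = n - d%:Z * (n %/ d)%Z.
      by rewrite {2}(divz_eq n d) mulrC addrAC subrr add0r.
    by rewrite mulrzBr mulrzA; apply: sH.2 => //; exact: subgroupMz.
  have /andP[r_ge0 r_lt] : (0 <= (n %% d)%Z < d%:Z).
    by rewrite modz_ge0 ?ltz_pmod // gt_eqF.
  apply/dvdz_mod0P; case: (n %% d)%Z r_ge0 r_lt Hr => // -[|r] // _.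
  rewrite ltz_nat => r_lt Hr; have /dmin : P r.+1 by apply/PE.
  by rewrite leqNgt r_lt.
right=> n Hn; apply: NNPP => n0; apply: noP; exists `|n|%N; apply/PE.
split; first by rewrite absz_gt0; apply/eqP.
case: n Hn {n0} => n //; rewrite NegzE mulrNz => /(subgroupN sH).
by rewrite opprK.
Qed.

(** A root of 1 + X + ... + X^(d-1); it is not 1 because the value at 1 is d, nonzero in
    characteristic 0. *)
Lemma root_of_unity_neq1 d : [pchar F] =i pred0 -> (1 < d)%N ->
  exists2 z : F, z ^+ d = 1 & z != 1.
Proof.
move=> charF0 d_gt1; pose p : {poly F} := \sum_(i < d) 'X^i.
have pE : ('X - 1) * p = 'X^d - 1 by rewrite [RHS]subrX1.
have sp : size p != 1.
  apply/eqP => s1; have p0 : p != 0 by rewrite -size_poly_eq0 s1.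
  have := size_monicM (monicXsubC (1 : F)) p0.
  by rewrite size_XsubC s1 pE size_Xn_sub_1 ?(ltnW d_gt1) // => -[d1];
    move: d_gt1; rewrite d1.
have [z /rootP pz0] := closed_rootP p sp; exists z.
  have /(congr1 (horner^~ z)) := pE.
  by rewrite hornerM pz0 mulr0 !hornerE => /esym/eqP; rewrite subr_eq0 => /eqP.
apply/eqP => z1; move: pz0; rewrite z1 horner_sum.
rewrite (eq_bigr (fun _ => 1)) => [|i _]; last by rewrite hornerXn expr1n.
rewrite sumr_const card_ord => /eqP; rewrite (pcharf0P _).1 //.
by case: d d_gt1 {p pE sp}.
Qed.

(** The multiplicative group of an algebraically closed field is divisible, so a value at x
    compatible with f exists: a d-th root of f(dx) if x has order d modulo H, and 1 if the order is
    infinite. *)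
Lemma character_extend H f x : [pchar F] =i pred0 ->
    subgroup H -> character_on H f ->
  exists H' f', [/\ subgroup H', character_on H' f',
    forall y, H y -> H' y /\ f' y = f y & H' x].
Proof.
move=> charF0 sH cf; suff [z z0 fz] : exists2 z, z != 0 &
    forall n : int, H (x *~ n) -> f (x *~ n) = z ^ n.
  have [H' [f' [? ? ? ? _]]] := character_extend_value sH cf z0 fz.
  by exists H', f'.
have [[d d_gt0 [Hd dP]] | nP] := order_modP x sH; last first.
  exists 1; rewrite ?oner_eq0 // => n /nP ->.
  by rewrite mulr0z expr0z (character_on0 sH).
(* The coefficient function is constant-term only; it encodes the equation z^d = f(dx). *)
have [z zE] := @solve_monicpoly F d (fun i => f (x *+ d) *+ (i == 0%N)) d_gt0.
have {}zE : z ^+ d = f (x *+ d).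
  rewrite zE (bigD1 (Ordinal d_gt0)) //= expr0 mulr1 big1 ?addr0 // => i.
  by rewrite -val_eqE /= => /negbTE ->; rewrite mul0r.
exists z => [|n Hn].
  by apply: contraNneq (cf.1 _ Hd) => z0; rewrite -zE z0 expr0n gtn_eqF.
have /dvdzP[q ->] := dP n Hn; rewrite mulrC mulrzA (character_onMz _ sH cf) //.
by rewrite -[x *~ d]/(x *+ d) -zE exprnP exprz_exp.
Qed.

(** The trivial character of R is extended to w with a value other than 1 (a d-th root of unity if w
    has order d modulo R, -1 if the order is infinite), and then over the elements of [gens] one by
    one. A finite list suffices because gradings have finite support. *)
Lemma separating_character (R : M -> Prop) w (gens : seq M) :
    [pchar F] =i pred0 -> subgroup R -> ~ R w ->
  exists H f, [/\ subgroup H, character_on H f,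
    forall y, R y -> H y /\ f y = 1, H w /\ f w != 1
    & {in gens, forall y, H y}].
Proof.
move=> charF0 sR Rw.
have c1 : character_on R (fun=> 1).
  by split=> *; rewrite ?oner_eq0 ?mulr1.
have [z [z0 z1 fz]] : exists z : F, [/\ z != 0, z != 1 &
    forall n : int, R (w *~ n) -> 1 = z ^ n].
  have [[d d_gt0 [Hd dP]] | nP] := order_modP w sR; last first.
    exists (-1); rewrite oppr_eq0 oner_eq0; split=> // [|n /nP ->].
      rewrite eq_sym -subr_eq0 opprK -mulr2n (pcharf0P _).1 //.
    by rewrite expr0z.
  have d_gt1 : (1 < d)%N by case: d d_gt0 Hd {dP} => [|[|d]].
  have [z zd z1] := root_of_unity_neq1 charF0 d_gt1; exists z; split=> // [|n].
    have : z ^+ d != 0 by rewrite zd oner_neq0.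
    by rewrite expf_eq0 d_gt0.
  by move/dP => /dvdzP[q ->]; rewrite mulrC -exprz_exp -exprnP zd exp1rz.
have [H0 [f0 [sH0 cf0 R0 H0w f0w]]] := character_extend_value sR c1 z0 fz.
elim: gens => [|g gens [H [f [sH cf HR [Hw fw] Hg]]]].
  by exists H0, f0; split; rewrite ?f0w.
have [H' [f' [sH' cf' HH' Hg']]] := character_extend g charF0 sH cf.
exists H', f'; split=> //.
- by move=> y Ry; have [Hy fy] := HR y Ry; have [? ->] := HH' y Hy.
- by have [? ->] := HH' w Hw.
- by move=> y; rewrite inE => /predU1P[-> // | /Hg Hy]; case: (HH' y Hy).
Qed.

End Characters.

(** * Automorphisms of P(n) *)

Section PeriplecticBrackets.
Variables (F : fieldType) (m : nat).
Implicit Types a b c d : 'M[F]_m.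

Definition pmx a b c : 'M[F]_(m + m) := block_mx a b c (- a^T).

(** The actions of the even element [pmx a 0 0] on the two odd blocks: the symmetric square of the
    standard module and the exterior square of its dual. *)
Definition act_sym a b := a *m b + b *m a^T.
Definition act_skew a c := - (a^T *m c + c *m a).

Lemma supercommutator_block a b c d a' b' c' d' :
  supercommutator (block_mx a b c d) (block_mx a' b' c' d') =
  block_mx (a *m a' - a' *m a + (b *m c' + b' *m c))
           (a *m b' - b' *m d + (b *m d' - a' *m b))
           (d *m c' - c' *m a + (c *m a' - d' *m c))
           (d *m d' - d' *m d + (c *m b' + c' *m b)).
Proof.
rewrite /supercommutator !big_bool /= /parity_part !block_mxKul !block_mxKur
  !block_mxKdl !block_mxKdr !mulmx_block !mul0mx !mulmx0 !add0r !addr0.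
rewrite expr1 expr0 scaleN1r !scale1r !opp_block_mx !add_block_mx.
rewrite !opprK !oppr0 !add0r !addr0.
by congr block_mx; rewrite addrC // addrCA addrA addrC.
Qed.

Lemma supercommutator_even_odd a b c :
  supercommutator (pmx a 0 0) (pmx 0 b c) = pmx 0 (act_sym a b) (act_skew a c).
Proof.
rewrite supercommutator_block trmx0 oppr0 /act_sym /act_skew.
rewrite !mul0mx !mulmx0 !subr0 !addr0; congr block_mx.
- by rewrite mulmxN opprK.
- by rewrite mulNmx opprD.
- by rewrite trmx0 oppr0.
Qed.

(** The entry b' drops out because two elements of the symmetric block have zero bracket. Hence the
    bracket with a symmetric b sees only the skew block of an odd element, which [aut_skew]
    exploits. *)
Lemma supercommutator_sym_skew b b' c : b = b^T -> c = - c^T ->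
  supercommutator (pmx 0 b 0) (pmx 0 b' c) = pmx (b *m c) 0 0.
Proof.
move=> sb sc; rewrite supercommutator_block trmx0 oppr0 !mul0mx !mulmx0.
rewrite !subr0 !addr0 !add0r; congr block_mx.
by rewrite trmx_mul -sb {1}sc mulNmx.
Qed.

Lemma mem_pmx a b c : (pmx a b c \in P_space F m) =
  [&& \tr a == 0, b == b^T & c == - c^T].
Proof.
apply/mem_P_space/and3P => [[a' [b' [c' [/eq_block_mx[-> -> -> _] ta sb sc]]]]|].
  by split; apply/eqP.
by case=> /eqP ta /eqP sb /eqP sc; exists a, b, c.
Qed.

Lemma P_spaceP x : reflect (exists a b c,
   [/\ x = pmx a b c, \tr a = 0, b = b^T & c = - c^T]) (x \in P_space F m).
Proof. exact: mem_P_space. Qed.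

Lemma P_evenP x :
  reflect (exists2 a, x = pmx a 0 0 & \tr a = 0) (x \in P_part F m false).
Proof.
rewrite mem_P_part; apply: (iffP andP) => [[/P_spaceP[a [b [c [-> ta _ _]]]]]|].
  rewrite /parity_part block_mxKul block_mxKdr => /eqP e.
  by exists a.
case=> a -> ta; rewrite mem_pmx ta trmx0 oppr0 !eqxx; split=> //.
by rewrite /parity_part block_mxKul block_mxKdr.
Qed.

Lemma P_oddP x :
  reflect (exists b c, [/\ x = pmx 0 b c, b = b^T & c = - c^T])
          (x \in P_part F m true).
Proof.
rewrite mem_P_part; apply: (iffP andP) => [[/P_spaceP[a [b [c [-> ta sb sc]]]]]|].
  rewrite /parity_part /= block_mxKur block_mxKdl => /eqP e; exists b, c.
  by rewrite -e /pmx trmx0 oppr0.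
case=> b [c [-> sb sc]]; rewrite mem_pmx mxtrace0 -sb -sc !eqxx; split=> //.
by rewrite /parity_part block_mxKur block_mxKdl /pmx trmx0 oppr0.
Qed.

Lemma pmxD a b c a' b' c' :
  pmx a b c + pmx a' b' c' = pmx (a + a') (b + b') (c + c').
Proof. by rewrite /pmx add_block_mx linearD opprD. Qed.

Lemma pmxZ k a b c : k *: pmx a b c = pmx (k *: a) (k *: b) (k *: c).
Proof. by rewrite /pmx scale_block_mx linearZ scalerN. Qed.

Lemma pmx_inj a b c a' b' c' : pmx a b c = pmx a' b' c' ->
  [/\ a = a', b = b' & c = c'].
Proof. by case/eq_block_mx. Qed.

Lemma pmx0 : pmx 0 0 0 = 0.
Proof. by rewrite /pmx trmx0 oppr0 block_mx0. Qed.

Lemma P_part_sub i : (P_part F m i <= P_space F m)%VS.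
Proof. exact: capvSl. Qed.

Lemma total_P : total_space (P_part F m) = P_space F m.
Proof.
apply/eqP; rewrite eqEsubv subv_add !P_part_sub /=.
apply/subvP => x /P_spaceP[a [b [c [-> ta sb sc]]]].
have -> : pmx a b c = pmx a 0 0 + pmx 0 b c by rewrite pmxD !addr0 !add0r.
apply: memv_add; first by apply/P_evenP; exists a.
by apply/P_oddP; exists b, c.
Qed.

(* [Ad x] is conjugation by the block diagonal matrix (x, x^-T). *)
Definition Ad (x : 'M[F]_m) (v : 'M[F]_(m + m)) : 'M[F]_(m + m) :=
  block_mx (x *m ulsubmx v *m invmx x) (x *m ursubmx v *m x^T)
    ((invmx x)^T *m dlsubmx v *m invmx x) ((invmx x)^T *m drsubmx v *m x^T).

Fact Ad_is_linear x : linear (Ad x).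
Proof.
move=> k v w; rewrite /Ad scale_block_mx add_block_mx.
have subE : [/\ ulsubmx (k *: v + w) = k *: ulsubmx v + ulsubmx w,
  ursubmx (k *: v + w) = k *: ursubmx v + ursubmx w,
  dlsubmx (k *: v + w) = k *: dlsubmx v + dlsubmx w
  & drsubmx (k *: v + w) = k *: drsubmx v + drsubmx w].
  by split; apply/matrixP => i j; rewrite !mxE.
case: subE => -> -> -> ->.
by rewrite !mulmxDr !mulmxDl -!scalemxAr -!scalemxAl.
Qed.

HB.instance Definition _ x := GRing.isLinear.Build F 'M[F]_(m + m) 'M[F]_(m + m)
  _ (Ad x) (Ad_is_linear x).

Lemma Ad_block x a b c d : Ad x (block_mx a b c d) =
  block_mx (x *m a *m invmx x) (x *m b *m x^T)
    ((invmx x)^T *m c *m invmx x) ((invmx x)^T *m d *m x^T).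
Proof. by rewrite /Ad block_mxKul block_mxKur block_mxKdl block_mxKdr. Qed.

Lemma Ad_pmx x a b c : Ad x (pmx a b c) =
  pmx (x *m a *m invmx x) (x *m b *m x^T) ((invmx x)^T *m c *m invmx x).
Proof.
by rewrite Ad_block /pmx !trmx_mul mulmxN mulNmx !mulmxA.
Qed.

Lemma invmxM (x y : 'M[F]_m) : x \in unitmx -> y \in unitmx ->
  invmx (x *m y) = invmx y *m invmx x.
Proof.
move=> ux uy; have uxy : x *m y \in unitmx by rewrite unitmx_mul ux.
rewrite -[RHS]mul1mx -(mulVmx uxy) -!mulmxA (mulmxA y) mulmxV // mul1mx.
by rewrite mulmxV // mulmx1.
Qed.

Lemma AdM x y v : x \in unitmx -> y \in unitmx -> Ad x (Ad y v) = Ad (x *m y) v.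
Proof.
move=> ux uy; rewrite -[v]submxK !Ad_block !invmxM // !trmx_mul !mulmxA.
by [].
Qed.

Lemma Ad1 v : Ad 1%:M v = v.
Proof.
by rewrite -[v]submxK Ad_block invmx1 trmx1 !mulmx1 !mul1mx.
Qed.

Lemma AdK x : x \in unitmx -> cancel (Ad x) (Ad (invmx x)).
Proof. by move=> ux v; rewrite AdM ?unitmx_inv // mulVmx // Ad1. Qed.

Lemma AdVK x : x \in unitmx -> cancel (Ad (invmx x)) (Ad x).
Proof. by move=> ux v; rewrite AdM ?unitmx_inv // mulmxV // Ad1. Qed.

Lemma parity_Ad i x v : parity_part i (Ad x v) = Ad x (parity_part i v).
Proof.
rewrite -[v]submxK; set a := ulsubmx v; set b := ursubmx v; set c := dlsubmx v.
set d := drsubmx v.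
by case: i; rewrite /parity_part Ad_block ?block_mxKul ?block_mxKur ?block_mxKdl
  ?block_mxKdr Ad_block !mulmx0 !mul0mx.
Qed.

Lemma Ad_supercommutator x v w : x \in unitmx ->
  Ad x (supercommutator v w) = supercommutator (Ad x v) (Ad x w).
Proof.
move=> ux; have uxT : x^T \in unitmx by rewrite unitmx_tr.
rewrite -[v]submxK -[w]submxK supercommutator_block !Ad_block.
rewrite supercommutator_block -!mulmxA.
rewrite !(mulKmx ux) !(mulmxA x^T (invmx x)^T) -!trmx_mul !mulVmx // trmx1.
rewrite !mul1mx.
by rewrite !(mulmxDr, mulmxDl, mulmxN, mulNmx, mulmxA).
Qed.

Lemma Ad_P x v : x \in unitmx -> (Ad x v \in P_space F m) = (v \in P_space F m).
Proof.
move=> ux; suff AdP y w : y \in unitmx -> w \in P_space F m ->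
    Ad y w \in P_space F m.
  apply/idP/idP; last exact: AdP.
  by move/(AdP _ _ (etrans (unitmx_inv x) ux)); rewrite AdK.
move=> uy /P_spaceP[a [b [c [-> ta sb sc]]]]; rewrite Ad_pmx mem_pmx.
rewrite mxtrace_mulC mulKmx // ta !trmx_mul !trmxK -sb eqxx !mulmxA eqxx /=.
by rewrite -mulNmx -mulmxN -sc.
Qed.

Lemma Ad_P_part i x v : x \in unitmx ->
  (Ad x v \in P_part F m i) = (v \in P_part F m i).
Proof.
move=> ux; rewrite !mem_P_part Ad_P // parity_Ad.
by rewrite (can_eq (AdK ux)).
Qed.

Lemma Ad_automorphism x : x \in unitmx ->
  is_automorphism (@supercommutator F m) (@P_part F m) (linfun (Ad x)).
Proof.
move=> ux; split=> [i | v w _ _]; last by rewrite !lfunE /= Ad_supercommutator.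
apply/eqP; rewrite eqEsubv; apply/andP; split; apply/subvP => v.
  by case/memv_imgP => w Pw ->; rewrite lfunE /= Ad_P_part.
move=> Pv; apply/memv_imgP; exists (Ad (invmx x) v).
  by rewrite Ad_P_part ?unitmx_inv.
by rewrite lfunE /= AdVK.
Qed.

End PeriplecticBrackets.

(** * Symmetric products of vectors and the action on the odd blocks *)

Section SymmetricProducts.
Variables (F : fieldType) (m : nat).
Hypothesis charF0 : [pchar F] =i pred0.
Implicit Types (a b c : 'M[F]_m) (p q u v w : 'cV[F]_m).

(** The product p.q in the symmetric square, written as a symmetric matrix and normalized so that
    [sprod p p] is twice the rank one matrix of p. *)
Definition sprod p q : 'M[F]_m := p *m q^T + q *m p^T.

Lemma sprodC p q : sprod p q = sprod q p.
Proof. by rewrite /sprod addrC. Qed.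

Lemma sprod_sym p q : sprod p q = (sprod p q)^T.
Proof. by rewrite /sprod linearD /= !trmx_mul !trmxK addrC. Qed.

Lemma sprodDl p p' q : sprod (p + p') q = sprod p q + sprod p' q.
Proof. by rewrite /sprod linearD /= mulmxDl mulmxDr addrACA. Qed.

Lemma sprodZl k p q : sprod (k *: p) q = k *: sprod p q.
Proof. by rewrite /sprod linearZ /= scalerDr -scalemxAl -scalemxAr. Qed.

Lemma sprod0l q : sprod 0 q = 0.
Proof. by rewrite /sprod trmx0 mul0mx mulmx0 addr0. Qed.

Lemma sprodpp p : sprod p p = 2 *: (p *m p^T).
Proof. by rewrite /sprod scaler_nat mulr2n. Qed.

Lemma sym_rank1 p : p *m p^T = (p *m p^T)^T.
Proof. by rewrite trmx_mul trmxK. Qed.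

Lemma act_sym_sprod a p q :
  act_sym a (sprod p q) = sprod (a *m p) q + sprod p (a *m q).
Proof.
rewrite /act_sym /sprod mulmxDr mulmxDl !trmx_mul !mulmxA -!addrA.
by congr (_ + _); rewrite addrC [RHS]addrA [X in _ = X + _]addrC.
Qed.

Lemma act_sym_rank1 a p : act_sym a (p *m p^T) = sprod (a *m p) p.
Proof. by rewrite /act_sym /sprod trmx_mul !mulmxA. Qed.

Lemma act_symZ a k b : act_sym a (k *: b) = k *: act_sym a b.
Proof. by rewrite /act_sym -scalemxAr -scalemxAl scalerDr. Qed.

Lemma act_symD a b b' : act_sym a (b + b') = act_sym a b + act_sym a b'.
Proof. by rewrite /act_sym mulmxDr mulmxDl addrACA. Qed.

Lemma act_sym_tr a b : b = b^T -> act_sym a b = (act_sym a b)^T.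
Proof.
by move=> sb; rewrite /act_sym linearD /= !trmx_mul trmxK -sb addrC.
Qed.

Lemma act_skew_tr a c : c = - c^T -> act_skew a c = - (act_skew a c)^T.
Proof.
move=> sc; have cT : c^T = - c by rewrite {2}sc opprK.
rewrite /act_skew; set x := a^T *m c + c *m a.
have xT : x^T = - x.
  by rewrite /x linearD /= !trmx_mul trmxK cT mulmxN mulNmx opprD addrC.
by have -> : (- x)^T = x by rewrite linearN /= xT opprK.
Qed.

Lemma act_sym_square0 a b : a *m a = 0 ->
  act_sym a (act_sym a b) = 2 *: (a *m b *m a^T).
Proof.
move=> aa; have aaT : a^T *m a^T = 0 by rewrite -trmx_mul aa trmx0.
rewrite /act_sym mulmxDr mulmxDl !mulmxA aa mul0mx add0r -(mulmxA b) aaT.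
by rewrite mulmx0 addr0 scaler_nat mulr2n.
Qed.

Lemma act_skew_square0 a c : a *m a = 0 ->
  act_skew a (act_skew a c) = 2 *: (a^T *m c *m a).
Proof.
move=> aa; have aaT : a^T *m a^T = 0 by rewrite -trmx_mul aa trmx0.
rewrite /act_skew !(mulmxN, mulNmx) -opprD opprK mulmxDr mulmxDl !mulmxA aaT.
by rewrite mul0mx add0r -(mulmxA c) aa mulmx0 addr0 scaler_nat mulr2n.
Qed.

Lemma natF_neq0 k : k.+1%:R != 0 :> F.
Proof. by rewrite (pcharf0P _).1. Qed.

(** The symmetric algebra has no zero divisors. By hand: if the entry p_i is nonzero, the entry (i,
    i) gives q_i = 0, and then row i gives q = 0. *)
Lemma sprod_eq0 p q : sprod p q = 0 -> p = 0 \/ q = 0.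
Proof.
move=> pq0; have pqE i j : p i 0 * q j 0 + q i 0 * p j 0 = 0.
  move/matrixP/(_ i j): pq0; rewrite /sprod !mxE !big_ord1 !mxE.
  by [].
have [-> | /cV0Pn[i pi]] := eqVneq p 0; first by left.
right; have qi : q i 0 = 0.
  move: (pqE i i) => /eqP; rewrite [q i 0 * _]mulrC -mulr2n -mulr_natl.
  by rewrite !mulf_eq0 (negbTE (natF_neq0 1)) (negbTE pi) => /eqP.
apply/matrixP => j z; rewrite ord1 mxE.
move: (pqE i j) => /eqP; rewrite qi mul0r addr0 mulf_eq0 (negbTE pi).
by move/eqP.
Qed.

Lemma sprod_inj p q q' : p != 0 -> sprod p q = sprod p q' -> q = q'.
Proof.
move=> p0 /eqP; rewrite -subr_eq0 ![sprod p _]sprodC -scaleN1r -sprodZl -sprodDl.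
rewrite scaleN1r => /eqP /sprod_eq0[/eqP|p0']; last by rewrite p0' eqxx in p0.
by rewrite subr_eq0 => /eqP.
Qed.

Lemma rank1_eq0 p : (p *m p^T == 0) = (p == 0).
Proof.
apply/eqP/eqP => [pp0 | ->]; last by rewrite mul0mx.
by have [] : p = 0 \/ p = 0 by apply: sprod_eq0; rewrite sprodpp pp0 scaler0.
Qed.

Lemma mx_neq0_col a : a != 0 -> exists u, a *m u != 0.
Proof.
move=> a0; apply: NNPP => noU; case/eqP: a0; apply/matrixP => i j.
apply/eqP; apply: contraT => aij; case: noU; exists (delta_mx j 0).
by apply: contraNneq aij => /matrixP/(_ i 0); rewrite -colE !mxE => ->.
Qed.

Lemma sym_skew_form c u : c = - c^T -> u^T *m c *m u = 0.
Proof.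
move=> sc; have /eqP : u^T *m c *m u = - (u^T *m c *m u).
  rewrite {1}[u^T *m c *m u](_ : _ = (u^T *m c *m u)^T); last first.
    by apply/matrixP => i j; rewrite !ord1 [RHS]mxE.
  have cT : c^T = - c by rewrite {2}sc opprK.
  by rewrite !trmx_mul trmxK cT mulNmx mulmxN mulmxA.
rewrite -addr_eq0 -mulr2n -scaler_nat scaler_eq0 (negbTE (natF_neq0 1)).
by move/eqP.
Qed.

(** Polarization: squares v v^T yield all symmetric products, and twice a symmetric matrix is a
    combination of symmetric products of basis vectors. *)
Lemma rank1_span_sym (V : lmodType F) (g : 'M[F]_m -> V) b : linear g ->
  (forall v, g (v *m v^T) = 0) -> b = b^T -> g b = 0.
Proof.
move=> gL g0 sb; have [f fE] : exists f : {linear 'M[F]_m -> V}, f =1 g.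
  by exists (HB.pack_for {linear 'M[F]_m -> V} g
    (GRing.isLinear.Build F 'M[F]_m V _ g gL)).
have f0 v : f (v *m v^T) = 0 by rewrite fE.
rewrite -fE.
have fs p q : f (sprod p q) = 0.
  have E : (p + q) *m (p + q)^T = p *m p^T + (q *m q^T + sprod p q).
    rewrite linearD /= mulmxDl !mulmxDr -addrA; congr (_ + _).
    by rewrite [RHS]addrC -addrA.
  by have := f0 (p + q); rewrite E linearD f0 add0r linearD f0 add0r.
have gen (h : 'I_m -> 'I_m -> F) (x := \sum_i \sum_j h i j *: delta_mx i j) :
    x + x^T = \sum_i \sum_j h i j *: sprod (delta_mx i 0) (delta_mx j 0).
  rewrite linear_sum -big_split; apply: eq_bigr => i _ /=.
  rewrite linear_sum -big_split; apply: eq_bigr => j _ /=.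
  by rewrite linearZ /= trmx_delta -scalerDr /sprod !trmx_delta !mul_delta_mx.
have e : 2 *: b = \sum_i \sum_j b i j *: sprod (delta_mx i 0) (delta_mx j 0).
  by rewrite -gen -matrix_sum_delta -sb scaler_nat mulr2n.
have : 2 *: f b = 0.
  rewrite -linearZ /= e linear_sum big1 // => i _.
  by rewrite linear_sum big1 // => j _; rewrite linearZ /= fs scaler0.
by move/eqP; rewrite scaler_eq0 (negbTE (natF_neq0 1)) => /eqP.
Qed.

End SymmetricProducts.

(** All roots of the characteristic polynomial are 0, so it is a power of X and Cayley-Hamilton
    applies. *)
Lemma nilpotent_eigenvalues (F : closedFieldType) n (a : 'M[F]_n.+1) :
  (forall z, eigenvalue a z -> z = 0) -> exists k, a ^+ k = 0.
Proof.
move=> ev0; have [r rE] := closed_field_poly_normal (char_poly a).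
rewrite (monicP (char_poly_monic a)) scale1r in rE.
have r0 z : z \in r -> z = 0.
  by move=> zr; apply: ev0; rewrite eigenvalue_root_char rE root_prod_XsubC.
have pE : char_poly a = 'X^(size r).
  rewrite rE big_seq (eq_bigr (fun=> 'X)) => [|z /r0 ->]; last by rewrite subr0.
  by rewrite -big_seq big_const_seq count_predT -Monoid.iteropE.
exists (size r); have := Cayley_Hamilton a.
by rewrite pE rmorphXn /= horner_mx_X.
Qed.

(** * The action of an automorphism on the symmetric block and on the even part *)

Section Automorphisms.
Variables (F : closedFieldType) (n : nat).
Hypotheses (charF0 : [pchar F] =i pred0) (n_gt0 : (0 < n)%N).
Local Notation m := n.+1.
Implicit Types (a b c : 'M[F]_m) (p q u v w : 'cV[F]_m).

(* On a vector [v] with [a^3 v = 0] the cube of [ad a] maps [v v^T] to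
   [3 (a^2 v) . (a v)], a symmetric product of nonzero vectors if [a^2 v <> 0]. *)
Lemma ad_cube0_square0 a :
  (forall b, b = b^T -> act_sym a (act_sym a (act_sym a b)) = 0) -> a *m a = 0.
Proof.
move=> ad3; have [k ak0] : exists k, a^T ^+ k = 0.
  apply: nilpotent_eigenvalues => z /eigenvalueP[v vE v0].
  have avE : a *m v^T = z *: v^T by rewrite -[a]trmxK -trmx_mul vE linearZ.
  have v0' : v^T *m v^T^T != 0 by rewrite rank1_eq0 // trmx_eq0.
  have actE : act_sym a (v^T *m v^T^T) = (z * 2) *: (v^T *m v^T^T).
    by rewrite act_sym_rank1 avE sprodZl sprodpp scalerA.
  have := ad3 _ (sym_rank1 v^T); rewrite actE !act_symZ actE !act_symZ actE.
  rewrite !scalerA => /eqP; rewrite scaler_eq0 (negbTE v0') orbF !mulf_eq0.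
  by rewrite (negbTE (natF_neq0 charF0 1)) !orbF !orbb => /eqP.
have exk : exists j, a ^+ j == 0.
  exists k; rewrite -trmx_eq0; apply/eqP; rewrite -ak0.
  elim: k {ak0} => [|k IHk]; first by rewrite !expr0 trmx1.
  by rewrite exprSr [RHS]exprS -IHk -!mulmxE trmx_mul.
(* In the remaining case the nilpotency index is [k.+3], and v = a^k u for a suitable u satisfies
   a^3 v = 0 and a^2 v <> 0. *)
case: (ex_minnP exk) => {k ak0 exk} -[|[|[|k]]] /eqP ak kmin.
- by move/eqP: ak; rewrite expr0 oner_eq0.
- by rewrite expr1 in ak; rewrite ak mul0mx.
- by rewrite expr2 in ak.
have ak2 : a ^+ k.+2 != 0 by apply/negP => /kmin; rewrite ltnn.
have [u au] := mx_neq0_col ak2.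
have aS j (x : 'cV_m) : a *m (a ^+ j *m x) = a ^+ j.+1 *m x.
  by rewrite mulmxA exprS -mulmxE.
pose v := a ^+ k *m u.
have a2v : a *m (a *m v) != 0.
  by rewrite /v !aS.
have a3v : a *m (a *m (a *m v)) = 0.
  by rewrite /v !aS ak mul0mx.
have := ad3 _ (sym_rank1 v); rewrite act_sym_rank1 !act_sym_sprod.
rewrite act_symD !act_sym_sprod a3v sprod0l add0r.
rewrite [sprod (a *m v) (a *m (a *m v))]sprodC -mulr2n -mulrS -scaler_nat.
move=> /eqP; rewrite scaler_eq0 (negbTE (natF_neq0 charF0 2)).
move=> /eqP/(sprod_eq0 charF0)[] av0.
  by rewrite av0 eqxx in a2v.
by rewrite av0 mulmx0 eqxx in a2v.
Qed.

(** There are at least two coordinates since n > 0. The matrix [u *m w^T] is then traceless and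
    squares to zero: a nilpotent element of the even part. *)
Lemma orthogonal_vector u : exists2 w : 'cV[F]_m, w != 0 & w^T *m u = 0.
Proof.
pose i0 := @ord0 n; pose i1 := @inord n 1.
have i01 : i1 != i0 by rewrite -val_eqE /= inordK.
have [u00 | u00] := eqVneq (u i0 0) 0.
  exists (delta_mx i0 0); last first.
    rewrite trmx_delta -rowE; apply/matrixP => i j.
    by rewrite !mxE !ord1 -[RHS]u00.
  by apply/cV0Pn; exists i0; rewrite mxE !eqxx oner_eq0.
exists (u i0 0 *: delta_mx i1 0 - u i1 0 *: delta_mx i0 0).
  apply/cV0Pn; exists i1; rewrite !mxE eqxx (negbTE i01) /=.
  by rewrite mulr0 subr0 mulr1.
rewrite [(_ - _)^T]linearB /= ![(_ *: _)^T]linearZ /= !trmx_delta mulmxBl -!scalemxAl -!rowE.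
by apply/matrixP => i j; rewrite !mxE !ord1 mulrC subrr.
Qed.

Variable phi : 'End('M[F]_(m + m)).
Hypothesis phiP : is_automorphism (@supercommutator F m) (@P_part F m) phi.

Local Notation P := (P_space F m).

Lemma aut_total : (phi @: P)%VS = P.
Proof. by rewrite -total_P limgD !phiP.1. Qed.

(** An automorphism is only required to map P onto itself; equality of dimensions makes its kernel
    on P trivial. *)
Lemma aut_eq0 x : x \in P -> phi x = 0 -> x = 0.
Proof.
move=> Px fx0; have := limg_ker_dim phi P; rewrite aut_total.
move=> /(canRL (addnK _)); rewrite subnn => /eqP; rewrite dimv_eq0 => /eqP k0.
by apply/eqP; rewrite -memv0 -k0 memv_cap Px memv_ker fx0 eqxx.
Qed.

Lemma aut_mul x y : x \in P -> y \in P ->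
  phi (supercommutator x y) = supercommutator (phi x) (phi y).
Proof. by move=> Px Py; apply: phiP.2; rewrite total_P. Qed.

Lemma aut_even a : \tr a = 0 ->
  exists2 a', phi (pmx a 0 0) = pmx a' 0 0 & \tr a' = 0.
Proof.
move=> ta; apply/P_evenP; rewrite -(phiP.1 false); apply: memv_img.
by apply/P_evenP; exists a.
Qed.

Lemma aut_odd b c : b = b^T -> c = - c^T ->
  exists b' c', [/\ phi (pmx 0 b c) = pmx 0 b' c', b' = b'^T & c' = - c'^T].
Proof.
move=> sb sc; apply/P_oddP; rewrite -(phiP.1 true); apply: memv_img.
by apply/P_oddP; exists b, c.
Qed.

Lemma aut_odd_onto b c : b = b^T -> c = - c^T ->
  exists b' c', [/\ phi (pmx 0 b' c') = pmx 0 b c, b' = b'^T & c' = - c'^T].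
Proof.
move=> sb sc; have : pmx 0 b c \in P_part F m true by apply/P_oddP; exists b, c.
rewrite -(phiP.1 true) => /memv_imgP[x /P_oddP[b' [c' [-> sb' sc']]] xE].
by exists b', c'.
Qed.

Lemma aut_act a b c a' b' c' : \tr a = 0 -> b = b^T -> c = - c^T ->
  phi (pmx a 0 0) = pmx a' 0 0 -> phi (pmx 0 b c) = pmx 0 b' c' ->
  phi (pmx 0 (act_sym a b) (act_skew a c)) =
    pmx 0 (act_sym a' b') (act_skew a' c').
Proof.
move=> ta sb sc aE bcE; rewrite -!supercommutator_even_odd -aE -bcE aut_mul //.
  by rewrite mem_pmx ta !trmx0 oppr0 !eqxx.
by rewrite mem_pmx mxtrace0 -sb -sc !eqxx.
Qed.

Lemma rank1_trace u w : w^T *m u = 0 -> \tr (u *m w^T) = 0.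
Proof. by move=> wu; rewrite mxtrace_mulC wu mxtrace0. Qed.

Lemma skew0 : 0 = - 0^T :> 'M[F]_m.
Proof. by rewrite trmx0 oppr0. Qed.

Lemma sym0 : 0 = 0^T :> 'M[F]_m.
Proof. by rewrite trmx0. Qed.

(** For a with a^2 = 0 the cube of ad a vanishes on both odd blocks, and phi carries this over to a'
    on the symmetric block. The preimage of a symmetric matrix may have a skew component, so both
    blocks are followed. *)
Lemma aut_rank1_square0 u w a' : w^T *m u = 0 ->
  phi (pmx (u *m w^T) 0 0) = pmx a' 0 0 -> a' *m a' = 0.
Proof.
move=> wu; have ta := rank1_trace wu.
have aa : (u *m w^T) *m (u *m w^T) = 0.
  by rewrite mulmxA -(mulmxA u) wu mulmx0 mul0mx.
move: (u *m w^T) ta aa => a ta aa aE.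
apply: ad_cube0_square0 => b sb.
have [b' [c' [bE sb' sc']]] := aut_odd_onto sb skew0.
have E1 := aut_act ta sb' sc' aE bE.
have E2 := aut_act ta (act_sym_tr a sb') (act_skew_tr a sc') aE E1.
have := aut_act ta (act_sym_tr a (act_sym_tr a sb'))
  (act_skew_tr a (act_skew_tr a sc')) aE E2.
have -> : act_sym a (act_sym a (act_sym a b')) = 0.
  rewrite act_sym_square0 // /act_sym mulmxDr !mulmxA aa mul0mx add0r.
  by rewrite -!mulmxA -trmx_mul aa trmx0 !mulmx0 scaler0.
have -> : act_skew a (act_skew a (act_skew a c')) = 0.
  rewrite act_skew_square0 // /act_skew mulmxN mulNmx mulmxDr mulmxDl !mulmxA.
  rewrite -trmx_mul aa trmx0 !mul0mx add0r -!mulmxA aa !mulmx0 oppr0.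
  by rewrite scaler0.
by rewrite pmx0 linear0 -pmx0 => /pmx_inj[].
Qed.

Lemma closed_sqrt (z : F) : exists y, y ^+ 2 = z.
Proof.
have [y yE] := @solve_monicpoly F 2 (fun i => z *+ (i == 0%N)) isT.
exists y; rewrite yE big_ord_recl big_ord1 /= expr0 mulr1 mulr0n mul0r.
by rewrite addr0.
Qed.

(** Put a = u w^T with w orthogonal to u. The square of ad a sends an odd element (b, c) to twice
    (w^T b w) u u^T, the skew component vanishing because u^T c u = 0. On the image side the square
    of ad a' sends v v^T to twice (a' v)(a' v)^T. Taking (b, c) to be the preimage of v v^T, with a'
    v <> 0, compares the two. *)
Lemma aut_rank1 u : u != 0 ->
  exists2 p : 'cV[F]_m, p != 0 & phi (pmx 0 (u *m u^T) 0) = pmx 0 (p *m p^T) 0.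
Proof.
move=> u0; have [w w0 wu] := orthogonal_vector u; have ta := rank1_trace wu.
have [a' aE _] := aut_even ta; set a := u *m w^T in ta aE.
have aa' : a' *m a' = 0 := aut_rank1_square0 wu aE.
have aa : a *m a = 0 by rewrite /a mulmxA -(mulmxA u) wu mulmx0 mul0mx.
have a0 : a != 0.
  apply/eqP => a0; have /cV0Pn[i wi] := w0.
  have : a *m delta_mx i (0 : 'I_1) = 0 by rewrite a0 mul0mx.
  rewrite /a -mulmxA -colE => /eqP.
  have -> : col i w^T = (w i 0)%:M by apply/matrixP => k l; rewrite !ord1 !mxE eqxx.
  by rewrite mul_mx_scalar scaler_eq0 (negbTE wi) (negbTE u0).
have a'0 : a' != 0.
  apply: contraNneq a0 => a'0; move: aE; rewrite a'0 pmx0.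
  move/(aut_eq0 _); rewrite mem_pmx ta !trmx0 oppr0 !eqxx -pmx0.
  by move/(_ isT)/pmx_inj => [->].
have [v av0] := mx_neq0_col a'0.
have [b [c [bE sb sc]]] := aut_odd_onto (sym_rank1 v) skew0.
have E1 := aut_act ta sb sc aE bE.
have := aut_act ta (act_sym_tr a sb) (act_skew_tr a sc) aE E1.
rewrite !act_sym_square0 // !act_skew_square0 // mulmx0 mul0mx scaler0.
have -> : a^T *m c *m a = 0.
  rewrite /a trmx_mul trmxK -!mulmxA (mulmxA u^T) (mulmxA (u^T *m c)).
  by rewrite (sym_skew_form charF0 u sc) mul0mx mulmx0.
have -> : a *m b *m a^T = (w^T *m (b *m w)) 0 0 *: (u *m u^T).
  rewrite /a trmx_mul trmxK -!mulmxA (mulmxA b) (mulmxA w^T).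
  move: (w^T *m _) => s; rewrite [s in LHS]mx11_scalar mul_scalar_mx.
  by rewrite scalemxAr.
have -> : a' *m (v *m v^T) *m a'^T = (a' *m v) *m (a' *m v)^T.
  by rewrite trmx_mul !mulmxA.
set q := a' *m v in av0 *; set k := _ 0 0; rewrite scaler0.
have -> : pmx 0 (2 *: (k *: (u *m u^T))) 0 = (2 * k) *: pmx 0 (u *m u^T) 0.
  by rewrite pmxZ !scaler0 scalerA.
rewrite linearZ /= => kE.
have k0 : k != 0.
  apply: contraNneq av0 => k0; move: kE; rewrite k0 mulr0 scale0r -pmx0.
  move/pmx_inj => [_ /esym/eqP + _].
  by rewrite scaler_eq0 (negbTE (natF_neq0 charF0 1)) rank1_eq0.
have k20 : 2 * k != 0 by rewrite mulf_neq0 ?(natF_neq0 charF0 1).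
(* The scalar k is absorbed into the vector by a square root. *)
have [y yE] := closed_sqrt k^-1.
exists (y *: q).
  rewrite scaler_eq0 negb_or av0 andbT -sqrf_eq0 yE invr_eq0 //.
apply: (scalerI k20); rewrite kE pmxZ !scaler0; congr pmx.
rewrite [(y *: q)^T]linearZ /= -scalemxAl -scalemxAr !scalerA -!mulrA.
by rewrite -expr2 yE mulfV // mulr1.
Qed.

(* With [p p^T] the image of [u u^T], equivariance under the rank one
   nilpotents [v w^T] turns [phi (u . v) = p . (x v)] into
   [phi (v v^T) = (x v)(x v)^T]. *)
Lemma aut_sym_rank1 : exists x : 'M[F]_m,
  forall v, phi (pmx 0 (v *m v^T) 0) = pmx 0 ((x *m v) *m (x *m v)^T) 0.
Proof.
pose u : 'cV[F]_m := delta_mx ord0 0.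
have u0 : u != 0 by apply/cV0Pn; exists ord0; rewrite mxE !eqxx oner_eq0.
have [p p0 pE] := aut_rank1 u0.
(* Candidates for the columns of x. For j <> 0 the nilpotent e_j u^T sends u u^T to the product
   u.e_j; for j = 0 the vector p itself works. *)
have colx j : exists q, phi (pmx 0 (sprod u (delta_mx j 0)) 0) = pmx 0 (sprod p q) 0.
  have [-> | j0] := eqVneq j ord0.
    exists p; rewrite !sprodpp.
    have P2 b : pmx 0 (2 *: b) 0 = 2 *: pmx 0 b 0 :> 'M[F]_(m + m).
      by rewrite pmxZ !scaler0.
    by rewrite !P2 linearZ /= pE.
  have wu : u^T *m delta_mx j (0 : 'I_1) = 0.
    rewrite /u trmx_delta -rowE; apply/matrixP => k l.
    by rewrite !mxE eq_sym (negbTE j0).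
  have [a' aE _] := aut_even (rank1_trace wu).
  exists (a' *m p); have := aut_act (rank1_trace wu) (sym_rank1 u) skew0 aE pE.
  rewrite !act_sym_rank1 /act_skew !mulmx0 !mul0mx !addr0 !oppr0 -mulmxA.
  have -> : u^T *m u = 1%:M.
    by apply/matrixP => k l; rewrite /u trmx_delta -rowE !mxE !ord1 eqxx.
  by rewrite mulmx1 sprodC => ->; rewrite sprodC.
pose q j := projT1 (constructive_indefinite_description _ (colx j)).
have qE j : phi (pmx 0 (sprod u (delta_mx j 0)) 0) = pmx 0 (sprod p (q j)) 0.
  by rewrite /q; case: constructive_indefinite_description.
pose x : 'M[F]_m := \matrix_(i, j) q j i 0.
have pS (I : finType) (f : I -> 'M[F]_m) :
    pmx 0 (\sum_i f i) 0 = \sum_i pmx 0 (f i) 0 :> 'M[F]_(m + m).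
  by apply: (big_morph (fun b => pmx 0 b 0)) => [b b'|];
    rewrite ?pmx0 // pmxD !addr0.
have sS (I : finType) r (k : I -> F) (f : I -> 'cV[F]_m) :
    sprod r (\sum_i k i *: f i) = \sum_i k i *: sprod r (f i).
  rewrite sprodC (big_morph (fun y => sprod y r) (fun y z => sprodDl y z r)
    (sprod0l r)).
  by apply: eq_bigr => i _; rewrite sprodZl sprodC.
have p0Z k (b : 'M[F]_m) : pmx 0 (k *: b) 0 = k *: pmx 0 b 0 :> 'M[F]_(m + m).
  by rewrite pmxZ !scaler0.
have xE v : phi (pmx 0 (sprod u v) 0) = pmx 0 (sprod p (x *m v)) 0.
  have vE : v = \sum_i v i 0 *: delta_mx i 0.
    by rewrite {1}[v]matrix_sum_delta; apply: eq_bigr => i _; rewrite big_ord1.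
  have -> : x *m v = \sum_i v i 0 *: q i.
    apply/matrixP => k l; rewrite ord1 !mxE summxE; apply: eq_bigr => i _.
    by rewrite !mxE mulrC.
  rewrite {1}vE !sS !pS linear_sum; apply: eq_bigr => i _.
  by rewrite !p0Z linearZ /= qE.
exists x => v.
have xu : x *m u = p.
  apply: (sprod_inj charF0 p0); have := xE u.
  by rewrite !sprodpp !p0Z linearZ /= pE -p0Z -sprodpp => /pmx_inj[].
have [i vi | v0] := pickP (fun i => (i != ord0) && (v i 0 != 0)); last first.
  have -> : v = v ord0 0 *: u.
    apply/matrixP => i j; rewrite ord1 !mxE eqxx andbT.
    have [-> | i0] := eqVneq i ord0; first by rewrite mulr1.
    by have := v0 i; rewrite i0 /= mulr0 => /negbFE/eqP.
  rewrite -scalemxAr xu ![(_ *: _)^T]linearZ /= -!scalemxAl -!scalemxAr.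
  by rewrite !p0Z !linearZ /= pE.
case/andP: vi => i0 vi.
(* Chosen so that w^T u = 1 and w^T v = 0: then a = v w^T is nilpotent and sends u to v, and half
   the square of ad a carries u u^T to v v^T. *)
pose w : 'cV[F]_m := delta_mx ord0 0 - (v ord0 0 / v i 0) *: delta_mx i 0.
have wT : w^T = delta_mx 0 ord0 - (v ord0 0 / v i 0) *: delta_mx 0 i.
  by rewrite /w linearB /= [(_ *: _)^T]linearZ /= !trmx_delta.
have wu : w^T *m u = 1%:M.
  rewrite wT mulmxBl -scalemxAl -!rowE; apply/matrixP => k l.
  by rewrite !mxE !ord1 !eqxx (negbTE i0) mulr0 subr0.
have wv : w^T *m v = 0.
  rewrite wT mulmxBl -scalemxAl -!rowE; apply/matrixP => k l.
  by rewrite !mxE !ord1 divfK // subrr.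
have ta := rank1_trace wv; have [a' aE _] := aut_even ta.
have aa' := aut_rank1_square0 wv aE.
have aa : (v *m w^T) *m (v *m w^T) = 0.
  by rewrite mulmxA -(mulmxA v) wv mulmx0 mul0mx.
have au : v *m w^T *m u = v by rewrite -mulmxA wu mulmx1.
move: (v *m w^T) ta aE aa au => a ta aE aa au.
have E1 := aut_act ta (sym_rank1 u) skew0 aE pE.
have skewE0 d : act_skew d 0 = 0 by rewrite /act_skew mulmx0 mul0mx addr0 oppr0.
have a'p : a' *m p = x *m v.
  apply: (sprod_inj charF0 p0); have := xE v.
  move: E1; rewrite !skewE0 !act_sym_rank1 au sprodC [sprod (_ *m p) p]sprodC.
  by move=> -> /pmx_inj[].
have := aut_act ta (act_sym_tr a (sym_rank1 u)) (act_skew_tr a skew0) aE E1.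
rewrite !skewE0 !act_sym_square0 // !p0Z linearZ /= => /(scalerI (natF_neq0 charF0 1)).
rewrite !mulmxA -!(mulmxA _ _ a^T) -!(mulmxA _ _ a'^T) -!trmx_mul -!mulmxA.
by rewrite !mulmxA au a'p.
Qed.

Lemma aut_sym : exists2 x : 'M[F]_m, x \in unitmx &
  forall b, b = b^T -> phi (pmx 0 b 0) = pmx 0 (x *m b *m x^T) 0.
Proof.
have [x xE] := aut_sym_rank1; exists x.
  rewrite unitmxE unitfE -det_tr; apply/negP => /det0P[w w0 wx].
  have xw : x *m w^T = 0 by rewrite -[x]trmxK -trmx_mul wx trmx0.
  have /aut_eq0 : phi (pmx 0 (w^T *m w^T^T) 0) = 0.
    by rewrite xE xw mul0mx pmx0.
  rewrite mem_pmx mxtrace0 -sym_rank1 -skew0 !eqxx -pmx0 => /(_ isT)/pmx_inj[_].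
  by move/eqP; rewrite rank1_eq0 // trmx_eq0 (negbTE w0).
move=> b sb; apply/eqP; rewrite -subr_eq0; apply/eqP.
pose f b := phi (pmx 0 b 0) - pmx 0 (x *m b *m x^T) 0.
apply: (rank1_span_sym charF0 (g := f)) => // [k c c' | v]; rewrite /f.
  have E d d' : pmx 0 (k *: d + d') 0 = k *: pmx 0 d 0 + pmx 0 d' 0 :> 'M[F]_(m + m).
    by rewrite pmxZ pmxD !scaler0 !addr0.
  rewrite mulmxDr mulmxDl -scalemxAr -scalemxAl !E linearP scalerBr opprD.
  by rewrite addrACA.
by rewrite xE trmx_mul !mulmxA subrr.
Qed.

(** Applying phi to the action of a on v v^T gives (a' x v).(x v) = (x a v).(x v), where the factor
    x v can be cancelled. *)
Lemma aut_even_conj x a : x \in unitmx ->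
    (forall b, b = b^T -> phi (pmx 0 b 0) = pmx 0 (x *m b *m x^T) 0) ->
  \tr a = 0 -> phi (pmx a 0 0) = pmx (x *m a *m invmx x) 0 0.
Proof.
move=> ux xE ta; have [a' aE _] := aut_even ta; rewrite aE; congr pmx.
suff : a' *m x = x *m a by move <-; rewrite mulmxK.
have xvE v : phi (pmx 0 (v *m v^T) 0) = pmx 0 ((x *m v) *m (x *m v)^T) 0.
  by rewrite (xE _ (sym_rank1 v)) trmx_mul !mulmxA.
have conjE p q : x *m sprod p q *m x^T = sprod (x *m p) (x *m q).
  by rewrite /sprod mulmxDr mulmxDl !trmx_mul !mulmxA.
apply/eqP; rewrite -subr_eq0; apply: contraT => /mx_neq0_col[v].
rewrite mulmxBl subr_eq0 => /eqP[]; rewrite -!mulmxA.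
have [-> | v0] := eqVneq v 0; first by rewrite !mulmx0.
have xv0 : x *m v != 0.
  by apply: contraNneq v0 => xv0; rewrite -(mulKmx ux v) xv0 mulmx0.
apply: (sprod_inj charF0 xv0).
have := aut_act ta (sym_rank1 v) skew0 aE (xvE v).
rewrite !act_sym_rank1 /act_skew !mulmx0 !mul0mx !addr0 oppr0.
rewrite (xE _ (sprod_sym _ _)) conjE => /pmx_inj[_ e _].
by rewrite sprodC -e sprodC.
Qed.

End Automorphisms.

(** * Automorphisms fixing the even part and the symmetric block *)

Section AutomorphismTheorem.
Variables (F : closedFieldType) (n : nat).
Hypotheses (charF0 : [pchar F] =i pred0) (n_gt0 : (0 < n)%N).
Local Notation m := n.+1.
Local Notation P := (P_space F m).
Variable phi : 'End('M[F]_(m + m)).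
Hypothesis phiP : is_automorphism (@supercommutator F m) (@P_part F m) phi.

Lemma form_eq0 (b : 'M[F]_m) : b = b^T ->
  (forall v : 'cV[F]_m, v^T *m b *m v = 0) -> b = 0.
Proof.
move=> sb vbv; apply/matrixP => i j; rewrite mxE.
have bE k l : (delta_mx k 0 : 'cV[F]_m)^T *m b *m delta_mx l 0 = (b k l)%:M.
  rewrite trmx_delta -rowE -colE.
  by apply/matrixP => r s; rewrite !ord1 !mxE eqxx.
have := vbv (delta_mx i 0 + delta_mx j 0).
rewrite [(_ + _)^T]linearD /= mulmxDl mulmxDl !mulmxDr !vbv add0r addr0 !bE.
rewrite {2}sb [b^T j i]mxE => /matrixP/(_ 0 0); rewrite !mxE eqxx /=.
by move/eqP; rewrite -mulr2n -mulr_natl mulf_eq0 (negbTE (natF_neq0 charF0 1)) => /eqP.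
Qed.

Definition wedge (u w : 'cV[F]_m) := u *m w^T - w *m u^T.

Lemma wedge_skew u w : wedge u w = - (wedge u w)^T.
Proof. by rewrite /wedge linearB /= !trmx_mul !trmxK opprB. Qed.

Hypothesis phi_even : forall a, \tr a = 0 -> phi (pmx a 0 0) = pmx a 0 0.
Hypothesis phi_sym : forall b, b = b^T -> phi (pmx 0 b 0) = pmx 0 b 0.

(** The bracket with the identity matrix in the symmetric block is the fixed element [pmx c 0 0], so
    the skew component of the image is again c. The image has zero bracket with itself, as its
    preimage does, and the upper left block of that bracket is 2 b c. *)
Lemma aut_skew (c : 'M[F]_m) : c = - c^T ->
  exists2 b, b = b^T & phi (pmx 0 0 c) = pmx 0 b c /\ b *m c = 0.
Proof.
move=> sc; have [b [c' [cE sb sc']]] := aut_odd phiP (sym0 _ _) sc.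
have P0c : pmx 0 0 c \in P by rewrite mem_pmx mxtrace0 -sc -(sym0 _ _) !eqxx.
have ec : c' = c.
  have s1 : 1%:M = (1%:M)^T :> 'M[F]_m by rewrite trmx1.
  have P1 : pmx 0 1%:M 0 \in P.
    by rewrite mem_pmx mxtrace0 -s1 -(skew0 _ _) !eqxx.
  have := aut_mul phiP P1 P0c; rewrite cE (phi_sym s1).
  rewrite !supercommutator_sym_skew // !mul1mx phi_even => [/pmx_inj[]//|].
  have /eqP : \tr c = - \tr c by rewrite -[in RHS]mxtrace_tr -linearN -sc.
  rewrite -addr_eq0 -mulr2n -mulr_natl mulf_eq0 (negbTE (natF_neq0 charF0 1)).
  by move/eqP.
exists b => //; rewrite cE ec; split=> //.
have := aut_mul phiP P0c P0c; rewrite cE ec.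
rewrite !supercommutator_block !mul0mx !mulmx0 !addr0 !subr0 trmx0 oppr0.
rewrite !mul0mx !mulmx0 !addr0 !subr0 add0r block_mx0 linear0.
rewrite -[X in X = _ -> _]block_mx0 => /eq_block_mx[/esym/eqP + _ _ _].
by rewrite add0r -mulr2n -scaler_nat scaler_eq0 (negbTE (natF_neq0 charF0 1)) => /eqP.
Qed.

(** The deviation b depends equivariantly on c. For c the wedge of e_i and e_j, the relation b c = 0
    gives b e_i = b e_j = 0. For w orthogonal to e_i and e_j, the element a = e_i w^T sends c to the
    wedge of e_j and w, whose deviation [act_sym a b] annihilates that wedge; this gives w^T b w =
    0. So the quadratic form of b vanishes. *)
Lemma aut_wedge i j : i != j -> phi (pmx 0 0 (wedge (delta_mx i 0) (delta_mx j 0)))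
   = pmx 0 0 (wedge (delta_mx i 0) (delta_mx j 0)).
Proof.
move=> ij; pose e k : 'cV[F]_m := delta_mx k 0.
have ee k l : (e k)^T *m e l = (k == l)%:R%:M.
  rewrite trmx_delta -rowE; apply/matrixP => r s.
  by rewrite !mxE !ord1 !eqxx andbT.
have ew k (w : 'cV[F]_m) : (e k)^T *m w = (w k 0)%:M.
  by rewrite trmx_delta -rowE; apply/matrixP => r s; rewrite !mxE !ord1 eqxx.
have s0 : (0%:M : 'M[F]_1) = 0.
  by apply/matrixP => r s; rewrite !mxE mul0rn.
rewrite -!/(e _); set c := wedge (e i) (e j).
have sc : c = - c^T := wedge_skew _ _.
have [b sb [cE bc]] := aut_skew sc.
have bei : b *m e i = 0.
  have := congr1 (fun x => x *m e j) bc; rewrite /= mul0mx -mulmxA.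
  rewrite /c /wedge mulmxBl -!mulmxA !ee eqxx (negbTE ij) mulmx1.
  by rewrite mul_mx_scalar scale0r subr0.
have bej : b *m e j = 0.
  have := congr1 (fun x => x *m e i) bc; rewrite /= mul0mx -mulmxA.
  rewrite /c /wedge mulmxBl -!mulmxA !ee eqxx eq_sym (negbTE ij) mulmx1.
  by rewrite mul_mx_scalar scale0r sub0r mulmxN => /eqP; rewrite oppr_eq0 => /eqP.
suff b0 : b = 0 by rewrite cE b0.
have wbw (w : 'cV[F]_m) : w i 0 = 0 -> w j 0 = 0 -> w^T *m b *m w = 0.
  move=> wi wj; have wei : w^T *m e i = 0.
    by rewrite -[LHS]trmxK trmx_mul trmxK ew wi s0 trmx0.
  have wej : w^T *m e j = 0.
    by rewrite -[LHS]trmxK trmx_mul trmxK ew wj s0 trmx0.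
  pose a := e i *m w^T; have ta : \tr a = 0 := rank1_trace wei.
  have actE : act_skew a c = wedge (e j) w.
    rewrite /act_skew /a /c /wedge trmx_mul trmxK mulmxBl mulmxBr.
    rewrite -!mulmxA !(mulmxA (e i)^T) !(mulmxA (e j)^T) !ee eqxx.
    rewrite [j == i]eq_sym (negbTE ij) !mul1mx !mul_scalar_mx !scale0r.
    by rewrite !mulmx0 subr0 sub0r opprB.
  have E := aut_act phiP ta (sym0 _ _) sc (phi_even ta) cE.
  rewrite actE in E; have [b1 _ [E1 b1c]] := aut_skew (wedge_skew (e j) w).
  move: E; rewrite [act_sym a 0](_ : _ = 0); last first.
    by rewrite /act_sym mulmx0 mul0mx addr0.
  rewrite E1 => /pmx_inj[_ b1E _]; rewrite b1E in b1c.
  have : act_sym a b *m (wedge (e j) w *m e j) = 0 by rewrite mulmxA b1c mul0mx.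
  rewrite [wedge (e j) w *m e j](_ : _ = - w); last first.
    by rewrite /wedge mulmxBl -!mulmxA wej ee eqxx mulmx0 mulmx1 sub0r.
  rewrite mulmxN => /eqP; rewrite oppr_eq0 /act_sym mulmxDl /a trmx_mul trmxK.
  rewrite -(mulmxA b) -(mulmxA w) ew wi s0 !mulmx0 addr0 => /eqP ebw.
  have : (e i)^T *m (e i *m w^T *m b *m w) = 0 by rewrite ebw mulmx0.
  by rewrite !mulmxA ee eqxx mul1mx.
(* Every v differs from such a w by a combination of e_i and e_j, which b kills. *)
apply: form_eq0 => // v; pose w := v - (v i 0 *: e i + v j 0 *: e j).
have bw : b *m v = b *m w.
  by rewrite /w mulmxBr mulmxDr -!scalemxAr bei bej !scaler0 addr0 subr0.
have wk k : w k 0 = v k 0 - (v i 0 * (k == i)%:R + v j 0 * (k == j)%:R).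
  by rewrite !mxE eqxx !andbT.
have bT (u : 'cV_m) : u^T *m b = (b *m u)^T by rewrite trmx_mul -sb.
rewrite bT bw -bT -mulmxA bw mulmxA wbw // wk eqxx ?[j == i]eq_sym (negbTE ij).
  by rewrite mulr1 mulr0 addr0 subrr.
by rewrite mulr1 mulr0 add0r subrr.
Qed.

Lemma aut_id x : x \in P -> phi x = x.
Proof.
case/P_spaceP => a [b [c [-> ta sb sc]]].
have -> : pmx a b c = pmx a 0 0 + pmx 0 b 0 + pmx 0 0 c.
  by rewrite !pmxD !addr0 !add0r.
rewrite !linearD /= phi_even // phi_sym //; congr (_ + _).
have p0S (I : finType) (f : I -> 'M[F]_m) :
    pmx 0 0 (\sum_i f i) = \sum_i pmx 0 0 (f i) :> 'M[F]_(m + m).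
  by apply: (big_morph (fun b => pmx 0 0 b)) => [d d'|];
    rewrite ?pmx0 // pmxD !addr0.
have p0Z k (d : 'M[F]_m) : pmx 0 0 (k *: d) = k *: pmx 0 0 d :> 'M[F]_(m + m).
  by rewrite pmxZ !scaler0.
have gen (g : 'I_m -> 'I_m -> F) (y := \sum_i \sum_j g i j *: delta_mx i j) :
    y - y^T = \sum_i \sum_j g i j *: wedge (delta_mx i 0) (delta_mx j 0).
  rewrite linear_sum -sumrB; apply: eq_bigr => i _ /=.
  rewrite linear_sum -sumrB; apply: eq_bigr => j _ /=.
  by rewrite linearZ /= trmx_delta -scalerBr /wedge !trmx_delta !mul_delta_mx.
have e : 2 *: c = \sum_i \sum_j c i j *: wedge (delta_mx i 0) (delta_mx j 0).
  by rewrite -gen -matrix_sum_delta -sc scaler_nat mulr2n.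
apply: (scalerI (natF_neq0 charF0 1)); rewrite -linearZ -!p0Z e !p0S linear_sum.
apply: eq_bigr => i _; rewrite !p0S linear_sum; apply: eq_bigr => j _.
rewrite /= p0Z linearZ /=; have [-> | ij] := eqVneq i j; last by rewrite aut_wedge.
by rewrite /wedge subrr pmx0 linear0.
Qed.

End AutomorphismTheorem.

(** Composing phi with [Ad (invmx x)], for the x found on the symmetric block, leaves an
    automorphism that fixes the even part and the symmetric block, to which [aut_id] applies. *)
Theorem automorphism_Ad (F : closedFieldType) n (phi : 'End('M[F]_(n.+1 + n.+1))) :
    [pchar F] =i pred0 -> (0 < n)%N ->
    is_automorphism (@supercommutator F n.+1) (@P_part F n.+1) phi ->
  exists2 x, x \in unitmx & {in P_space F n.+1, forall v, phi v = Ad x v}.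
Proof.
move=> charF0 n_gt0 phiP; have [x ux xE] := aut_sym charF0 n_gt0 phiP.
have aE a ta := @aut_even_conj F n charF0 phi phiP x a ux xE ta.
exists x => // v Pv; pose y := invmx x; have uy : y \in unitmx by rewrite unitmx_inv.
pose psi := (linfun (Ad y) \o phi)%VF.
have psiE w : psi w = Ad y (phi w) by rewrite comp_lfunE lfunE.
have adP := Ad_automorphism uy.
have psiP : is_automorphism (@supercommutator F n.+1) (@P_part F n.+1) psi.
  split=> [i | w w' Pw Pw']; first by rewrite limg_comp phiP.1 adP.1.
  by rewrite !psiE phiP.2 // Ad_supercommutator.
suff : psi v = v by rewrite psiE => /(congr1 (Ad x)); rewrite AdVK.
apply: (aut_id charF0 psiP) => // [a ta | b sb]; rewrite psiE ?aE ?xE //.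
  by rewrite -[RHS](AdK ux) (Ad_pmx x) !mulmx0 !mul0mx.
by rewrite -[RHS](AdK ux) (Ad_pmx x) !mulmx0 !mul0mx.
Qed.

(** * Gradings *)

Section DirectSums.
Variables (F : fieldType) (V : vectType F) (G : eqType).
Implicit Types (Gam : G -> {vspace V}) (S : seq G).

(** Families are indexed by all of G rather than by positions in S; the two views agree because S
    has no repetitions. *)
Lemma directv_seqP Gam S : uniq S ->
  directv (\sum_(g <- S) Gam g) <->
  (forall x : G -> V, (forall g, x g \in Gam g) -> \sum_(g <- S) x g = 0 ->
     {in S, forall g, x g = 0}).
Proof.
move=> uS; case: S uS => [|g0 S0] uS.
  by split=> // _; rewrite directvE /= !big_nil dimv0.
set S := g0 :: S0 in uS *.
have -> : directv (\sum_(g <- S) Gam g) =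
          directv (\sum_(i < size S) Gam (nth g0 S i)).
  by rewrite !directvE /= !(big_nth g0) !big_mkord.
split=> [/directv_sum_independent dS x xG | dS].
  rewrite (big_nth g0) big_mkord => x0 g gS.
  have := dS (fun i => x (nth g0 S i)) (fun i _ => xG _) x0.
  move/(_ (Ordinal (etrans (index_mem g S) gS)) isT) => /=.
  by rewrite nth_index.
apply/directv_sum_independent => us usG us0 i _.
pose x g := if insub (index g S) is Some j then us j else 0.
have xE (j : 'I_(size S)) : x (nth g0 S j) = us j.
  by rewrite /x index_uniq // valK.
rewrite -xE; apply: dS; last exact: mem_nth.
  move=> g; rewrite /x; case: insubP => [j _ jE | _]; last exact: mem0v.
  have -> : g = nth g0 S (val j).
    by rewrite jE nth_index // -index_mem -jE; exact: ltn_ord j.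
  exact: usG.
rewrite (big_nth g0) big_mkord -[RHS]us0; apply: eq_bigr => j _; exact: xE.
Qed.

End DirectSums.

Section GradingTheory.
Variables (F : fieldType) (V : vectType F) (mul : V -> V -> V).
Variable L : bool -> {vspace V}.
Local Notation W := (total_space L).

Section OneGrading.
Variables (G : zmodType) (Gam : G -> {vspace V}).
Hypothesis gradG : is_grading mul L Gam.

Lemma grading_sub g : (Gam g <= W)%VS.
Proof.
case: gradG => -[S [_ sS _ <-]] _ _; have [-> | g0] := eqVneq (Gam g) 0%VS.
  exact: sub0v.
have gS : g \in S by exact: sS.
by rewrite (big_rem g) //= addvSl.
Qed.

Lemma grading_homogeneous g h v :
  v \in Gam g -> v \in Gam h -> v != 0 -> g = h.
Proof.
case: gradG => -[S [uS sS dS _]] _ _ vg vh v0.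
have Gv k : v \in Gam k -> k \in S.
  move=> vk; apply: sS; rewrite unfold_in; apply: contraNneq v0 => Gk0.
  by rewrite Gk0 memv0 in vk.
(* If g <> h, the family with v in degree g and -v in degree h sums to 0, against directness. *)
apply/eqP; apply: contraT => gh; pose x k := if k == g then v else
  if k == h then - v else 0.
have xG k : x k \in Gam k.
  rewrite /x; case: eqP => [-> //|_]; case: eqP => [->|_]; last exact: mem0v.
  by rewrite memvN.
suff x0 : \sum_(k <- S) x k = 0.
  move/(directv_seqP _ uS): dS => /(_ x xG x0 g (Gv g vg)).
  by rewrite /x eqxx => v00; rewrite v00 eqxx in v0.
have -> : \sum_(k <- S) x k = \sum_(k <- S) (v *+ (k == g) - v *+ (k == h)).
  apply: eq_bigr => k _; rewrite /x; case: eqP => [->|_].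
    by rewrite (negbTE gh) subr0.
  by rewrite sub0r; case: eqP; rewrite ?mulr1n ?mulr0n ?oppr0.
have sum1 k : k \in S -> \sum_(l <- S) v *+ (l == k) = v.
  move=> kS; rewrite (bigD1_seq k) //= eqxx big1 ?addr0 // => l /negbTE -> //.
by rewrite sumrB !sum1 ?Gv // subrr.
Qed.

Lemma grading_projections : exists S (pr : G -> 'End(V)),
  [/\ uniq S, forall g v, pr g v \in Gam g,
      forall v, v \in W -> v = \sum_(g <- S) pr g v,
      forall g h v, v \in Gam g -> pr h v = v *+ (h == g)
    & forall g, (Gam g != 0)%VS -> g \in S].
Proof.
case: (gradG) => -[S [uS sS dS defW]] _ _.
pose pi := sumv_pi_for (esym defW).
(* Projections of degrees outside S are 0, so that [pr g v] lies in [Gam g] for every g. *)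
pose pr g : 'End(V) := if g \in S then pi g else 0.
have prG g v : pr g v \in Gam g.
  rewrite /pr; case: ifP => _; first exact: memv_sum_pi.
  by rewrite lfunE mem0v.
have uS' : uniq [seq g <- S | true] by rewrite filter_predT.
have prS v : v \in W -> v = \sum_(g <- S) pr g v.
  move=> Wv; rewrite -{1}(sumv_pi_uniq_sum (esym defW) uS' Wv).
  by rewrite big_seq [RHS]big_seq; apply: eq_bigr => g gS; rewrite /pr gS.
exists S, pr; split=> // g h v vg.
have [-> | v0] := eqVneq v 0; first by rewrite linear0 mul0rn.
have gS : g \in S.
  apply: sS; rewrite unfold_in; apply: contraNneq v0 => Gk0.
  by rewrite Gk0 memv0 in vg.
pose x k := pr k v - v *+ (k == g).
have xG k : x k \in Gam k.
  by rewrite /x memvB //; case: eqP => [->|_]; rewrite ?mem0v.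
have x0 : \sum_(k <- S) x k = 0.
  rewrite sumrB -prS; last exact: subvP (grading_sub g) _ vg.
  by rewrite (bigD1_seq g) //= eqxx big1 ?addr0 ?subrr // => l /negbTE ->.
have [hS | hS] := boolP (h \in S).
  move/(directv_seqP _ uS): dS => /(_ x xG x0 h hS).
  by move/eqP; rewrite subr_eq0 => /eqP.
rewrite /pr (negbTE hS) lfunE /=; case: eqP => // hg.
by rewrite hg gS in hS.
Qed.

Lemma grading_ind (Q : V -> Prop) :
  Q 0 -> (forall u v, Q u -> Q v -> Q (u + v)) ->
  (forall g v, v \in Gam g -> Q v) -> {in W, forall v, Q v}.
Proof.
move=> Q0 QD QG v Wv; have [S [pr [_ prG prS _ _]]] := grading_projections.
rewrite (prS v Wv); apply: (big_ind Q) => // g _; exact: QG (prG g v).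
Qed.

Lemma grading_homo_parts g v : v \in Gam g ->
  exists v0 v1, [/\ v = v0 + v1, v0 \in (Gam g :&: L false)%VS
    & v1 \in (Gam g :&: L true)%VS].
Proof.
case: gradG => _ gradL _; rewrite {1}gradL => /memv_addP[v0 vG0 [v1 vG1 ->]].
by exists v0, v1.
Qed.

Lemma grading_scaling (c : G -> F) :
  exists phi : 'End(V), forall g v, v \in Gam g -> phi v = c g *: v.
Proof.
have [S [pr [uS prG prS prid prS']]] := grading_projections.
exists (\sum_(g <- S) c g *: pr g) => g v vg.
have [-> | v0] := eqVneq v 0; first by rewrite linear0 scaler0.
have Wv : v \in W := subvP (grading_sub g) _ vg.
rewrite sum_lfunE [in RHS](prS v Wv) scaler_sumr; apply: eq_bigr => h _.
rewrite scale_lfunE (prid _ h _ vg); case: eqP => [-> //|_].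
by rewrite !scaler0.
Qed.

(** Multiplicativity is imposed only where a product is nonzero. For functions without zeros on the
    support this describes the characters of the universal group, which need not come from G. *)
Definition multiplicative_on (c : G -> F) := forall g h x y,
  x \in Gam g -> y \in Gam h -> mul x y != 0 -> c (g + h) = c g * c h.

Lemma grading_mul g h x y : x \in Gam g -> y \in Gam h -> mul x y \in Gam (g + h).
Proof. by case: gradG => _ _; apply. Qed.

Hypothesis mulDl : forall x y z, mul (x + y) z = mul x z + mul y z.
Hypothesis mulDr : forall x y z, mul x (y + z) = mul x y + mul x z.
Hypothesis mulZl : forall k x y, mul (k *: x) y = k *: mul x y.
Hypothesis mulZr : forall k x y, mul x (k *: y) = k *: mul x y.

Hypothesis Ldirect : (L false :&: L true = 0)%VS.

(** Components are sums of their parity parts, so an element of L i is a sum of homogeneous elements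
    of L i: the parts of opposite parity add up to 0, as the two parities meet trivially. *)
Lemma grading_part_ind i (Q : V -> Prop) :
  Q 0 -> (forall u v, Q u -> Q v -> Q (u + v)) ->
  (forall g v, v \in Gam g -> v \in L i -> Q v) -> {in L i, forall v, Q v}.
Proof.
move=> Q0 QD QG v Lv.
suff [u [w [vE uL wL Qu]]] : exists u w, [/\ v = u + w, u \in L i, w \in L (~~ i) & Q u].
  have w0 : w = 0.
    apply/eqP; rewrite -memv0 -Ldirect memv_cap.
    have : w \in L i by have -> : w = v - u by [rewrite vE addrC addKr]; exact: memvB.
    by case: (i) wL => -> ->.
  by rewrite vE w0 addr0.
have Wv : v \in W.
  by apply: subvP Lv; case: (i); [exact: addvSr | exact: addvSl].
move: v Wv {Lv}; apply: grading_ind => [|x y [u [w [-> uL wL Qu]]] [u' [w' [-> uL' wL' Qu']]]|g x xg].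
- by exists 0, 0; rewrite addr0 !mem0v.
- by exists (u + u'), (w + w'); rewrite addrACA !memvD //; split=> //; exact: QD.
have [v0 [v1 [-> /memv_capP[v0G v0L] /memv_capP[v1G v1L]]]] := grading_homo_parts xg.
case: (i) QG => QG; [exists v1, v0 | exists v0, v1]; split=> //.
- by rewrite addrC.
- exact: QG v1G v1L.
- exact: QG v0G v0L.
Qed.

Lemma scaling_automorphism (c : G -> F) (phi : 'End(V)) :
    (forall g v, v \in Gam g -> phi v = c g *: v) ->
    (forall g, (Gam g != 0)%VS -> c g != 0) -> multiplicative_on c ->
  is_automorphism mul L phi.
Proof.
move=> phiE c0 cM; have mul0l x : mul 0 x = 0.
  by have := mulZl 0 0 x; rewrite !scale0r.
have mul0r x : mul x 0 = 0.
  by have := mulZr 0 x 0; rewrite !scale0r.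
split=> [i|]; last first.
  move=> x y Wx Wy; move: x Wx; apply: grading_ind => [|u v IHu IHv|g u ug].
  - by rewrite mul0l linear0 mul0l.
  - by rewrite mulDl !linearD /= mulDl IHu IHv.
  move: y Wy; apply: grading_ind => [|v w IHv IHw|h v vh].
  - by rewrite mul0r linear0 mul0r.
  - by rewrite mulDr !linearD /= mulDr IHv IHw.
  rewrite (phiE _ _ ug) (phiE _ _ vh) mulZl mulZr scalerA.
  rewrite (phiE _ _ (grading_mul ug vh)).
  have [-> | uv0] := eqVneq (mul u v) 0; first by rewrite !scaler0.
  by rewrite (cM _ _ _ _ ug vh uv0).
apply/eqP; rewrite eqEsubv; apply/andP; split; apply/subvP => v.
  case/memv_imgP => w Lw ->; move: w Lw; apply: (grading_part_ind (Q := fun w => phi w \in L i)).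
  - by rewrite linear0 mem0v.
  - by move=> u w uL wL; rewrite linearD memvD.
  by move=> g w wg wL; rewrite (phiE _ _ wg) memvZ.
move: v; apply: (grading_part_ind (Q := fun v => v \in (phi @: L i)%VS)) => [|u w uL wL|g w wg wL].
- exact: mem0v.
- exact: memvD.
have [-> | w0] := eqVneq w 0; first exact: mem0v.
have cg : c g != 0.
  by apply: c0; apply: contraNneq w0 => Gg0; rewrite Gg0 memv0 in wg.
apply/memv_imgP; exists ((c g)^-1 *: w); first exact: memvZ.
by rewrite linearZ /= (phiE _ _ wg) scalerA mulVf // scale1r.
Qed.

End OneGrading.
End GradingTheory.

Section SupercommutatorBilinear.
Variables (F : fieldType) (m : nat).
Implicit Types x y z : 'M[F]_(m + m).

Lemma supercommutatorDl x y z : supercommutator (x + y) z = supercommutator x z + supercommutator y z.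
Proof.
rewrite /supercommutator -big_split; apply: eq_bigr => i _ /=.
rewrite -big_split; apply: eq_bigr => j _ /=.
by rewrite linearD mulmxDl mulmxDr scalerDr opprD addrACA.
Qed.

Lemma supercommutatorDr x y z : supercommutator x (y + z) = supercommutator x y + supercommutator x z.
Proof.
rewrite /supercommutator -big_split; apply: eq_bigr => i _ /=.
rewrite -big_split; apply: eq_bigr => j _ /=.
by rewrite linearD mulmxDl mulmxDr scalerDr opprD addrACA.
Qed.

Lemma supercommutatorZl k x y : supercommutator (k *: x) y = k *: supercommutator x y.
Proof.
rewrite /supercommutator scaler_sumr; apply: eq_bigr => i _.
rewrite scaler_sumr; apply: eq_bigr => j _; rewrite linearZ /=.
by rewrite -scalemxAl -scalemxAr scalerBr !scalerA [k * _]mulrC.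
Qed.

Lemma supercommutatorZr k x y : supercommutator x (k *: y) = k *: supercommutator x y.
Proof.
rewrite /supercommutator scaler_sumr; apply: eq_bigr => i _.
rewrite scaler_sumr; apply: eq_bigr => j _; rewrite linearZ /=.
by rewrite -scalemxAl -scalemxAr scalerBr !scalerA [k * _]mulrC.
Qed.

Lemma supercommutator0l y : supercommutator 0 y = 0.
Proof. by have := supercommutatorZl 0 0 y; rewrite !scale0r. Qed.

Lemma supercommutator0r x : supercommutator x 0 = 0.
Proof. by have := supercommutatorZr 0 x 0; rewrite !scale0r. Qed.

Lemma P_part_direct : (P_part F m false :&: P_part F m true)%VS = 0%VS.
Proof.
apply/eqP; rewrite -subv0; apply/subvP => x /memv_capP[].
case/P_evenP => a -> _ /P_oddP[b [c [/pmx_inj[-> _ _] _ _]]].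
by rewrite pmx0 memv0.
Qed.

End SupercommutatorBilinear.

(** * Matrices acting by scalars on the components of a grading *)

Section ScalarActions.
Variables (F : fieldType) (m : nat) (G : zmodType) (Gam : G -> {vspace 'M[F]_(m + m)}).

Definition acts_by (x : 'M[F]_m) (c : G -> F) :=
  forall g v, v \in Gam g -> Ad x v = c g *: v.

(** For a grading of P(n), the invertible x of this kind represent, up to sign, the automorphisms
    that scale every component: the quasitorus of the grading. *)
Definition scalar_on (x : 'M[F]_m) :=
  forall g, exists c, forall v, v \in Gam g -> Ad x v = c *: v.

Lemma acts_by_scalar_on x c : acts_by x c -> scalar_on x.
Proof. by move=> xc g; exists (c g) => v; exact: xc. Qed.

End ScalarActions.

Lemma closed_eigenvector (F : closedFieldType) n (x : 'M[F]_n.+1) :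
  exists z (v : 'cV[F]_n.+1), v != 0 /\ x *m v = z *: v.
Proof.
have [z] : exists z, root (char_poly x^T) z.
  by apply/closed_rootP; rewrite size_char_poly.
rewrite -eigenvalue_root_char => /eigenvalueP[v vE v0].
exists z, v^T; rewrite trmx_eq0; split=> //.
by rewrite -[x]trmxK -trmx_mul vE linearZ.
Qed.

Lemma horner_mx_eigenvector (F : fieldType) n (x : 'M[F]_n.+1) z (v : 'cV[F]_n.+1) p :
  x *m v = z *: v -> horner_mx x p *m v = p.[z] *: v.
Proof.
move=> xv; elim/poly_ind: p => [|p c IHp].
  by rewrite rmorph0 mul0mx horner0 scale0r.
rewrite rmorphD rmorphM /= horner_mx_X horner_mx_C mulmxDl -mulmxE -mulmxA xv.
by rewrite -scalemxAr IHp scalerA !hornerE mul_scalar_mx -scalerDl mulrC.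
Qed.

Section PGradings.
Variables (F : closedFieldType) (n : nat).
Hypotheses (charF0 : [pchar F] =i pred0) (n_gt0 : (0 < n)%N).
Local Notation m := n.+1.
Local Notation bracket := (@supercommutator F m).
Local Notation P := (@P_part F m).

(** Difference of two squares: (p - q).(p + q) = 0 in the symmetric square. *)
Lemma rank1_inj (p q : 'cV[F]_m) : p *m p^T = q *m q^T -> p = q \/ p = - q.
Proof.
move=> pq; have /(sprod_eq0 charF0)[/eqP|/eqP] : sprod (p - q) (p + q) = 0.
- rewrite sprodDl -scaleN1r sprodZl ![sprod _ (p + q)]sprodC !sprodDl !sprodpp.
  by rewrite pq sprodC scaleN1r [_ + 2 *: _]addrC subrr.
- by rewrite subr_eq0 => /eqP; left.
- by rewrite addr_eq0 => /eqP; right.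
Qed.

(** With z = w^-1 u, the map b -> z b z^T is the identity on symmetric matrices. On e_i e_i^T this
    gives z e_i = e_i or -e_i, and on e_i.e_j it makes the signs equal. *)
Lemma Ad_inj_sign (u w : 'M[F]_m) : u \in unitmx -> w \in unitmx ->
  {in P_space F m, Ad u =1 Ad w} -> u = w \/ u = - w.
Proof.
move=> uu uw AdE; pose z := invmx w *m u.
have uz : u = w *m z by rewrite mulKVmx.
suff : z = 1%:M \/ z = - 1%:M.
  by rewrite uz => -[] ->; [left | right]; rewrite ?mulmxN mulmx1.
have zb (b : 'M_m) : b = b^T -> z *m b *m z^T = b.
  move=> sb; have : Ad u (pmx 0 b 0) = Ad w (pmx 0 b 0).
    by apply: AdE; rewrite mem_pmx mxtrace0 -sb -(skew0 _ _) !eqxx.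
  move/(congr1 (Ad (invmx w))); rewrite (AdK uw) (AdM _ (etrans (unitmx_inv w) uw) uu) -/z.
  by rewrite Ad_pmx => /pmx_inj[].
pose e i : 'cV[F]_m := delta_mx i 0.
have e0 i : e i != 0 by apply/cV0Pn; exists i; rewrite mxE !eqxx oner_eq0.
have ze i : exists k, z *m e i = k *: e i.
  have : (z *m e i) *m (z *m e i)^T = e i *m (e i)^T.
    by rewrite trmx_mul !mulmxA -(mulmxA z) zb //; exact: sym_rank1.
  case/rank1_inj => ->; first by exists 1; rewrite scale1r.
  by exists (-1); rewrite scaleN1r.
pose k i := projT1 (constructive_indefinite_description _ (ze i)).
have kE i : z *m e i = k i *: e i.
  by rewrite /k; case: constructive_indefinite_description.
have kk i j : k i * k j = 1.
  have := zb (sprod (e i) (e j)) (sprod_sym _ _).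
  have -> : z *m sprod (e i) (e j) *m z^T = sprod (z *m e i) (z *m e j).
    by rewrite /sprod mulmxDr mulmxDl !trmx_mul !mulmxA.
  rewrite !kE sprodZl sprodC sprodZl scalerA => /eqP.
  rewrite sprodC -subr_eq0 -{2}[sprod _ _]scale1r -scalerBl scaler_eq0 subr_eq0.
  case/orP => /eqP // /(sprod_eq0 charF0)[] ek0.
    by have := e0 i; rewrite ek0 eqxx.
  by have := e0 j; rewrite ek0 eqxx.
have zE : z = (k ord0)%:M.
  apply/matrixP => i j; have := congr1 (fun x : 'cV_m => x i 0) (kE j).
  rewrite /= -colE !mxE eqxx andbT => ->.
  have -> : k j = k ord0.
    have k0 : k ord0 != 0.
      by apply/eqP => k0; have /eqP := kk ord0 ord0;
        rewrite k0 mul0r eq_sym oner_eq0.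
    by apply: (mulfI k0); rewrite !kk.
  by rewrite mulr_natr.
have : (k ord0) ^+ 2 == 1 by rewrite expr2 kk.
rewrite sqrf_eq1 zE => /orP[] /eqP ->; first by left.
by right; apply/matrixP => i j; rewrite !mxE mulNrn.
Qed.

Section OneGrading.
Variables (G : zmodType) (Gam : G -> {vspace 'M[F]_(m + m)}).
Hypothesis gradG : is_grading bracket P Gam.

Local Notation acts_by := (acts_by Gam).

Lemma character_acts c :
    (forall g, (Gam g != 0)%VS -> c g != 0) -> multiplicative_on bracket Gam c ->
  exists2 x, x \in unitmx & acts_by x c.
Proof.
move=> c0 cM; have [phi phiE] := grading_scaling gradG c.
have phiP := scaling_automorphism gradG (@supercommutatorDl F m)
  (@supercommutatorDr F m) (@supercommutatorZl F m) (@supercommutatorZr F m)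
  (P_part_direct F m) phiE c0 cM.
have [x ux xE] := automorphism_Ad charF0 n_gt0 phiP.
exists x => // g v vg; rewrite -(phiE g v vg) xE // -total_P.
exact: subvP (grading_sub gradG g) _ vg.
Qed.

(** Scalars commute, so [Ad (x *m y)] and [Ad (y *m x)] agree on P, and only a sign remains. *)
Lemma scalar_on_commute x y : x \in unitmx -> y \in unitmx ->
  scalar_on Gam x -> scalar_on Gam y -> x *m y = y *m x \/ x *m y = - (y *m x).
Proof.
move=> ux uy xS yS; apply: Ad_inj_sign; rewrite ?unitmx_mul ?ux ?uy // => v.
rewrite -total_P; move: v; apply: (grading_ind gradG
  (Q := fun v => Ad (x *m y) v = Ad (y *m x) v)) => [|v1 v2 E1 E2|g w wg].
- by rewrite !linear0.
- by rewrite !linearD /= E1 E2.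
have [c xc] := xS g; have [d yd] := yS g.
rewrite -!AdM // (xc _ wg) (yd _ wg) !linearZ /= (xc _ wg) (yd _ wg).
by rewrite !scalerA mulrC.
Qed.

(** Let x v = z v. A homogeneous even b of degree g satisfies x b = c(g) b x, so it sends v to 0 or
    to an eigenvector with eigenvalue c(g) z. Traceless matrices applied to v, together with v, span
    everything, so the product of the X - r over these finitely many values r annihilates x. *)
Lemma acts_diagonalizable x c : x \in unitmx -> acts_by x c -> diagonalizable x.
Proof.
move=> ux xc; have [z [v [v0 xv]]] := closed_eigenvector x.
have [S [pr [_ _ _ _ SG]]] := grading_projections gradG.
pose rs := undup (z :: [seq c g * z | g <- S]).
apply/diagonalizableP; exists rs; first exact: undup_uniq.
set p := \prod_(r <- rs) _; apply: mxminpoly_min.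
have p_root r : r \in rs -> p.[r] = 0.
  by move=> rrs; apply/rootP; rewrite root_prod_XsubC.
have pv : horner_mx x p *m v = 0.
  by rewrite (horner_mx_eigenvector p xv) p_root ?scale0r // mem_undup mem_head.
have pa a : \tr a = 0 -> horner_mx x p *m (a *m v) = 0.
  move=> ta; have Pa : pmx a 0 0 \in P false by apply/P_evenP; exists a.
  rewrite -[a](block_mxKul a 0 0 (- a^T)) -/(pmx a 0 0).
  move: Pa; move: (pmx a 0 0); apply: (grading_part_ind gradG (P_part_direct F m)
    (Q := fun y => horner_mx x p *m (ulsubmx y *m v) = 0)).
  - by rewrite -pmx0 block_mxKul mul0mx mulmx0.
  - move=> y w Ey Ew; have -> : ulsubmx (y + w) = ulsubmx y + ulsubmx w.
      by apply/matrixP => i j; rewrite !mxE.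
    by rewrite mulmxDl mulmxDr Ey Ew addr0.
  move=> g w wg /P_evenP[b wE _]; rewrite wE block_mxKul.
  have [-> | b0] := eqVneq b 0; first by rewrite mul0mx mulmx0.
  have gS : g \in S.
    apply: SG; apply: contraNneq b0 => Gg0; move: wg; rewrite Gg0 memv0 wE -pmx0.
    by move/eqP/pmx_inj => [->].
  have := xc _ _ wg; rewrite wE Ad_pmx pmxZ => /pmx_inj[xb _ _].
  have xbv : x *m (b *m v) = (c g * z) *: (b *m v).
    have xbE : x *m b = c g *: (b *m x) by rewrite scalemxAl -xb mulmxKV.
    by rewrite mulmxA xbE -scalemxAl -mulmxA xv -scalemxAr scalerA.
  rewrite (horner_mx_eigenvector p xbv) p_root ?scale0r //.
  by rewrite mem_undup inE (map_f (fun h => c h * z) gS) orbT.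
apply/eqP; apply: contraT => /mx_neq0_col[w /eqP[]].
have [i vi] : exists i, v i 0 != 0 by apply/cV0Pn.
(* A rank one matrix with a v = w; subtracting a scalar matrix makes it traceless. *)
pose a := w *m ((v i 0)^-1 *: delta_mx (0 : 'I_1) i).
have av : a *m v = w.
  rewrite -mulmxA -scalemxAl -rowE -[RHS]mulmx1; congr (_ *m _).
  by apply/matrixP => r s; rewrite !mxE !ord1 eqxx mulVf.
pose t := \tr a / m%:R.
have -> : w = (a - t%:M) *m v + t *: v.
  by rewrite mulmxBl mul_scalar_mx subrK.
rewrite mulmxDr pa ?add0r -?scalemxAr ?pv ?scaler0 //.
by rewrite linearB /= mxtrace_scalar -mulr_natr divfK ?subrr // natF_neq0.
Qed.

(** Each of the finitely many pairs of distinct degrees is separated by a character, which acts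
    through some Ad x. The last clause speaks of every c because [acts_by] determines c on the
    support only. *)
Lemma separating_matrices : exists Q : seq 'M[F]_m,
  {in Q, forall x, x \in unitmx /\ exists c, acts_by x c} /\
  forall g h, (Gam g != 0)%VS -> (Gam h != 0)%VS -> g != h ->
    exists2 x, x \in Q & forall c, acts_by x c -> c g != c h.
Proof.
have [S [_ [_ _ _ _ SG]]] := grading_projections gradG.
have sep1 g h : (Gam g != 0)%VS -> (Gam h != 0)%VS -> g != h ->
    exists x, [/\ x \in unitmx, exists c, acts_by x c
      & forall c, acts_by x c -> c g != c h].
  move=> g0 h0 gh; pose R (k : G) := k = 0.
  have sR : subgroup R by split=> // _ _ -> ->; rewrite /R subrr.
  have Rgh : ~ R (g - h) by move/eqP; rewrite subr_eq0 (negbTE gh).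
  have [H [f [sH cf _ [_ fgh] HS]]] := separating_character S charF0 sR Rgh.
  have HG k : (Gam k != 0)%VS -> H k by move/SG/HS.
  have nz k v : v \in Gam k -> v != 0 -> (Gam k != 0)%VS.
    by move=> vk; apply: contraNneq => Gk0; rewrite Gk0 memv0 in vk.
  have f0 k : (Gam k != 0)%VS -> f k != 0 by move/HG; exact: cf.1.
  have fM : multiplicative_on bracket Gam f.
    move=> k l v w vk wl vw0; apply: cf.2; apply: HG.
      by apply: nz vk _; apply: contraNneq vw0 => ->;
        rewrite supercommutator0l.
    by apply: nz wl _; apply: contraNneq vw0 => ->;
      rewrite supercommutator0r.
  have [x ux xf] := character_acts f0 fM; exists x; split=> //; first by exists f.
  move=> c xc; have cE k : (Gam k != 0)%VS -> c k = f k.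
    move=> k0; have vk := memv_pick (Gam k); have v0 : vpick (Gam k) != 0.
      by rewrite vpick0.
    have /eqP : (c k - f k) *: vpick (Gam k) = 0.
      by rewrite scalerBl -(xc _ _ vk) -(xf _ _ vk) subrr.
    by rewrite scaler_eq0 (negbTE v0) orbF subr_eq0 => /eqP.
  rewrite !cE //; apply: contraNneq fgh => fE.
  rewrite (cf.2 _ _ (HG _ g0)) ?(character_onN sH cf) ?fE ?divff ?f0 //.
    exact: HG.
  by apply: subgroupN => //; exact: HG.
pose ps := [seq gh <- [seq (g, h) | g <- S, h <- S] |
  [&& (Gam gh.1 != 0)%VS, (Gam gh.2 != 0)%VS & gh.1 != gh.2]].
have {sep1} : forall gh, gh \in ps -> exists x, [/\ x \in unitmx,
    exists c, acts_by x c & forall c, acts_by x c -> c gh.1 != c gh.2].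
  by move=> [g h]; rewrite mem_filter => /andP[/and3P[g0 h0 gh] _]; exact: sep1.
have : forall g h, (Gam g != 0)%VS -> (Gam h != 0)%VS -> g != h -> (g, h) \in ps.
  move=> g h g0 h0 gh; rewrite mem_filter /= g0 h0 gh /=.
  by apply/allpairsP; exists (g, h); split=> //; exact: SG.
move: ps => ps psP sep1.
suff [Q QP sepQ] : exists2 Q : seq 'M[F]_m,
    {in Q, forall x, x \in unitmx /\ exists c, acts_by x c} &
    {in ps, forall gh, exists2 x, x \in Q &
       forall c, acts_by x c -> c gh.1 != c gh.2}.
  exists Q; split=> // g h g0 h0 gh; exact: (sepQ (g, h) (psP g h g0 h0 gh)).
elim: ps {psP} sep1 => [|gh ps IHps] sep1; first by exists [::].
have [|Q QP sepQ] := IHps; first by move=> p pps; apply: sep1; rewrite inE pps orbT.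
have [x [ux xc xgh]] := sep1 gh (mem_head _ _).
exists (x :: Q) => [y|p]; rewrite inE => /predU1P[-> // | yQ].
- exact: QP.
- by exists x; rewrite ?mem_head.
by have [y yQ' yp] := sepQ p yQ; exists y => //; rewrite inE yQ' orbT.
Qed.

End OneGrading.
End PGradings.

Lemma F2_cases (z : 'F_2) : z = 0 \/ z = 1.
Proof. by case: z => -[|[|z]] //= z2; [left | right]; exact: val_inj. Qed.

Lemma F2_addxx (z : 'F_2) : z + z = 0.
Proof. by case: (F2_cases z) => ->; apply: val_inj. Qed.

(** * Matrices commuting up to sign *)

Section SignCharacters.
Variables (F : fieldType) (r : nat).
Hypothesis charF0 : [pchar F] =i pred0.
Implicit Types u v w : 'rV['F_2]_r.

Definition sgn2 (z : 'F_2) : F := (-1) ^+ z.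

Definition dot2 u v : 'F_2 := \sum_i u 0 i * v 0 i.

Lemma sgn2_0 : sgn2 0 = 1. Proof. by []. Qed.
Lemma sgn2_1 : sgn2 1 = -1. Proof. by rewrite /sgn2 expr1. Qed.

Lemma sgn2D z z' : sgn2 (z + z') = sgn2 z * sgn2 z'.
Proof.
case: (F2_cases z) => ->; first by rewrite add0r sgn2_0 mul1r.
case: (F2_cases z') => ->; first by rewrite addr0 sgn2_0 mulr1.
by rewrite F2_addxx sgn2_0 sgn2_1 mulrN1 opprK.
Qed.

Lemma sgn2_sq z : sgn2 z * sgn2 z = 1.
Proof. by rewrite -sgn2D F2_addxx. Qed.

Lemma neq1N1 : 1 != -1 :> F.
Proof. by rewrite -subr_eq0 opprK -mulr2n (pcharf0P _).1. Qed.

Lemma sgn2_inj : injective sgn2.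
Proof.
move=> z z'; case: (F2_cases z) => ->; case: (F2_cases z') => ->;
  rewrite ?sgn2_0 ?sgn2_1 // => /eqP; first by rewrite (negbTE neq1N1).
by rewrite eq_sym (negbTE neq1N1).
Qed.

Lemma sgn2_sum (I : finType) (f : I -> 'F_2) :
  sgn2 (\sum_i f i) = \prod_i sgn2 (f i).
Proof. exact: (big_morph sgn2 sgn2D sgn2_0). Qed.

Lemma dot2C u v : dot2 u v = dot2 v u.
Proof. by apply: eq_bigr => i _; rewrite mulrC. Qed.

Lemma dot2Dl u u' v : dot2 (u + u') v = dot2 u v + dot2 u' v.
Proof. by rewrite -big_split; apply: eq_bigr => i _; rewrite mxE mulrDl. Qed.

Lemma dot2Dr u v v' : dot2 u (v + v') = dot2 u v + dot2 u v'.
Proof. by rewrite dot2C dot2Dl !(dot2C u). Qed.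

Lemma dot20 u : dot2 u 0 = 0.
Proof. by rewrite /dot2 big1 // => i _; rewrite mxE mulr0. Qed.

Lemma dot2_delta i v : dot2 (delta_mx 0 i) v = v 0 i.
Proof.
rewrite /dot2 (bigD1 i) //= mxE !eqxx mul1r big1 ?addr0 // => j ji.
by rewrite mxE (negbTE ji) andbF mul0r.
Qed.

Lemma rV2_addxx u : u + u = 0.
Proof. by apply/matrixP => i j; rewrite !mxE F2_addxx. Qed.

Lemma rV2_opp u : - u = u.
Proof. by apply/eqP; rewrite eq_sym -subr_eq0 opprK rV2_addxx. Qed.

(** Such a character is determined by its signs on the standard basis, which form the vector v. *)
Lemma sign_character (chi : 'rV['F_2]_r -> F) :
    (forall u u', chi (u + u') = chi u * chi u') ->
    (forall u, chi u = 1 \/ chi u = -1) ->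
  exists v, forall u, chi u = sgn2 (dot2 u v).
Proof.
move=> chiD chi1; have chi0 : chi 0 = 1.
  have := chiD 0 0; rewrite addr0.
  by case: (chi1 0) => -> //; rewrite mulrN1 opprK => /esym/eqP; rewrite (negbTE neq1N1).
exists (\row_i (if chi (delta_mx 0 i) == 1 then 0 else 1)) => u.
rewrite {1}[u]row_sum_delta (big_morph chi chiD chi0) sgn2_sum.
apply: eq_bigr => i _; rewrite mxE; case: (F2_cases (u 0 i)) => ->.
  by rewrite scale0r chi0 mul0r.
rewrite scale1r mul1r; case: (chi1 (delta_mx 0 i)) => ->; first by rewrite eqxx.
by rewrite eq_sym (negbTE neq1N1) sgn2_1.
Qed.

(** If w_i = 1, translating u by the i-th basis vector changes the sign of the sum. *)
Lemma sgn2_orthogonality w :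
  \sum_u sgn2 (dot2 u w) = #|{: 'rV['F_2]_r}|%:R *+ (w == 0).
Proof.
have [-> | w0] := eqVneq w 0.
  rewrite (eq_bigr (fun=> 1)) => [|u _]; last by rewrite dot20.
  by rewrite sumr_const.
have [i wi] : exists i, w 0 i != 0 by apply/rV0Pn.
have {}wi : w 0 i = 1 by case: (F2_cases (w 0 i)) wi => ->.
rewrite mulr0n; apply/eqP; set s := \sum_u _; have : s = - s.
  rewrite {1}/s (reindex_inj (addrI (delta_mx 0 i))) -sumrN.
  apply: eq_bigr => u _.
  by rewrite dot2Dl sgn2D dot2_delta wi sgn2_1 mulN1r.
move/eqP; rewrite -addr_eq0 -mulr2n -mulr_natl mulf_eq0 (pcharf0P _).1 //.
Qed.

End SignCharacters.

Definition sign_commute (F : fieldType) m (x y : 'M[F]_m) :=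
  x *m y = y *m x \/ x *m y = - (y *m x).

Section SignCommute.
Variables (F : fieldType) (m : nat).
Implicit Types x y z : 'M[F]_m.

Lemma sign_commuteC x y : sign_commute x y -> sign_commute y x.
Proof. by rewrite /sign_commute => -[] ->; [left | right; rewrite opprK]. Qed.

Lemma sign_commuteM x y z :
  sign_commute x y -> sign_commute x z -> sign_commute x (y *m z).
Proof.
case=> xy [] xz; rewrite /sign_commute !mulmxA xy ?mulNmx -!mulmxA xz ?mulmxN ?opprK;
  by [left | right].
Qed.

Lemma sign_commute1 x : sign_commute x 1%:M.
Proof. by left; rewrite mulmx1 mul1mx. Qed.

End SignCommute.

(** * Frames: paired families of involutions commuting up to sign *)

Section Frames.
Variables (F : closedFieldType) (n : nat).
Hypothesis charF0 : [pchar F] =i pred0.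
Local Notation m := n.+1.
Local Notation sgn := (@sgn2 F).
Implicit Types x y z q : 'M[F]_m.

Lemma codiagonal (Q : seq 'M[F]_m) :
    {in Q &, forall x y, x *m y = y *m x} -> {in Q, forall x, diagonalizable x} ->
  exists2 N : 'M[F]_m, N \in unitmx &
    {in Q, forall x, exists d, N *m x = diag_mx d *m N}.
Proof.
move=> QC Qd; have [N uN /allP QN] : codiagonalizable Q.
  by apply/codiagonalizableP; split.
exists N => // x /QN /= /similar_diagPex[d /(similarP uN) e].
by exists d.
Qed.

(* An odd choice of the sign d / sqrt(d^2) turns x into an involution with the
   same commutation signs. *)
Lemma normalize_involution x : x \in unitmx -> diagonalizable x ->
  exists x', x' *m x' = 1%:M /\ forall q,
    (x *m q = q *m x -> x' *m q = q *m x') /\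
    (x *m q = - (q *m x) -> x' *m q = - (q *m x')).
Proof.
move=> ux [N uN /similar_diagPex[d /(similarP uN) Nx]].
have NxE : x = invmx N *m (diag_mx d *m N) by rewrite -Nx mulKmx.
(* A fixed square root function: applied to d^2 it does not distinguish d from -d, so d / rt (d^2)
   is an odd function of d <> 0 with values 1 and -1. *)
pose rt (e : F) := projT1 (constructive_indefinite_description _ (closed_sqrt e)).
have rtE e : rt e ^+ 2 = e by rewrite /rt; case: constructive_indefinite_description.
have d0 i : d 0 i != 0.
  move: ux; rewrite NxE !unitmx_mul => /and3P[_ + _].
  by rewrite unitmxE det_diag unitfE => /prodf_neq0 -> .
pose s : 'rV[F]_m := \row_i (d 0 i / rt (d 0 i ^+ 2)).
have rt0 e : e != 0 -> rt e != 0 by move=> e0; rewrite -sqrf_eq0 rtE.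
pose x' := invmx N *m (diag_mx s *m N).
have Nx' : N *m x' = diag_mx s *m N by rewrite mulKVmx.
(* In the eigenbasis of y, the relation y q = k q y says that the entry (i, j) of q vanishes unless
   d_i = k d_j; for k = 1 and k = -1 this persists when the eigenvalues are replaced by their
   signs. *)
have conj (y q : 'M[F]_m) dy (k : F) : N *m y = diag_mx dy *m N ->
    (y *m q = k *: (q *m y) <-> forall i j,
      (N *m q *m invmx N) i j * (dy 0 i - k * dy 0 j) = 0).
  move=> Ny; have : N *m q = N *m q *m invmx N *m N by rewrite mulmxKV.
  move: (N *m q *m invmx N) => p Nq.
  have e1 : N *m (y *m q) = diag_mx dy *m p *m N by rewrite mulmxA Ny -mulmxA Nq mulmxA.
  have e2 : N *m (k *: (q *m y)) = (k *: (p *m diag_mx dy)) *m N.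
    by rewrite -scalemxAr mulmxA Nq -mulmxA Ny mulmxA scalemxAl.
  have entry i j : (diag_mx dy *m p - k *: (p *m diag_mx dy)) i j =
      p i j * (dy 0 i - k * dy 0 j).
    rewrite mul_diag_mx mul_mx_diag !mxE mulrBr [_ * p i j]mulrC; congr (_ - _).
    by rewrite mulrCA.
  split=> [yq i j | pij].
    rewrite -entry; suff -> : diag_mx dy *m p = k *: (p *m diag_mx dy) by rewrite subrr mxE.
    by apply: (can_inj (mulmxK uN)); rewrite -e1 -e2 yq.
  apply: (can_inj (mulKmx uN)); rewrite e1 e2; congr (_ *m N).
  by apply/eqP; rewrite -subr_eq0; apply/eqP/matrixP => i j; rewrite entry pij mxE.
exists x'; split.
  apply: (can_inj (mulKmx uN)); rewrite mulmxA Nx' -mulmxA Nx' mulmxA mulmx1.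
  rewrite -[RHS]mul1mx; congr (_ *m N); apply/matrixP => i j.
  rewrite mul_diag_mx !mxE; have [->|_] := eqVneq i j; last by rewrite mulr0n mulr0.
  rewrite mulr1n -expr2 expr_div_n rtE divff // sqrf_eq0; exact: d0.
move=> q; split=> [xq | xq].
  rewrite -[RHS]scale1r; apply/(conj x' q s 1 Nx') => i j; rewrite mul1r [s 0 i]mxE [s 0 j]mxE.
  have /(conj x q d 1 Nx)/(_ i j)/eqP : x *m q = 1 *: (q *m x) by rewrite scale1r.
  rewrite mul1r mulf_eq0 => /orP[/eqP-> | ]; first by rewrite mul0r.
  by rewrite subr_eq0 => /eqP ->; rewrite subrr mulr0.
rewrite -scaleN1r; apply/(conj x' q s (-1) Nx') => i j; rewrite mulN1r opprK [s 0 i]mxE [s 0 j]mxE.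
have /(conj x q d (-1) Nx)/(_ i j)/eqP : x *m q = (-1) *: (q *m x) by rewrite scaleN1r.
rewrite mulN1r opprK mulf_eq0 => /orP[/eqP-> | ]; first by rewrite mul0r.
rewrite addr_eq0 => /eqP ->; rewrite sqrrN mulNr addNr mulr0 //.
Qed.

(** Pauli-type matrices: two commuting families of involutions whose mutual commutation signs are
    the signs of the dot product, as for the X_ab of a standard realization once A and B are
    identified with F_2^r. *)
Definition frame r (X Y : 'rV['F_2]_r -> 'M[F]_m) :=
  [/\ X 0 = 1%:M, Y 0 = 1%:M, forall u u', X (u + u') = X u *m X u',
      forall v v', Y (v + v') = Y v *m Y v'
    & forall u v, X u *m Y v = sgn (dot2 u v) *: (Y v *m X u)].

Definition frame_compatible (Q : seq 'M[F]_m) r (X Y : 'rV['F_2]_r -> 'M[F]_m) :=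
  {in Q, forall q, forall u, sign_commute q (X u) /\ sign_commute q (Y u)}.

Section FrameTheory.
Variables (r : nat).
Implicit Types (X Y Z : 'rV['F_2]_r -> 'M[F]_m) (u v : 'rV['F_2]_r).

Lemma hom_involution Z u : Z 0 = 1%:M -> (forall u u', Z (u + u') = Z u *m Z u') ->
  Z u *m Z u = 1%:M.
Proof. by move=> Z0 ZD; rewrite -ZD rV2_addxx. Qed.

Lemma involution_unit x : x *m x = 1%:M -> x \in unitmx.
Proof. by case/mulmx1_unit. Qed.

(** The sign with which x commutes with Z u is multiplicative in u, since x and the Z u are
    invertible. *)
Lemma sign_commute_character Z x : x \in unitmx -> Z 0 = 1%:M ->
    (forall u u', Z (u + u') = Z u *m Z u') -> (forall u, sign_commute x (Z u)) ->
  exists v, forall u, x *m Z u = sgn (dot2 u v) *: (Z u *m x).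
Proof.
move=> ux Z0 ZD xZ; pose chi u : F := if x *m Z u == Z u *m x then 1 else -1.
have chiE u : x *m Z u = chi u *: (Z u *m x).
  rewrite /chi; case: eqP => [->|]; first by rewrite scale1r.
  by case: (xZ u) => -> //; rewrite scaleN1r.
have chi1 u : chi u = 1 \/ chi u = -1 by rewrite /chi; case: eqP; [left|right].
have uZ u : Z u \in unitmx by apply: involution_unit; exact: hom_involution.
have chiD u u' : chi (u + u') = chi u * chi u'.
  have e : x *m Z (u + u') = (chi u * chi u') *: (Z (u + u') *m x).
    by rewrite ZD mulmxA chiE -scalemxAl -mulmxA chiE -scalemxAr scalerA mulmxA.
  have /eqP := e; rewrite chiE -subr_eq0 -scalerBl scaler_eq0 subr_eq0.
  case/orP => /eqP // Zx0; have := uZ (u + u').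
  by rewrite -(mulmxK ux (Z _)) Zx0 mul0mx unitmxE det0 unitr0.
have [v vE] := sign_character charF0 chiD chi1; exists v => u.
by rewrite chiE vE.
Qed.

Lemma frame_swap X Y u v : frame X Y ->
  Y v *m X u = sgn (dot2 u v) *: (X u *m Y v).
Proof. by case=> _ _ _ _ XY; rewrite XY scalerA sgn2_sq scale1r. Qed.

(** The signs of q against X and Y are pairings with vectors v0 and u0; multiplication by X u0 Y v0
    introduces the same signs a second time. *)
Lemma frame_adjust X Y q : frame X Y -> q \in unitmx ->
    (forall u, sign_commute q (X u) /\ sign_commute q (Y u)) ->
  exists u v, let z := q *m (X u *m Y v) in
    forall w, z *m X w = X w *m z /\ z *m Y w = Y w *m z.
Proof.
move=> fXY uq qXY; have [X0 Y0 XD YD XY] := fXY.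
have [v0 qX] := sign_commute_character uq X0 XD (fun u => (qXY u).1).
have [u0 qY] := sign_commute_character uq Y0 YD (fun u => (qXY u).2).
exists u0, v0 => z w; split.
  rewrite /z -!mulmxA (frame_swap _ _ fXY) -!scalemxAr (mulmxA (X u0)) -XD addrC XD.
  by rewrite !mulmxA qX -!scalemxAl scalerA sgn2_sq scale1r.
rewrite /z -!mulmxA -YD [v0 + w]addrC YD (mulmxA (X u0)) XY -!scalemxAl.
rewrite -!scalemxAr !mulmxA qY -!scalemxAl scalerA dot2C sgn2_sq scale1r.
by [].
Qed.

End FrameTheory.

Lemma frame0 : frame (fun _ : 'rV['F_2]_0 => 1%:M : 'M[F]_m) (fun _ => 1%:M).
Proof.
split=> // *; rewrite ?mulmx1 //.
by rewrite /dot2 big_ord0 sgn2_0 scale1r.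
Qed.

Definition pw x (s : 'F_2) : 'M[F]_m := if s == 0 then 1%:M else x.

Lemma pwD x s t : x *m x = 1%:M -> pw x (s + t) = pw x s *m pw x t.
Proof.
move=> xx; case: (F2_cases s) => ->; first by rewrite add0r mul1mx.
case: (F2_cases t) => ->; first by rewrite addr0 mulmx1.
by rewrite F2_addxx /= /pw /= xx.
Qed.

Lemma pw_comm x y s : x *m y = y *m x -> pw x s *m y = y *m pw x s.
Proof. by rewrite /pw; case: eqP => // _ _; rewrite mul1mx mulmx1. Qed.

Lemma pw_sign x y s t : x *m y = - (y *m x) ->
  pw x s *m pw y t = sgn (s * t) *: (pw y t *m pw x s).
Proof.
move=> xy; case: (F2_cases s) => ->.
  by rewrite mul0r sgn2_0 scale1r mul1mx mulmx1.
case: (F2_cases t) => ->.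
  by rewrite mulr0 sgn2_0 scale1r mul1mx mulmx1.
by rewrite mulr1 sgn2_1 scaleN1r.
Qed.

(** The anticommuting pair x, y provides the first coordinate of the enlarged index space, the old
    frame the remaining r. *)
Lemma frame_extend (Q : seq 'M[F]_m) r (X Y : 'rV['F_2]_r -> 'M[F]_m) x y :
    frame X Y -> frame_compatible Q X Y ->
    x *m x = 1%:M -> y *m y = 1%:M -> x *m y = - (y *m x) ->
    (forall u, x *m X u = X u *m x /\ x *m Y u = Y u *m x) ->
    (forall u, y *m X u = X u *m y /\ y *m Y u = Y u *m y) ->
    {in Q, forall q, sign_commute q x /\ sign_commute q y} ->
  exists X' Y' : 'rV['F_2]_r.+1 -> 'M[F]_m, frame X' Y' /\ frame_compatible Q X' Y'.
Proof.
move=> [X0 Y0 XD YD XY] QXY xx yy xy xXY yXY Qxy.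
pose hd (u : 'rV['F_2]_r.+1) : 'F_2 := u 0 0.
pose tl (u : 'rV['F_2]_r.+1) : 'rV['F_2]_r := @rsubmx _ _ 1 r u.
have hdD u v : hd (u + v) = hd u + hd v by rewrite /hd mxE.
have tlD u v : tl (u + v) = tl u + tl v by apply/matrixP => i j; rewrite !mxE.
exists (fun u => pw x (hd u) *m X (tl u)), (fun u => pw y (hd u) *m Y (tl u)).
have pxX s u : pw x s *m X u = X u *m pw x s by apply: pw_comm; case: (xXY u).
have pxY s u : pw x s *m Y u = Y u *m pw x s by apply: pw_comm; case: (xXY u).
have pyX s u : pw y s *m X u = X u *m pw y s by apply: pw_comm; case: (yXY u).
have pyY s u : pw y s *m Y u = Y u *m pw y s by apply: pw_comm; case: (yXY u).
have hd0 : hd 0 = 0 by rewrite /hd mxE.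
have tl0 : tl 0 = 0 by apply/matrixP => i j; rewrite !mxE.
split; last first.
  move=> q Qq u; have [qx qy] := Qxy q Qq; have [qX qY] := QXY q Qq (tl u).
  have pwq s t : sign_commute q t -> sign_commute q (pw t s).
    by move=> qt; rewrite /pw; case: eqP => // _; exact: sign_commute1.
  by split; apply: sign_commuteM => //; exact: pwq.
split=> [||u v|u v|u v].
- by rewrite hd0 tl0 X0 mulmx1.
- by rewrite hd0 tl0 Y0 mulmx1.
- by rewrite hdD tlD pwD // XD -!mulmxA [in RHS](mulmxA (X _)) -pxX !mulmxA.
- by rewrite hdD tlD pwD // YD -!mulmxA [in RHS](mulmxA (Y _)) -pyY !mulmxA.
have -> : dot2 u v = hd u * hd v + dot2 (tl u) (tl v).
  rewrite /dot2 big_ord_recl; congr (_ + _); apply: eq_bigr => i _.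
  by rewrite /tl !mxE; congr (u _ _ * v _ _); exact: val_inj.
rewrite sgn2D -mulmxA (mulmxA (X _)) -pyX -mulmxA XY -!scalemxAr mulmxA.
rewrite (pw_sign _ _ xy) -scalemxAl scalerA mulrC; congr (_ *: _).
by rewrite -!mulmxA; congr (_ *m _); rewrite !mulmxA pxY.
Qed.

End Frames.

(** * Adapted bases and the structure of families commuting up to sign *)

Section FrameBasis.
Variables (F : closedFieldType) (n : nat).
Hypothesis charF0 : [pchar F] =i pred0.
Local Notation m := n.+1.
Local Notation sgn := (@sgn2 F).

Lemma involution_diagonalizable (x : 'M[F]_m) : x *m x = 1%:M -> diagonalizable x.
Proof.
move=> xx; apply/diagonalizableP; exists [:: 1; -1].
  by rewrite /= inE andbT neq1N1.
apply: mxminpoly_min; rewrite !big_cons big_nil mulr1 rmorphM !rmorphB /=.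
have N1 : (-1)%:M = - 1%:M :> 'M[F]_m.
  by apply/matrixP => i j; rewrite !mxE mulNrn.
rewrite !horner_mx_X !horner_mx_C -mulmxE N1 opprK mulmxBl !mulmxDr xx.
by rewrite !mul1mx mulmx1 [_ + x]addrC subrr.
Qed.

(* A basis adapted to a frame: the translates by the [Y w] of joint
   eigenvectors that are fixed by all the [X u]. *)
Lemma frame_basis r (X Y : 'rV['F_2]_r -> 'M[F]_m) (Z : seq 'M[F]_m) p
    (om : 'I_p -> 'rV['F_2]_r) :
    frame X Y -> bijective om ->
    {in Z &, forall x y, x *m y = y *m x} -> {in Z, forall x, diagonalizable x} ->
    {in Z, forall z, forall u, z *m X u = X u *m z /\ z *m Y u = Y u *m z} ->
  exists k (N : 'M[F]_(k * p, m)),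
    [/\ row_free N /\ row_full N,
        {in Z, forall z, exists lam : 'rV[F]_k, forall s j,
           row (mxtens_index (s, j)) N *m z =
             lam 0 s *: row (mxtens_index (s, j)) N},
        forall u s j, row (mxtens_index (s, j)) N *m X u =
             sgn (dot2 u (om j)) *: row (mxtens_index (s, j)) N
      & forall w s j j', om j' = om j + w ->
          row (mxtens_index (s, j)) N *m Y w = row (mxtens_index (s, j')) N].
Proof.
move=> fXY [omV omK omVK] ZC Zd ZXY; have [X0 Y0 XD YD XY] := fXY.
have XX u : X u *m X u = 1%:M := hom_involution u X0 XD.
have YY u : Y u *m Y u = 1%:M := hom_involution u Y0 YD.
have uY u : Y u \in unitmx by apply: involution_unit.
have dX u : diagonalizable (X u) by exact: involution_diagonalizable.
pose Z' := Z ++ [seq X u | u : 'rV['F_2]_r].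
have ZP x : x \in Z' -> x \in Z \/ exists u, x = X u.
  rewrite mem_cat => /orP[|/mapP[u _ ->]]; [by left | by right; exists u].
have [N0 uN0 N0d] : exists2 N0 : 'M[F]_m, N0 \in unitmx &
    {in Z', forall x, exists d, N0 *m x = diag_mx d *m N0}.
  apply: codiagonal => [x y /ZP[xZ|[u ->]] /ZP[yZ|[v ->]] | x /ZP[/Zd //|[u ->]//]].
  - exact: ZC.
  - exact: (ZXY x xZ v).1.
  - by rewrite (ZXY y yZ u).1.
  - by rewrite -!XD addrC.
pose ev x i := (N0 *m x *m invmx N0) i i.
have evE x i : x \in Z' -> row i N0 *m x = ev x i *: row i N0.
  move=> xZ; have [d dE] := N0d x xZ; rewrite -row_mul dE /ev dE mulmxK //.
  by rewrite row_mul row_diag_mx -scalemxAl -rowE mxE eqxx.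
have XZ u : X u \in Z' by rewrite mem_cat map_f ?orbT // mem_enum.
have row0 i : row i N0 != 0.
  apply/eqP => /(congr1 (fun x => x *m invmx N0)); rewrite /= rowE mulmxK //.
  rewrite mul0mx => /matrixP/(_ 0 i); rewrite !mxE !eqxx => /eqP.
  by rewrite oner_eq0.
have vP i : exists v, forall u, ev (X u) i = sgn (dot2 u v).
  apply: sign_character => // [u u'|u].
    apply/eqP; rewrite -subr_eq0; have : (ev (X (u + u')) i - ev (X u) i * ev (X u') i)
      *: row i N0 = 0.
      rewrite scalerBl -evE // XD mulmxA evE // -scalemxAl evE // scalerA.
      by rewrite mulrC subrr.
    by move/eqP; rewrite scaler_eq0 (negbTE (row0 i)) orbF.
  have : (ev (X u) i ^+ 2 - 1) *: row i N0 = 0.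
    rewrite scalerBl scale1r expr2 -scalerA -evE // scalemxAl -evE // -mulmxA.
    by rewrite XX mulmx1 subrr.
  move/eqP; rewrite scaler_eq0 (negbTE (row0 i)) orbF subr_eq0 sqrf_eq1.
  by case/orP => /eqP ->; [left | right].
pose v i := projT1 (constructive_indefinite_description _ (vP i)).
have vE i u : ev (X u) i = sgn (dot2 u (v i)).
  by rewrite /v; case: constructive_indefinite_description.
(* Rows of N0 are joint eigenvectors, and v i records the signs of row i under the X u; the rows in
   I are those fixed by all X u. *)
pose I := [set i | v i == 0].
pose N : 'M[F]_(#|I| * p, m) := \matrix_t
  (row (enum_val (mxtens_unindex t).1) N0 *m Y (om (mxtens_unindex t).2)).
have NE t : row t N = row (enum_val (mxtens_unindex t).1) N0 *m
    Y (om (mxtens_unindex t).2) by rewrite rowK.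
have NX t u : row t N *m X u = sgn (dot2 u (om (mxtens_unindex t).2)) *: row t N.
  rewrite NE -mulmxA (frame_swap _ _ fXY) -scalemxAr mulmxA (evE _ _ (XZ u)) vE.
  have := enum_valP (mxtens_unindex t).1; rewrite inE => /eqP ->.
  by rewrite dot20 sgn2_0 scale1r.
exists #|I|, N; split.
- split; last first.
    rewrite -sub1mx; apply: submx_trans (_ : N0 <= N)%MS.
      by rewrite sub1mx row_full_unit.
    (* Multiplying row i by Y (v i) cancels its signs, so the result is a combination of rows in I;
       multiplying by Y (v i) again lands in the span of N. *)
    apply/row_subP => i; pose y := row i N0 *m Y (v i).
    have yX u : y *m X u = y.
      rewrite /y -mulmxA (frame_swap _ _ fXY) -scalemxAr mulmxA (evE _ _ (XZ u)) vE.
      by rewrite -scalemxAl scalerA sgn2_sq scale1r.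
    pose c := y *m invmx N0; have yE : y = c *m N0 by rewrite mulmxKV.
    have c0 j : c 0 j != 0 -> v j = 0.
      move=> cj; apply/matrixP => a k; rewrite ord1 mxE.
      have [d dE] := N0d _ (XZ (delta_mx 0 k)).
      have dj : d 0 j = sgn (v j 0 k).
        rewrite -dot2_delta -vE /ev dE mulmxK // mxE eqxx mulr1n.
        by [].
      have : c *m diag_mx d = c.
        by apply: (can_inj (mulmxK uN0)); rewrite -mulmxA -dE mulmxA -yE yX.
      move/matrixP/(_ 0 j); rewrite mul_mx_diag mxE dj => /eqP.
      rewrite -subr_eq0 -[X in _ - X]mulr1 -mulrBr mulf_eq0 (negbTE cj) subr_eq0.
      by move/eqP/(sgn2_inj charF0 (x2 := 0)).
    have -> : row i N0 = \sum_j c 0 j *: (row j N0 *m Y (v i)).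
      rewrite -[LHS]mulmx1 -(YY (v i)) mulmxA -/y yE.
      rewrite [c *m N0]mulmx_sum_row mulmx_suml.
      by apply: eq_bigr => j _; rewrite scalemxAl.
    apply: summx_sub => j _; have [-> | /c0 vj] := eqVneq (c 0 j) 0.
      by rewrite scale0r sub0mx.
    apply: scalemx_sub; have jI : j \in I by rewrite inE vj.
    pose t := mxtens_index (enum_rank_in jI j, omV (v i)).
    suff -> : row j N0 *m Y (v i) = row t N by apply: row_sub.
    by rewrite NE mxtens_indexK /= omVK enum_rankK_in.
  apply: inj_row_free => c cN; apply/matrixP => a t; rewrite ord1 mxE.
  have [[s j] tE] : exists sj, t = mxtens_index sj.
    by exists (mxtens_unindex t); rewrite mxtens_unindexK.
  pose c' := \sum_t' (c 0 t' *+ ((mxtens_unindex t').2 == j)) *: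
    delta_mx (0 : 'I_1) (enum_val (mxtens_unindex t').1).
  have c'0 : c' *m N0 = 0.
    apply: (can_inj (mulmxK (uY (om j)))); rewrite mul0mx.
    (* Up to the factor 2^r, e projects onto the joint eigenspace of the X u with signs given by om
       j; it isolates the rows of N with second index j. *)
    pose e := \sum_u sgn (dot2 u (om j)) *: X u.
    have cNe : c *m N *m e = 0 by rewrite cN mul0mx.
    have p0 : #|{: 'rV['F_2]_r}|%:R != 0 :> F.
      by rewrite (pcharf0P _).1 // card_mx expn_eq0 card_Fp.
    apply: (scalerI p0); rewrite scaler0 -cNe [c *m N]mulmx_sum_row mulmx_suml.
    rewrite /c' !mulmx_suml scaler_sumr; apply: eq_bigr => t' _.
    rewrite -!scalemxAl /e mulmx_sumr.
    have -> : \sum_u row t' N *m (sgn (dot2 u (om j)) *: X u) =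
        (#|{: 'rV['F_2]_r}|%:R *+ ((mxtens_unindex t').2 == j)) *: row t' N.
      have -> : ((mxtens_unindex t').2 == j) = (om (mxtens_unindex t').2 + om j == 0).
        by rewrite addr_eq0 rV2_opp (can_eq omK).
      rewrite -sgn2_orthogonality // scaler_suml; apply: eq_bigr => u _.
      by rewrite -scalemxAr NX scalerA -sgn2D -dot2Dr addrC.
    rewrite NE -rowE; case: eqP => [-> | _]; last first.
      by rewrite !mulr0n !scale0r !scaler0.
    by rewrite !mulr1n !scalerA mulrC.
  have {}c'0 : c' = 0 by apply: (can_inj (mulmxK uN0)); rewrite c'0 mul0mx.
  have tsj : mxtens_unindex t = (s, j) by rewrite tE mxtens_indexK.
  move/matrixP/(_ 0 (enum_val s)): c'0.
  rewrite summxE (bigD1 t) // big1 => [|t' t't].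
    by rewrite tsj /= !mxE !eqxx mulr1n mulr1 addr0.
  rewrite !mxE eqxx andTb; case: eqP => [j' | _]; last by rewrite mul0r.
  case: eqP => [/enum_val_inj s' | _]; last by rewrite mulr0.
  case/negP: t't; apply/eqP/(can_inj (@mxtens_unindexK _ _)).
  by rewrite tsj (surjective_pairing (mxtens_unindex t')) j' -s'.
- move=> z zZ; exists (\row_s ev z (enum_val s)) => s j.
  rewrite NE mxtens_indexK /= mxE -mulmxA -(ZXY z zZ _).2 mulmxA evE ?mem_cat ?zZ //.
  by rewrite scalemxAl.
- by move=> u s j; rewrite NX mxtens_indexK.
move=> w s j j' jw; rewrite !NE !mxtens_indexK /= jw YD.
by rewrite mulmxA.
Qed.

Lemma free_full_size k (N : 'M[F]_(k, m)) : row_free N -> row_full N -> k = m.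
Proof. by rewrite /row_free /row_full => /eqP rk /eqP rm; rewrite -{1}rk. Qed.

(** An adapted basis has k 2^r elements, so m >= 2^r. The crude bound r <= m is enough for a maximal
    frame to exist. *)
Lemma frame_bound r (X Y : 'rV['F_2]_r -> 'M[F]_m) : frame X Y -> (r <= m)%N.
Proof.
move=> fXY; pose om (i : 'I_#|{: 'rV['F_2]_r}|) := enum_val i.
have omB : bijective om by exists (@enum_rank _); [exact: enum_valK | exact: enum_rankK].
have [//|//|//|k [N [[fN gN] _ _ _]]] := @frame_basis r X Y [::] _ om fXY omB.
have := free_full_size fN gN; rewrite card_mx card_Fp // mul1n => km.
have k_gt0 : (0 < k)%N by case: k km {N fN gN}.
rewrite -km; apply: leq_trans (ltnW (ltn_expl r (isT : 1 < 2)%N)) _.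
by rewrite leq_pmull.
Qed.

Lemma maximal_frame (Q : seq 'M[F]_m) : exists r (X Y : 'rV['F_2]_r -> 'M[F]_m),
  [/\ frame X Y, frame_compatible Q X Y &
   forall X' Y' : 'rV['F_2]_r.+1 -> 'M[F]_m,
     frame X' Y' -> ~ frame_compatible Q X' Y'].
Proof.
pose Pr r := exists X Y : 'rV['F_2]_r -> 'M[F]_m, frame X Y /\ frame_compatible Q X Y.
pose Pb r := if excluded_middle_informative (Pr r) then true else false.
have PbP r : Pb r <-> Pr r by rewrite /Pb; case: excluded_middle_informative.
have exP : exists r, Pb r.
  exists 0%N; apply/PbP; do 2!exists (fun=> 1%:M); split; first exact: frame0.
  by move=> q _ u; split; exact: sign_commute1.
have leP r : Pb r -> (r <= m)%N by case/PbP => X [Y [/frame_bound]].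
case: (ex_maxnP exP leP) => r /PbP[X [Y [fXY QXY]]] rmax.
exists r, X, Y; split=> // X' Y' fXY' QXY'.
by have /rmax : Pb r.+1 by [apply/PbP; exists X', Y']; rewrite ltnn.
Qed.

(** As z is invertible, z^2 is annihilated by a product of factors X - r with distinct nonzero r.
    Each X^2 - r then splits into two distinct linear factors, and different r share no root. *)
Lemma sqrt_diagonalizable (z : 'M[F]_m) : z \in unitmx -> diagonalizable (z *m z) ->
  diagonalizable z.
Proof.
move=> uz /diagonalizableP[rs urs /mxminpoly_minP zrs].
have [rs' [urs' rs0 zrs']] : exists rs', [/\ uniq rs', 0 \notin rs' &
    horner_mx (z *m z) (\prod_(x <- rs') ('X - x%:P)) = 0].
  have [rs0 | rs0] := boolP (0 \in rs); last by exists rs.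
  exists (rem 0 rs); rewrite rem_uniq // mem_rem_uniq // inE eqxx; split=> //.
  move: zrs; rewrite (big_rem 0) //= subr0 rmorphM /= horner_mx_X -mulmxE.
  move/(congr1 (fun y => invmx (z *m z) *m y)); rewrite /= mulKmx ?mulmx0 //.
  by rewrite unitmx_mul uz.
pose rt (e : F) := projT1 (constructive_indefinite_description _ (closed_sqrt e)).
have rtE e : rt e ^+ 2 = e by rewrite /rt; case: constructive_indefinite_description.
apply/diagonalizableP.
suff [qs [uqs _ zqs]] : exists qs, [/\ uniq qs, {in qs, forall s, s ^+ 2 \in rs'} &
    horner_mx z (\prod_(x <- qs) ('X - x%:P)) =
    horner_mx (z *m z) (\prod_(x <- rs') ('X - x%:P))].
  by exists qs => //; apply: mxminpoly_min; rewrite zqs.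
elim: rs' urs' rs0 {zrs'} => [_ _|r rs' IHrs /= /andP[rrs urs'] ].
  by exists [::]; rewrite !big_nil !rmorph1.
rewrite inE negb_or eq_sym => /andP[r0 rs0]; have [qs [uqs qsE zqs]] := IHrs urs' rs0.
exists (rt r :: - rt r :: qs); split.
- have nq s : s ^+ 2 = r -> s \notin qs.
    by move=> sr; apply: contra rrs => /qsE; rewrite sr.
  rewrite /= inE negb_or !nq ?sqrrN ?rtE // uqs !andbT.
  rewrite -subr_eq0 opprK -mulr2n -mulr_natl mulf_eq0 (pcharf0P _).1 //=.
  by rewrite -sqrf_eq0 rtE.
- move=> s; rewrite !inE => /or3P[/eqP-> | /eqP-> | /qsE ->]; rewrite ?orbT //.
    by rewrite rtE eqxx.
  by rewrite sqrrN rtE eqxx.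
rewrite !big_cons mulrA !rmorphM /= zqs; congr (_ * _).
rewrite !rmorphB /= !horner_mx_X !horner_mx_C -!mulmxE.
have N1 : (- rt r)%:M = - (rt r)%:M :> 'M[F]_m.
  by apply/matrixP => i j; rewrite !mxE mulNrn.
rewrite N1 opprK mulmxBl !mulmxDr -scalar_mxC opprD addrA addrK; congr (_ - _).
by rewrite -scalar_mxM -expr2 rtE.
Qed.

(** Fix a maximal frame compatible with Q. Each q, multiplied by a suitable product W q from the
    frame, commutes with the frame. Two such products commute up to sign, and if they anticommuted,
    involutions made from them would enlarge the frame. Each q is recovered from its product because
    W q squares to 1 or -1. *)
Lemma frame_structure (Q : seq 'M[F]_m) :
    {in Q, forall q, q \in unitmx /\ diagonalizable q} ->
    {in Q &, forall q q', sign_commute q q'} ->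
  exists r (X Y : 'rV['F_2]_r -> 'M[F]_m) (Z : seq 'M[F]_m),
    [/\ frame X Y, {in Z &, forall x y, x *m y = y *m x},
        {in Z, forall x, x \in unitmx /\ diagonalizable x},
        {in Z, forall z, forall u, z *m X u = X u *m z /\ z *m Y u = Y u *m z} &
        {in Q, forall q, exists z u v k, z \in Z /\ q = k *: (z *m (X u *m Y v))}].
Proof.
move=> QP Qs; have [r [X [Y [fXY QXY rmax]]]] := maximal_frame Q.
have [X0 Y0 XD YD XY] := fXY.
have XX u : X u *m X u = 1%:M := hom_involution u X0 XD.
have YY u : Y u *m Y u = 1%:M := hom_involution u Y0 YD.
have uX u : X u \in unitmx by apply: involution_unit.
have uY u : Y u \in unitmx by apply: involution_unit.
have adj q : exists uv : 'rV['F_2]_r * 'rV['F_2]_r, q \in Q ->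
    forall w, (q *m (X uv.1 *m Y uv.2)) *m X w = X w *m (q *m (X uv.1 *m Y uv.2)) /\
      (q *m (X uv.1 *m Y uv.2)) *m Y w = Y w *m (q *m (X uv.1 *m Y uv.2)).
  have [qQ | _] := boolP (q \in Q); last by exists (0, 0).
  have [u [v uvP]] := frame_adjust charF0 fXY (QP q qQ).1 (QXY q qQ).
  by exists (u, v).
pose uv q := projT1 (constructive_indefinite_description _ (adj q)).
have [W WE] : exists W, forall q, W q = X (uv q).1 *m Y (uv q).2.
  by exists (fun q => X (uv q).1 *m Y (uv q).2).
pose zz q := q *m W q.
have zP q : q \in Q -> forall w, zz q *m X w = X w *m zz q /\ zz q *m Y w = Y w *m zz q.
  move=> qQ; rewrite /zz WE /uv; move: qQ;
  by case: constructive_indefinite_description.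
have uW q : W q \in unitmx by rewrite WE unitmx_mul uX uY.
have uz q : q \in Q -> zz q \in unitmx.
  by move=> /QP[uq _]; rewrite unitmx_mul uq uW.
have WW q : W q *m W q = 1%:M \/ W q *m W q = - 1%:M.
  rewrite WE -!mulmxA (mulmxA (Y _)) (frame_swap _ _ fXY) -scalemxAl -scalemxAr.
  rewrite -mulmxA YY mulmx1 XX.
  case: (F2_cases (dot2 (uv q).1 (uv q).2)) => ->; rewrite ?sgn2_0 ?sgn2_1.
    by left; rewrite scale1r.
  by right; rewrite scaleN1r.
have qW q q' : q \in Q -> sign_commute q (W q').
  by move=> /QXY qXY; rewrite WE; apply: sign_commuteM; case: (qXY (uv q').1) (qXY (uv q').2) => ? ? [].
have qz q q' : q \in Q -> q' \in Q -> sign_commute q (zz q').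
  by move=> qQ qQ'; apply: sign_commuteM; [exact: Qs | exact: qW].
(* W q commutes with q up to sign and squares to 1 or -1, so the square of [zz q] is q^2 up to sign,
   hence diagonalizable. *)
have dz q : q \in Q -> diagonalizable (zz q).
  move=> qQ; apply: sqrt_diagonalizable; first exact: uz.
  have [_ [N uN Nd]] := QP q qQ.
  have /similar_diagPex[d /(similarP uN) Nq] := Nd.
  have [k zzE] : exists k, zz q *m zz q = k *: (q *m q).
    have [k qWE] : exists k, W q *m q = k *: (q *m W q).
      case: (sign_commuteC (qW q q qQ)) => ->; first by exists 1; rewrite scale1r.
      by exists (-1); rewrite scaleN1r.
    have -> : zz q *m zz q = k *: ((q *m q) *m (W q *m W q)).
      rewrite /zz -!mulmxA (mulmxA (W q)) qWE -scalemxAl -!scalemxAr.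
      by rewrite !mulmxA.
    case: (WW q) => ->; first by exists k; rewrite mulmx1.
    by exists (- k); rewrite mulmxN mulmx1 scalerN scaleNr.
  exists N => //; apply/similar_diagPex.
  exists (\row_i (k * d 0 i ^+ 2)); apply/(similarP uN).
  rewrite zzE -scalemxAr mulmxA Nq -mulmxA Nq mulmxA scalemxAl; congr (_ *m N).
  apply/matrixP => i j; rewrite mul_diag_mx !mxE.
  have [->|_] := eqVneq i j; last by rewrite !mulr0n !mulr0.
  by rewrite !mulr1n expr2.
have commz q q' : q \in Q -> q' \in Q -> zz q *m zz q' = zz q' *m zz q.
  move=> qQ qQ'; have : sign_commute (zz q) (zz q').
    apply: sign_commuteM; first exact: sign_commuteC (qz _ _ qQ' qQ).
    left; rewrite WE mulmxA (zP q qQ _).1 -mulmxA (zP q qQ _).2.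
    by rewrite mulmxA.
  case=> // anti; exfalso.
  have [x [xx xP]] := normalize_involution (uz q qQ) (dz q qQ).
  have [y [yy yP]] := normalize_involution (uz q' qQ') (dz q' qQ').
  have xy : x *m y = - (y *m x).
    have e1 := (xP (zz q')).2 anti; have e2 : zz q' *m x = - (x *m zz q').
      by rewrite e1 opprK.
    by have e3 := (yP x).2 e2; rewrite e3 opprK.
  have sc q0 t t' : (forall p : 'M[F]_m,
       (t *m p = p *m t -> t' *m p = p *m t') /\
       (t *m p = - (p *m t) -> t' *m p = - (p *m t'))) ->
      sign_commute q0 t -> sign_commute q0 t'.
    move=> tP /sign_commuteC; case=> [/(tP q0).1 e | /(tP q0).2 e].
      by left.
    by right; rewrite e opprK.
  have [X' [Y' [fXY' QXY']]] := frame_extend fXY QXY xx yy xy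
    (fun u => conj ((xP _).1 (zP q qQ u).1) ((xP _).1 (zP q qQ u).2))
    (fun u => conj ((yP _).1 (zP q' qQ' u).1) ((yP _).1 (zP q' qQ' u).2))
    (fun q0 qQ0 => conj (sc q0 _ _ xP (qz q0 q qQ0 qQ)) (sc q0 _ _ yP (qz q0 q' qQ0 qQ'))).
  exact: rmax fXY' QXY'.
exists r, X, Y, [seq zz q | q <- Q]; split=> //.
- by move=> _ _ /mapP[q qQ ->] /mapP[q' qQ' ->]; exact: commz.
- by move=> _ /mapP[q qQ ->]; split; [exact: uz | exact: dz].
- by move=> _ /mapP[q qQ ->]; exact: zP.
move=> q qQ; exists (zz q), (uv q).1, (uv q).2.
have zQ : zz q \in [seq zz q | q <- Q] := map_f zz qQ.
rewrite -WE /zz -mulmxA; case: (WW q) => ->.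
  by exists 1; split=> //; rewrite mulmx1 scale1r.
by exists (-1); split=> //; rewrite mulmxN mulmx1 scaleN1r opprK.
Qed.

End FrameBasis.

(** * The standard realization *)

Section SymplecticCoordinates.
Variables (F : fieldType) (l : nat).
Hypothesis charF0 : [pchar F] =i pred0.
Local Notation T := (T_l l).
Local Notation beta := (@beta_l F l).
Local Notation sgn := (@sgn2 F).
Implicit Types x y t : T.

Definition dotT x y : 'F_2 := \sum_i x ord0 i * y ord0 (rev_ord i).

(** The exponent in [beta_l] is a natural number built from representatives; only its parity
    matters. *)
Lemma beta_sgn2 x y : beta x y = sgn (dotT x y).
Proof.
rewrite /beta_l /dotT sgn2_sum (big_morph _ (exprD (-1 : F)) (expr0 (-1 : F))).
apply: eq_bigr => i _.
case: (F2_cases (x ord0 i)) => ->; first by rewrite mul0n mul0r.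
by case: (F2_cases (y ord0 (rev_ord i))) => ->; rewrite ?mulr0 ?muln0 ?mulr1.
Qed.

Lemma dotTC x y : dotT x y = dotT y x.
Proof.
rewrite /dotT (reindex_inj rev_ord_inj); apply: eq_bigr => i _.
by rewrite rev_ordK mulrC.
Qed.

Lemma dotTDl x x' y : dotT (x + x') y = dotT x y + dotT x' y.
Proof. by rewrite -big_split; apply: eq_bigr => i _; rewrite mxE mulrDl. Qed.

Lemma betaC x y : beta x y = beta y x.
Proof. by rewrite !beta_sgn2 dotTC. Qed.

Lemma betaDl x x' y : beta (x + x') y = beta x y * beta x' y.
Proof. by rewrite !beta_sgn2 dotTDl sgn2D. Qed.

Lemma betaDr x y y' : beta x (y + y') = beta x y * beta x y'.
Proof. by rewrite betaC betaDl ![beta _ x]betaC. Qed.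

Lemma beta_sq x y : beta x y * beta x y = 1.
Proof. by rewrite !beta_sgn2 sgn2_sq. Qed.

Lemma T_addxx t : t + t = 0.
Proof. exact: rV2_addxx. Qed.

Lemma T_opp t : - t = t.
Proof. exact: rV2_opp. Qed.

Lemma beta0l y : beta 0 y = 1.
Proof. by rewrite -(T_addxx 0) betaDl beta_sq. Qed.

Lemma beta0r y : beta y 0 = 1.
Proof. by rewrite betaC beta0l. Qed.

Lemma beta_nondegenerate x : (forall y, beta x y = 1) -> x = 0.
Proof.
move=> xy; apply/matrixP => i j; rewrite ord1 mxE.
have := xy (delta_mx ord0 (rev_ord j)); rewrite beta_sgn2.
have -> : dotT x (delta_mx ord0 (rev_ord j)) = x ord0 j.
  rewrite /dotT (bigD1 j) //= mxE !eqxx mulr1 big1 ?addr0 // => k kj.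
  by rewrite mxE (inj_eq rev_ord_inj) (negbTE kj) andbF mulr0.
exact: (sgn2_inj charF0 (x2 := 0)).
Qed.

Lemma card_T : #|{: T}| = (2 ^ (2 * l))%N.
Proof. by rewrite card_mx card_Fp // mul1n. Qed.

Variables A B : {set T}.
Hypothesis AB : isotropic_decomposition beta A B.

Lemma isotropic_opp : isotropic_decomposition beta B A.
Proof.
case: AB => zA zB dec bA bB; split=> // t; have [[a b] [[/= aA bB' tE] ab_uniq]] := dec t.
exists (b, a); split=> [|[b' a'] [/= b'B a'A tE']]; first by rewrite /= addrC.
have [-> -> //] : (a, b) = (a', b').
by apply: ab_uniq; split=> //=; rewrite tE' addrC.
Qed.
End SymplecticCoordinates.

(** * Isotropic decompositions in coordinates *)

Section Lagrangian.
Variables (F : fieldType) (l : nat).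
Hypothesis charF0 : [pchar F] =i pred0.
Local Notation T := (T_l l).
Local Notation beta := (@beta_l F l).
Local Notation sgn := (@sgn2 F).

Lemma zmod_closedD (A : {set T}) : zmod_closed A -> {in A &, forall x y, x + y \in A}.
Proof. by case=> _ AB x y Ax Ay; rewrite -[y]T_opp; apply: AB. Qed.

Lemma dotT_comb p (e : 'I_p -> T) (w : 'rV['F_2]_p) b :
  dotT (\sum_i w 0 i *: (e i : 'rV_(2 * l))) b = dot2 w (\row_i dotT (e i) b).
Proof.
have dotT0 : dotT 0 b = 0 by rewrite /dotT big1 // => i _; rewrite mxE mul0r.
rewrite (big_morph (fun x => dotT x b) (fun x y => dotTDl x y b) dotT0).
apply: eq_bigr => i _; rewrite mxE /dotT mulr_sumr; apply: eq_bigr => j _.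
by rewrite mxE mulrA.
Qed.

(** A subgroup of T is a subspace over F_2, so it has a basis; u gives coordinates, meaningful on A
    only. *)
Lemma elementary_coordinates (A : {set T}) : zmod_closed A ->
  exists p (e : 'I_p -> T) (u : T -> 'rV['F_2]_p),
    [/\ forall i, e i \in A, forall w : 'rV['F_2]_p, \sum_i w 0 i *: (e i : 'rV_(2 * l)) \in A,
        {in A, forall a, a = \sum_i u a 0 i *: (e i : 'rV_(2 * l))} &
        forall w : 'rV['F_2]_p, u (\sum_i w 0 i *: (e i : 'rV_(2 * l))) = w].
Proof.
move=> zA; have AD := zmod_closedD zA; have A0 : 0 \in A by case: zA.
pose U : {vspace 'rV['F_2]_(2 * l)} := <<enum A>>%VS.
have AS (I : finType) (f : I -> T) : (forall i, f i \in A) -> \sum_i f i \in A.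
  by move=> fA; apply: (big_ind (fun x => x \in A)) => // x y; exact: AD.
have AZ (k : 'F_2) (x : T) : x \in A -> k *: (x : 'rV_(2 * l)) \in A.
  by case: (F2_cases k) => -> xA; rewrite ?scale0r ?scale1r.
have UA x : (x \in U) = (x \in A).
  apply/idP/idP => [|xA]; last by apply: memv_span; rewrite mem_enum.
  rewrite /U -[enum A]/(tval (in_tuple (enum A))) => /coord_span ->.
  by apply: AS => i; apply: AZ; rewrite -mem_enum mem_nth.
have eA i : (vbasis U)`_i \in A.
  have [iU | iU] := ltnP i (size (vbasis U)); last by rewrite nth_default.
  by rewrite -UA vbasis_mem // mem_nth.
exists (\dim U), (fun i => (vbasis U)`_i), (fun x => \row_i coord (vbasis U) i x).
split=> // [w | a aA | w].
- by apply: AS => i; apply: AZ.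
- rewrite {1}(coord_vbasis (v := a) (U := U)) ?UA //.
  by apply: eq_bigr => i _; rewrite mxE.
apply/rowP => i; rewrite mxE coord_sum_free //; exact: (basis_free (vbasisP U)).
Qed.

Lemma card_coordinates (A : {set T}) p (e : 'I_p -> T) (u : T -> 'rV['F_2]_p) :
    (forall w : 'rV['F_2]_p, \sum_i w 0 i *: (e i : 'rV_(2 * l)) \in A) ->
    {in A, forall a, a = \sum_i u a 0 i *: (e i : 'rV_(2 * l))} ->
    (forall w : 'rV['F_2]_p, u (\sum_i w 0 i *: (e i : 'rV_(2 * l))) = w) ->
  #|A| = (2 ^ p)%N.
Proof.
move=> eA Au uE; have uinj : {in A &, injective u}.
  by move=> a a' aA aA' uaa; rewrite (Au a aA) (Au a' aA') uaa.
rewrite -(card_in_imset uinj); have -> : u @: A = setT.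
  by apply/setP => w; rewrite inE -(uE w); apply: imset_f.
by rewrite cardsT card_mx card_Fp // mul1n.
Qed.

Lemma card_decomposition (A B : {set T}) : isotropic_decomposition beta A B ->
  (#|A| * #|B|)%N = (2 ^ (2 * l))%N.
Proof.
case=> _ _ dec _ _; rewrite -card_T -cardsX.
pose f (ab : T * T) := ab.1 + ab.2.
have finj : {in setX A B &, injective f}.
  move=> [a b] [a' b']; rewrite !inE => /andP[/= aA bB] /andP[/= aA' bB'] fE.
  have [ab0 [_ abP]] := dec (f (a, b)).
  by rewrite -(abP (a, b)) // -(abP (a', b')).
rewrite -(card_in_imset finj) -cardsT; congr #|pred_of_set _|.
apply/setP => t; rewrite inE; apply/imsetP.
have [[a b] [[/= aA bB ->] _]] := dec t.
by exists (a, b); rewrite ?inE /= ?aA.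
Qed.

(** An element of B is determined by its pairings with a basis of A, and conversely, so A and B have
    the same dimension, which is l by counting. These pairings identify B with the dual of A and
    bring any isotropic decomposition to the dot product on F_2^l. *)
Lemma lagrangian_coordinates (A B : {set T}) : isotropic_decomposition beta A B ->
  exists u v : T -> 'rV['F_2]_l,
    [/\ {in A & B, forall a b, beta a b = sgn (dot2 (u a) (v b))},
        {in B &, forall b b', v (b + b') = v b + v b'},
        (forall w, exists2 a, a \in A & u a = w) &
        {in B &, injective v} /\ #|B| = (2 ^ l)%N].
Proof.
move=> AB; have [zA zB dec bA bB] := AB.
have [p [e [u [eA wA Au uE]]]] := elementary_coordinates zA.
have [q [e' [u' [eB wB Bu uE']]]] := elementary_coordinates zB.
have cA := card_coordinates wA Au uE; have cB := card_coordinates wB Bu uE'.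
(* An element of B' orthogonal to A' is orthogonal to all of T, because B' is isotropic; so it is
   0. *)
have pair_inj (A' B' : {set T}) p' (e1 : 'I_p' -> T) (u1 : T -> 'rV['F_2]_p') :
    isotropic_decomposition beta A' B' ->
    {in A', forall a, a = \sum_i u1 a 0 i *: (e1 i : 'rV_(2 * l))} ->
    {in B' &, injective (fun b => \row_i dotT (e1 i) b)}.
  move=> AB' Au' b b' bB1 bB1' /rowP ebb; apply/eqP; rewrite -subr_eq0; apply/eqP.
  have [_ zB' dec' _ bB''] := AB'.
  apply: (beta_nondegenerate charF0) => t.
  have [[a c] [[/= aA cB' ->] _]] := dec' t.
  have bbB : b - b' \in B' by case: zB' => _; apply.
  rewrite [LHS]betaC betaDl (bB'' c) // mulr1 (Au' a aA) beta_sgn2 dotT_comb.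
  have -> : \row_i dotT (e1 i) (b - b') = 0.
    apply/rowP => i; rewrite !mxE T_opp dotTC dotTDl ![dotT _ (e1 i)]dotTC.
    by have := ebb i; rewrite !mxE => ->; rewrite F2_addxx.
  by rewrite dot20.
have le_card (A' B' : {set T}) p' (g : T -> 'rV['F_2]_p') : {in B' &, injective g} ->
    (#|B'| <= 2 ^ p')%N.
  move=> ginj; rewrite -(card_in_imset ginj).
  by apply: leq_trans (max_card _) _; rewrite card_mx card_Fp // mul1n.
have vinj := pair_inj A B p e u AB Au.
have lpq : p = q.
  have := le_card B A _ _ (pair_inj B A q e' u' (isotropic_opp AB) Bu).
  have := le_card A B _ _ vinj; rewrite cA cB !leq_exp2l // => qp pq.
  by apply/eqP; rewrite eqn_leq qp pq.
have pl : p = l.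
  have := card_decomposition AB; rewrite cA cB -lpq -expnD => /eqP.
  by rewrite eqn_exp2l // addnn -mul2n eqn_pmul2l // => /eqP.
move: cB; rewrite -lpq pl => cB; clear lpq; subst p.
exists u, (fun b => \row_i dotT (e i) b); split=> //.
- by move=> a b aA bB'; rewrite {1}(Au a aA) beta_sgn2 dotT_comb.
- move=> b b' _ _; apply/rowP => i; rewrite !mxE dotTC dotTDl.
  by rewrite ![dotT _ (e i)]dotTC.
by move=> w; exists (\sum_i w 0 i *: (e i : 'rV_(2 * l))); [exact: wA | exact: uE].
Qed.

End Lagrangian.

(** * The matrices X_ab *)

Section StandardMatrices.
Variables (F : fieldType) (l : nat).
Hypothesis charF0 : [pchar F] =i pred0.
Local Notation T := (T_l l).
Local Notation beta := (@beta_l F l).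
Variables A B : {set T}.
Hypothesis AB : isotropic_decomposition beta A B.
Local Notation X := (@X_mx F (T_l l) beta B).
Local Notation p := #|B|.
Implicit Types (a b s t : T).

Lemma A_closedD : {in A &, forall a a', a + a' \in A}.
Proof. by case: AB => zA *; apply: zmod_closedD. Qed.

Lemma B_closedD : {in B &, forall b b', b + b' \in B}.
Proof. by case: AB => _ zB *; apply: zmod_closedD. Qed.

Lemma A_0 : 0 \in A. Proof. by case: AB => -[]. Qed.
Lemma B_0 : 0 \in B. Proof. by case: AB => _ []. Qed.

Lemma T_eqD a b c : (a == b + c :> T) = (b + a == c).
Proof. by rewrite -[RHS](inj_eq (addrI b)) addrA T_addxx add0r. Qed.

Lemma betaA : {in A &, forall x y, beta x y = 1}. Proof. by case: AB. Qed.
Lemma betaB : {in B &, forall x y, beta x y = 1}. Proof. by case: AB. Qed.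

Lemma T_decomposition t : exists a b, [/\ a \in A, b \in B & t = a + b].
Proof.
by case: AB => _ _ dec _ _; have [[a b] [[/= aA bB tE] _]] := dec t; exists a, b.
Qed.

Lemma decomposition_inj a b a' b' : a \in A -> b \in B -> a' \in A -> b' \in B ->
  a + b = a' + b' -> a = a' /\ b = b'.
Proof.
case: AB => _ _ dec _ _ aA bB aA' bB' E; have [ab [_ abP]] := dec (a + b).
have [-> ->] : (a, b) = (a', b') by rewrite -(abP (a, b)) // -(abP (a', b')).
by [].
Qed.

Lemma decomposition_eq0 a b : a \in A -> b \in B -> a + b = 0 -> a = 0 /\ b = 0.
Proof.
move=> aA bB ab0; apply: (decomposition_inj aA bB A_0 B_0).
by rewrite ab0 addr0.
Qed.

Lemma enumB_index b : b \in B -> exists j : 'I_p, enum_val j = b.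
Proof. by move=> bB; exists (enum_rank_in bB b); rewrite enum_rankK_in. Qed.

Lemma enumB (j : 'I_p) : enum_val j \in B. Proof. exact: enum_valP. Qed.

Lemma X_mul a b a' b' : b' \in B ->
  X a b *m X a' b' = beta a' b *: X (a + a') (b + b').
Proof.
move=> bB; apply/matrixP => i j; rewrite mxE [RHS]mxE [X in _ = _ * X]mxE.
have [c cE] := enumB_index (B_closedD bB (enumB j)).
rewrite (bigD1 c) //= [X in X * _ + _]mxE [X in _ * X + _]mxE cE eqxx mulr1n big1 ?addr0 => [|d dc]; last first.
  rewrite [X in _ * X]mxE; have -> : (enum_val d == b' + enum_val j) = false.
    by apply: contraNF dc => /eqP; rewrite -cE => /enum_val_inj ->.
  by rewrite mulr0n mulr0.
rewrite addrA; case: eqP => _; last by rewrite !mulr0n mul0r mulr0.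
rewrite !mulr1n betaDl mulrCA; congr (_ * _).
by rewrite -addrA [in RHS]betaDr mulrA beta_sq mul1r.
Qed.

Lemma X_trmx a b : (X a b)^T = beta a b *: X a b.
Proof.
apply/matrixP => i j; rewrite !mxE.
have -> : (enum_val j == b + enum_val i) = (enum_val i == b + enum_val j).
  by rewrite T_eqD eq_sym.
case: eqP => [-> | _]; last by rewrite !mulr0n mulr0.
by rewrite !mulr1n betaDr.
Qed.

Lemma X_1 : X 0 0 = 1%:M.
Proof.
apply/matrixP => i j; rewrite !mxE !add0r beta0l (inj_eq enum_val_inj).
by [].
Qed.

Lemma X_sqr a b : b \in B -> X a b *m X a b = beta a b *: 1%:M.
Proof. by move=> bB; rewrite (X_mul _ _ _ bB) (T_addxx a) (T_addxx b) X_1. Qed.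

Lemma X_unitary a b : b \in B -> X a b *m (X a b)^T = 1%:M.
Proof.
by move=> bB; rewrite X_trmx -scalemxAr (X_sqr a bB) scalerA beta_sq scale1r.
Qed.

Lemma X_unitaryV a b : b \in B -> (X a b)^T *m X a b = 1%:M.
Proof. by move=> bB; apply: mulmx1C; exact: X_unitary. Qed.

Lemma X_conj a b a' b' : a \in A -> b \in B -> a' \in A -> b' \in B ->
  X a b *m X a' b' *m (X a b)^T = beta (a + b) (a' + b') *: X a' b'.
Proof.
move=> aA bB aA' bB'; have e : X a b *m X a' b' = beta (a + b) (a' + b') *: (X a' b' *m X a b).
  rewrite [LHS](X_mul a b a' bB') (X_mul a' b' a bB) scalerA [a' + a]addrC [b' + b]addrC; congr (_ *: _).
  rewrite betaDl !betaDr (betaA aA aA') (betaB bB bB') mul1r mulr1.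
  by rewrite mulrAC beta_sq mul1r betaC.
by rewrite [X in X *m _]e -scalemxAl -mulmxA [X in _ *m X](X_unitary a bB) mulmx1.
Qed.

Lemma orthogonality_A b : b \in B -> \sum_(a in A) beta a b = #|A|%:R *+ (b == 0).
Proof.
move=> bB; have [-> | b0] := eqVneq b 0.
  rewrite (eq_bigr (fun=> 1)) => [|a _]; last by rewrite beta0r.
  by rewrite sumr_const.
have [a0 a0A a0b] : exists2 a0, a0 \in A & beta a0 b = -1.
  apply: NNPP => noa; case/eqP: b0; apply: (beta_nondegenerate charF0) => t.
  have [a [b' [aA bB' ->]]] := T_decomposition t.
  rewrite betaC betaDl (betaB bB' bB) mulr1.
  have := beta_sgn2 F a b; case: (F2_cases (dotT a b)) => ->; rewrite ?sgn2_0 //.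
  by rewrite sgn2_1 => ab; case: noa; exists a.
rewrite mulr0n; apply/eqP; set S := \sum_(a in A) _; have : S = - S.
  rewrite {1}/S (reindex_inj (addrI a0)) -sumrN.
  apply: eq_big => [a|a _]; last by rewrite betaDl a0b mulN1r.
  apply/idP/idP => [aA|]; last exact: A_closedD.
  by rewrite -[a]add0r -(T_addxx a0) -addrA; apply: A_closedD.
move/eqP; rewrite -addr_eq0 -mulr2n -mulr_natl mulf_eq0 (pcharf0P _).1 //.
Qed.

(** Fourier inversion over A recovers the matrix units from the X_ab, which therefore span all
    matrices. *)
Lemma X_delta (i j : 'I_p) : \sum_(a in A) beta a (enum_val i) *:
    X a (enum_val i + enum_val j) = #|A|%:R *: delta_mx i j.
Proof.
apply/matrixP => i' j'; rewrite summxE.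
rewrite (eq_bigr (fun a => beta a (enum_val j + enum_val j') *+
    (enum_val i' == enum_val i + enum_val j + enum_val j'))); last first.
  move=> a _; rewrite !mxE mulrnAr -addrA; congr (_ *+ _).
  by rewrite [beta a (_ + (_ + _))]betaDr mulrA beta_sq mul1r.
rewrite sumrMnl orthogonality_A ?B_closedD ?enumB // !mxE.
rewrite -addrA; have -> : (enum_val j + enum_val j' == 0) = (j' == j).
  by rewrite -[X in X == _]T_opp oppr_eq0 addr_eq0 T_opp (inj_eq enum_val_inj) eq_sym.
have [-> | _] := eqVneq j' j; last by rewrite andbF mulr0n mul0rn mulr0.
by rewrite T_addxx addr0 (inj_eq enum_val_inj) andbT mulr1n mulr_natr.
Qed.

Lemma card_A_neq0 : #|A|%:R != 0 :> F.
Proof. by rewrite (pcharf0P _).1 // cards_eq0; apply/set0Pn; exists 0; exact: A_0. Qed.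

Lemma X_ind (Q : 'M[F]_p -> Prop) : Q 0 -> (forall x y, Q x -> Q y -> Q (x + y)) ->
    (forall k x, Q x -> Q (k *: x)) ->
    (forall a b, a \in A -> b \in B -> Q (X a b)) -> forall x, Q x.
Proof.
move=> Q0 QD QZ QX x; rewrite [x]matrix_sum_delta.
apply: big_ind => // i _; apply: big_ind => // j _; apply: (QZ).
have -> : delta_mx i j = #|A|%:R^-1 *: (#|A|%:R *: delta_mx i j) :> 'M[F]_p.
  by rewrite scalerA mulVf ?scale1r // card_A_neq0.
apply: (QZ); rewrite -X_delta; apply: big_ind => // a aA.
by apply: (QZ); apply: QX; rewrite ?B_closedD ?enumB.
Qed.

(** Nondegeneracy gives s with beta s (a + b) = -1; conjugation by the corresponding X changes the
    sign of X a b but not its trace. *)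
Lemma X_trace a b : a \in A -> b \in B -> a + b != 0 -> \tr (X a b) = 0.
Proof.
move=> aA bB ab0; have [s sE] : exists s, beta s (a + b) = -1.
  apply: NNPP => nos; case/eqP: ab0; apply: (beta_nondegenerate charF0) => s.
  have := beta_sgn2 F s (a + b); rewrite betaC.
  case: (F2_cases (dotT s (a + b))) => ->; rewrite ?sgn2_0 // sgn2_1 => sE.
  by case: nos; exists s; rewrite betaC.
have [a' [b' [aA' bB' sE']]] := T_decomposition s; rewrite sE' in sE.
have := X_conj aA' bB' aA bB; rewrite sE scaleN1r => /(congr1 mxtrace).
rewrite mxtrace_mulC mulmxA X_unitaryV // mul1mx linearN /= => /eqP.
by rewrite -addr_eq0 -mulr2n -mulr_natl mulf_eq0 (pcharf0P _).1 // => /eqP.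
Qed.

End StandardMatrices.

Section TensorLemmas.
Variable F : fieldType.

Lemma tens_scale_l m n p q (c : F) (M : 'M_(m, n)) (N : 'M_(p, q)) :
  (c *: M) *t N = c *: (M *t N).
Proof. by apply/matrixP => i j; rewrite !mxE mulrA. Qed.

Lemma tens_scale_r m n p q (c : F) (M : 'M_(m, n)) (N : 'M_(p, q)) :
  M *t (c *: N) = c *: (M *t N).
Proof. by apply/matrixP => i j; rewrite !mxE mulrCA. Qed.

Lemma tens_add_l m n p q (M M' : 'M[F]_(m, n)) (N : 'M_(p, q)) :
  (M + M') *t N = M *t N + M' *t N.
Proof. by apply/matrixP => i j; rewrite !mxE mulrDl. Qed.

Lemma tens_add_r m n p q (M : 'M[F]_(m, n)) (N N' : 'M_(p, q)) :
  M *t (N + N') = M *t N + M *t N'.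
Proof. by apply/matrixP => i j; rewrite !mxE mulrDr. Qed.

Lemma tens_1 m n : 1%:M *t 1%:M = 1%:M :> 'M[F]_(m * n).
Proof.
apply/matrixP => i j; case: (mxtens_indexP i) => i1 i2.
case: (mxtens_indexP j) => j1 j2; rewrite tensmxE !mxE.
rewrite (inj_eq (can_inj (@mxtens_indexK m n))) xpair_eqE.
by case: eqP => _; case: eqP => _; rewrite ?mulr1 ?mulr0 ?mul0r.
Qed.

Lemma tens_delta m n p q (i : 'I_m) (j : 'I_n) (i' : 'I_p) (j' : 'I_q) :
  delta_mx i j *t delta_mx i' j' =
  delta_mx (mxtens_index (i, i')) (mxtens_index (j, j')) :> 'M[F]_(_, _).
Proof.
apply/matrixP => r s; case: (mxtens_indexP r) => r1 r2.
case: (mxtens_indexP s) => s1 s2; rewrite tensmxE !mxE.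
rewrite !(inj_eq (can_inj (@mxtens_indexK _ _))) !xpair_eqE.
by rewrite -natrM mulnb andbACA.
Qed.

Lemma tens_trace m n (M : 'M[F]_m) (N : 'M_n) : \tr (M *t N) = \tr M * \tr N.
Proof.
rewrite /mxtrace mulr_sum; apply: eq_bigr => i _.
by rewrite mxE.
Qed.

Lemma diag_delta_diag n (d e : 'rV[F]_n) i j :
  diag_mx d *m delta_mx i j *m diag_mx e = (d 0 i * e 0 j) *: delta_mx i j.
Proof.
apply/matrixP => r s; rewrite mul_mx_diag mxE mul_diag_mx !mxE.
have [-> | _] := eqVneq r i; last by rewrite /= !mulr0 mul0r.
have [-> | _] := eqVneq s j; last by rewrite /= !mulr0 mul0r.
by rewrite !mulr1.
Qed.

End TensorLemmas.

(** * The components on the full matrix superalgebra *)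

Section GammaPl.
Variables (F : fieldType) (l : nat).
Hypothesis charF0 : [pchar F] =i pred0.
Local Notation T := (T_l l).
Local Notation beta := (@beta_l F l).
Variables A B : {set T}.
Hypothesis AB : isotropic_decomposition beta A B.
Local Notation X := (@X_mx F (T_l l) beta B).
Local Notation p := #|B|.
Variable k : nat.
Local Notation m := (k * p)%N.
Local Notation G := (group_l l k).
Local Notation Gam := (@Gamma_Pl l k F A B m).
Local Notation P := (P_space F m).
Implicit Types (a b s t : T) (g h : G) (e : bool).

Definition elem i j a b : 'M[F]_m := delta_mx i j *t X a b.

Lemma elemE i j a b : elem i j a b = kron beta B m i j a b.
Proof. by rewrite /kron conform_mx_id. Qed.

Definition blk e e' (N : 'M[F]_m) : 'M[F]_(m + m) :=
  match e, e' with
  | false, false => block_mx N 0 0 0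
  | false, true => block_mx 0 N 0 0
  | true, false => block_mx 0 0 N 0
  | true, true => block_mx 0 0 0 N
  end.

(* The blocks together form M_{2k} (x) D with the elementary grading given by
   the degrees [row_deg i false = g_i] and [row_deg i true = g_0 g_i^-1]. *)
Definition row_deg (i : 'I_k) e : G :=
  if e then e0_l l k - gam_l l i else gam_l l i.

Definition deg_T t : G := (t, 0, 0).

Definition blk_deg e e' i j a b : G := row_deg i e + deg_T (a + b) - row_deg j e'.

Local Notation M_comp :=
  (@M_component F (T_l l) beta A B G deg_T k (@gam_l l k) (e0_l l k) m).

Lemma lines_deg e e' i j a b :
  [/\ gam_l l i + deg_T (a + b) - gam_l l j = blk_deg false false i j a b,
      gam_l l i + deg_T (a + b) + gam_l l j - e0_l l k = blk_deg false true i j a b,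
      - gam_l l i + deg_T (a + b) - gam_l l j + e0_l l k = blk_deg true false i j a b
    & - gam_l l i + deg_T (a + b) + gam_l l j = blk_deg true true i j a b].
Proof.
rewrite /blk_deg /row_deg; split=> //.
- by rewrite opprB addrA.
- by rewrite [LHS]addrC !addrA.
by rewrite opprB [RHS]addrC !addrA subrK [LHS]addrC addrA.
Qed.

Lemma memv_line_if (d g : G) (x : 'M[F]_(m + m)) :
  d = g -> x \in (if d == g then <[x]>%VS else 0%VS).
Proof. by move=> ->; rewrite eqxx memv_line. Qed.

Lemma blk_in_M e e' i j a b : a \in A -> b \in B ->
  blk e e' (elem i j a b) \in M_comp (blk_deg e e' i j a b).
Proof.
move=> aA bB; rewrite /M_component.
apply: subvP (sumv_sup i isT (sumv_sup j isT (sumv_sup a aA (sumv_sup b bB (subvv _))))) _ _.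
rewrite /lines_of_degree -elemE.
have [d1 d2 d3 d4] := lines_deg e e' i j a b.
case: e e' d1 d2 d3 d4 => [] [] d1 d2 d3 d4; rewrite /blk.
- by apply: (subvP (addvSr _ _)); exact: memv_line_if.
- by apply: (subvP (addvSl _ _)); apply: (subvP (addvSr _ _)); exact: memv_line_if.
- by do 2!apply: (subvP (addvSl _ _)); apply: (subvP (addvSr _ _)); exact: memv_line_if.
by do 3!apply: (subvP (addvSl _ _)); exact: memv_line_if.
Qed.

Lemma M_ind g (Q : 'M[F]_(m + m) -> Prop) :
    Q 0 -> (forall x y, Q x -> Q y -> Q (x + y)) ->
    (forall c x, Q x -> Q (c *: x)) ->
    (forall e e' i j a b, a \in A -> b \in B -> blk_deg e e' i j a b = g ->
       Q (blk e e' (elem i j a b))) ->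
  forall x, x \in M_comp g -> Q x.
Proof.
move=> Q0 QD QZ QB x /memv_sumP[xi xiP ->].
apply: big_ind => // i _; have /memv_sumP[xj xjP ->] := xiP i isT.
apply: big_ind => // j _; have /memv_sumP[xa xaP ->] := xjP j isT.
apply: big_ind => // a aA; have /memv_sumP[xb xbP ->] := xaP a aA.
apply: big_ind => // b bB; have := xbP b bB; rewrite /lines_of_degree -elemE.
have [d1 d2 d3 d4] := lines_deg false false i j a b.
have line e e' y : y \in (if blk_deg e e' i j a b == g
    then <[blk e e' (elem i j a b)]>%VS else 0%VS) -> Q y.
  case: eqP => [dg /vlineP[c ->]|_]; first by apply: (QZ); exact: QB.
  by rewrite memv0 => /eqP ->.
move/memv_addP => [y /memv_addP[z /memv_addP[u u1 [v v1 ->]] [w w1 ->]] [t t1 ->]].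
apply: (QD); [apply: (QD); [apply: (QD)|]|].
- by apply: (line false false); rewrite -d1.
- by apply: (line false true); rewrite -d2.
- by apply: (line true false); rewrite -d3.
by apply: (line true true); rewrite -d4.
Qed.

Lemma elem_ind (Q : 'M[F]_m -> Prop) : Q 0 -> (forall x y, Q x -> Q y -> Q (x + y)) ->
    (forall c x, Q x -> Q (c *: x)) ->
    (forall i j a b, a \in A -> b \in B -> Q (elem i j a b)) -> forall x, Q x.
Proof.
move=> Q0 QD QZ QE x; rewrite [x]matrix_sum_delta.
apply: big_ind => // r _; apply: big_ind => // s _; apply: (QZ).
case: (mxtens_indexP r) => i i'; case: (mxtens_indexP s) => j j'.
rewrite -tens_delta.
apply: (X_ind charF0 AB (Q := fun y => Q (delta_mx i j *t y))) => [|y z Qy Qz|c y Qy|a b aA bB].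
- by rewrite tensmx0.
- by rewrite tens_add_r; exact: QD.
- by rewrite tens_scale_r; exact: QZ.
exact: QE.
Qed.

Lemma elem_mul i j a b i' j' a' b' : b' \in B ->
  elem i j a b *m elem i' j' a' b' =
  (beta a' b *+ (j == i')) *: elem i j' (a + a') (b + b').
Proof.
move=> bB; rewrite /elem tensmx_mul (X_mul AB) // tens_scale_r.
case: eqP => [-> | /eqP ji]; first by rewrite mul_delta_mx mulr1n.
by rewrite mul_delta_mx_0 // tens0mx scaler0 mulr0n scale0r.
Qed.

Lemma elem_trmx i j a b : (elem i j a b)^T = beta a b *: elem j i a b.
Proof. by rewrite /elem trmx_tens trmx_delta X_trmx tens_scale_r. Qed.

Lemma blk_mul e1 e2 e3 e4 N N' :
  blk e1 e2 N *m blk e3 e4 N' = if e2 == e3 then blk e1 e4 (N *m N') else 0.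
Proof.
by case: e1 e2 e3 e4 => [] [] [] [] /=; rewrite mulmx_block !mulmx0 !mul0mx
  ?addr0 ?add0r // block_mx0.
Qed.

Lemma M_mul g h x y : x \in M_comp g -> y \in M_comp h -> x *m y \in M_comp (g + h).
Proof.
move=> xg yh; move: x xg; apply: M_ind => [|x x' xM xM'|c x xM|e e' i j a b aA bB dg].
- by rewrite mul0mx mem0v.
- by rewrite mulmxDl memvD.
- by rewrite -scalemxAl memvZ.
move: y yh; apply: M_ind => [|y y' yM yM'|c y yM|e1 e1' i' j' a' b' aA' bB' dh].
- by rewrite mulmx0 mem0v.
- by rewrite mulmxDr memvD.
- by rewrite -scalemxAr memvZ.
rewrite blk_mul; case: eqP => [ee|_]; last exact: mem0v.
rewrite elem_mul //; case: eqP => [ji | _]; last first.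
  by rewrite scale0r; case: e e1' {dg dh} => [] []; rewrite /blk block_mx0 mem0v.
have -> : blk e e1' (beta a' b *+ true *: elem i j' (a + a') (b + b')) =
    beta a' b *: blk e e1' (elem i j' (a + a') (b + b')).
  by case: (e) (e1') => [] [] /=; rewrite scale_block_mx !scaler0 mulr1n.
rewrite memvZ //; have -> : g + h = blk_deg e e1' i j' (a + a') (b + b').
  rewrite -dg -dh /blk_deg -ee -ji.
  have -> : deg_T (a + a' + (b + b')) = deg_T (a + b) + deg_T (a' + b').
    by rewrite /deg_T addrACA; congr (_, _, _); rewrite ?addr0.
  by rewrite !addrA subrK.
apply: blk_in_M; [exact: (A_closedD AB) | exact: (B_closedD AB)].
Qed.

Lemma M_parity i g x : x \in M_comp g -> parity_part i x \in M_comp g.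
Proof.
move: x; apply: M_ind => [|x x' xM xM'|c x xM|e e' i1 j a b aA bB dg].
- by rewrite linear0 mem0v.
- by rewrite linearD memvD.
- by rewrite linearZ memvZ.
have := blk_in_M e e' i1 j aA bB; rewrite dg.
by case: i e e' {dg} => [] [] [] /=; rewrite /parity_part ?block_mxKul ?block_mxKur
  ?block_mxKdl ?block_mxKdr ?block_mx0 ?mem0v.
Qed.

End GammaPl.

(** * Universal groups *)

Section FreeEval.
Variables (F : fieldType) (V : vectType F).
Variables (G : zmodType) (Gam : G -> {vspace V}).
Local Notation S := {g : G | in_support Gam g}.
Local Notation free := {freeg S / int}.
Implicit Types w : free.

(** Allows two elements of the free group to be evaluated over one common list. *)
Lemma free_eval_dom (D : seq S) w : uniq D -> {subset dom w <= D} ->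
  free_eval w = \sum_(s <- D) val s *~ coeff s w.
Proof.
move=> uD wD; rewrite (bigID (mem (dom w))) /= [X in _ + X]big1 => [|s /coeff_outdom ->].
  rewrite addr0 -big_filter; apply: perm_big; apply: uniq_perm.
  - exact: uniq_dom.
  - exact: filter_uniq.
  by move=> s; rewrite mem_filter; case: (boolP (s \in dom w)) => // /wD ->.
by rewrite mulr0z.
Qed.

Lemma free_evalB w w' : free_eval (w - w') = free_eval w - free_eval w'.
Proof.
pose D := undup (dom w ++ dom w'); have uD : uniq D := undup_uniq _.
have sD x : x \in dom w ++ dom w' -> x \in D by rewrite mem_undup.
rewrite (free_eval_dom uD (w := w - w')) => [|x /domB /sD //].
rewrite (free_eval_dom uD (w := w)) => [|x xw]; last first.
  by apply: sD; rewrite mem_cat xw.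
rewrite (free_eval_dom uD (w := w')) => [|x xw]; last first.
  by apply: sD; rewrite mem_cat xw orbT.
by rewrite -sumrB; apply: eq_bigr => s _; rewrite coeffB mulrzBr.
Qed.

Lemma free_eval0 : free_eval (0 : free) = 0.
Proof. by rewrite -[0 in LHS](subrr 0) free_evalB subrr. Qed.

Lemma free_evalN w : free_eval (- w) = - free_eval w.
Proof. by rewrite -[in LHS]sub0r free_evalB free_eval0 sub0r. Qed.

Lemma free_evalD w w' : free_eval (w + w') = free_eval w + free_eval w'.
Proof. by rewrite -{1}[w']opprK free_evalB free_evalN opprK. Qed.

Lemma free_eval1 (s : S) : free_eval (<< s >> : free) = val s.
Proof. by rewrite /free_eval domU1 big_seq1 coeffU eqxx mulr1 mulr1z. Qed.

Lemma free_eval_image_subgroup : subgroup (fun u => exists w : free, free_eval w = u).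
Proof.
split; first by exists 0; exact: free_eval0.
by move=> _ _ [w <-] [w' <-]; exists (w - w'); rewrite free_evalB.
Qed.

End FreeEval.

Section UniversalGroupTheory.
Variables (F : closedFieldType) (V : vectType F) (mul : V -> V -> V).
Variable L : bool -> {vspace V}.
Hypothesis charF0 : [pchar F] =i pred0.
Variables (G : zmodType) (Gam : G -> {vspace V}).
Hypothesis mul0l : forall x, mul 0 x = 0.
Hypothesis mul0r : forall x, mul x 0 = 0.
Hypothesis gradG : is_grading mul L Gam.
Local Notation S := {g : G | in_support Gam g}.
Local Notation free := {freeg S / int}.
Implicit Types w : free.

(* If [w] is not a consequence of the relators, some character of the abstract
   universal group does not kill it; by hypothesis that character factors
   through the grading group. *)
Lemma universal_group_kernel :
    (forall c : G -> F, (forall g, (Gam g != 0)%VS -> c g != 0) ->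
       multiplicative_on mul Gam c ->
     exists psi : G -> F, [/\ forall g, psi g != 0,
       forall g h, psi (g + h) = psi g * psi h
       & forall g, (Gam g != 0)%VS -> c g = psi g]) ->
  forall w, free_eval w = 0 <-> generated_subgroup (universal_relator mul (Gam := Gam)) w.
Proof.
move=> extend w; split; last first.
  elim=> [_ [s1 [s2 [s3 [[x [y [xs ys xy0]]] s123 ->]]]]||x y _ ex _ ey].
  - rewrite free_evalB free_evalD !free_eval1.
    have := grading_homogeneous gradG (grading_mul gradG xs ys) (s123 x y xs ys) xy0.
    by move=> ->; rewrite subrr.
  - exact: free_eval0.
  by rewrite free_evalB ex ey subrr.
move=> ew; apply: NNPP => Rw; set R := generated_subgroup _ in Rw.
have sR : subgroup R by split; [exact: gen_zero | exact: gen_sub].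
have [[D [_ DS _ _]] _ _] := gradG.
(* The separating character has to be defined on all generators, and the support is contained in the
   finite list D. *)
pose gens : seq free := [seq << s >> | s <- pmap insub D].
have [H [f [sH cf Rf [Hw fw] Hgens]]] := separating_character gens charF0 sR Rw.
have Hs (s : S) : H << s >>.
  apply: Hgens; apply/mapP; exists s => //; rewrite mem_pmap.
  by apply/mapP; exists (val s); rewrite ?valK //; exact: DS (valP s).
pose c g := if (insub g : option S) is Some s then f << s >> else 0.
have cE (s : S) : c (val s) = f << s >> by rewrite /c valK.
have c0 g : (Gam g != 0)%VS -> c g != 0.
  by move=> g0; rewrite -[g]/(val (exist (in_support Gam) g g0)) cE; apply: cf.1.
have cM : multiplicative_on mul Gam c.
  move=> g h x y xg yh xy0.
  have nz k v : v \in Gam k -> v != 0 -> in_support Gam k.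
    move=> vk v0; rewrite /in_support; apply: contra v0 => /eqP k0.
    by rewrite k0 memv0 in vk.
  have [x0 y0] : x != 0 /\ y != 0.
    by split; apply: contraNneq xy0 => ->; rewrite ?mul0l ?mul0r.
  pose s1 : S := exist _ g (nz g x xg x0); pose s2 : S := exist _ h (nz h y yh y0).
  pose s3 : S := exist _ (g + h) (nz _ _ (grading_mul gradG xg yh) xy0).
  rewrite -[g]/(val s1) -[h]/(val s2) -[X in c X]/(val s3) !cE -cf.2 //.
  have Rr : R (<< s1 >> + << s2 >> - << s3 >>).
    apply: gen_incl; exists s1, s2, s3; split=> //; first by exists x, y.
    by move=> x' y' xs ys; exact: (grading_mul gradG).
  have H12 : H (<< s1 >> + << s2 >>) by apply: subgroupD.
  rewrite -[X in f X = _](subrK (<< s1 >> + << s2 >>)) cf.2 //; last first.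
    by apply: sH.2.
  have [Hr fr] := Rf _ Rr.
  by rewrite -opprB (character_onN sH cf) // fr invr1 mul1r.
have [psi [psi0 psiM cpsi]] := extend c c0 cM.
have psi1 : psi 0 = 1.
  by apply: (mulfI (psi0 0)); rewrite -psiM addr0 mulr1.
have psi_ch : character_on (fun=> True) psi by split=> *.
have sT : subgroup (fun _ : G => True) by [].
have f1 : f w = psi (free_eval w).
  have fE (r : seq S) : f (\sum_(s <- r) << coeff s w *g s >>) =
      psi (\sum_(s <- r) val s *~ coeff s w) /\ H (\sum_(s <- r) << coeff s w *g s >>).
    elim: r => [|s r [IH Hr]].
      by rewrite !big_nil psi1 (character_on0 sH cf); split=> //; exact: sH.1.
    have sE : << coeff s w *g s >> = << s >> *~ coeff s w :> free.
      by rewrite freegU_mulz intz.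
    have Hss : H << coeff s w *g s >> by rewrite sE; apply: subgroupMz.
    rewrite !big_cons cf.2 // psiM IH; split; last exact: subgroupD.
    congr (_ * _); rewrite sE (character_onMz _ sH cf) // (character_onMz _ sT psi_ch) //.
    by rewrite -cpsi ?cE //; exact: (valP s).
  by rewrite -{1}[w]freeg_sumE (fE _).1.
by case/eqP: fw; rewrite f1 ew.
Qed.

End UniversalGroupTheory.

(** * The grading of P(n) by T_l, Z^k and e_0 *)

Section EigenvectorIndependence.
Variables (F : fieldType) (V : lmodType F) (I : eqType).

(* The product of the [Psi - c h], one for each [h <> g] with [x h <> 0],
   kills every [x h] and multiplies [x g] by a nonzero scalar. *)
Lemma eigenvectors_independent (x : I -> V) (S : seq I) g :
    (forall h, h != g -> x h != 0 -> exists (Psi : {linear V -> V}) (c : I -> F),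
       (forall i, Psi (x i) = c i *: x i) /\ c g != c h) ->
  uniq S -> g \in S -> \sum_(h <- S) x h = 0 -> x g = 0.
Proof.
move=> sep uS gS x0.
suff [Psi [c [Psi0 PsiD PsiE cg ch]]] : exists (Psi : V -> V) (c : I -> F),
   [/\ Psi 0 = 0, forall u v, Psi (u + v) = Psi u + Psi v,
       forall i, Psi (x i) = c i *: x i,
       c g != 0 & {in S, forall h, h != g -> c h *: x h = 0}].
  have : Psi (\sum_(h <- S) x h) = 0 by rewrite x0.
  rewrite (big_morph Psi PsiD Psi0) (bigD1_seq g) //= big_seq_cond big1 => [|h].
    by rewrite addr0 PsiE => /eqP; rewrite scaler_eq0 (negbTE cg) => /eqP.
  by case/andP => hS hg; rewrite PsiE ch.
elim: S {uS gS x0} => [|h S [Psi [c [Psi0 PsiD PsiE cg ch]]]].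
  exists id, (fun=> 1); split=> //; rewrite ?oner_eq0 // => i.
  by rewrite scale1r.
have [-> | hg] := eqVneq h g.
  exists Psi, c; split=> // i; rewrite inE => /predU1P[-> | iS]; last exact: ch.
  by rewrite eqxx.
have [xh0 | xh0] := eqVneq (x h) 0.
  exists Psi, c; split=> // i; rewrite inE => /predU1P[-> | iS]; last exact: ch.
  by rewrite xh0 scaler0.
have [Phi [d [PhiE dgh]]] := sep h hg xh0.
exists (fun v => Phi (Psi v) - d h *: Psi v), (fun i => c i * (d i - d h)); split.
- by rewrite Psi0 linear0 scaler0 subr0.
- by move=> u v; rewrite PsiD linearD scalerDr opprD addrACA.
- by move=> i; rewrite PsiE linearZ /= PhiE !scalerA -scalerBl mulrBr [d h * _]mulrC.
- by rewrite mulf_neq0 // subr_eq0.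
move=> i; rewrite inE => /predU1P[-> _ | iS ig]; first by rewrite subrr mulr0 scale0r.
by rewrite mulrC -scalerA ch ?scaler0.
Qed.

End EigenvectorIndependence.

Section PClosed.
Variables (F : fieldType) (m : nat).

Lemma P_closed (charF0 : [pchar F] =i pred0) (x y : 'M[F]_(m + m)) :
  x \in P_space F m -> y \in P_space F m -> supercommutator x y \in P_space F m.
Proof.
case/P_spaceP => a [b [c [-> ta sb sc]]] /P_spaceP[a' [b' [c' [-> ta' sb' sc']]]].
have cT : c^T = - c by rewrite {2}sc opprK.
have cT' : c'^T = - c' by rewrite {2}sc' opprK.
have tr0 (u v : 'M[F]_m) : u = u^T -> v^T = - v -> \tr (u *m v) = 0.
  move=> su sv; have /eqP : \tr (u *m v) = - \tr (u *m v).
    rewrite -{1}mxtrace_tr trmx_mul sv -su mulNmx [LHS]linearN /= mxtrace_mulC.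
    by [].
  by rewrite -addr_eq0 -mulr2n -mulr_natl mulf_eq0 (pcharf0P _).1 // => /eqP.
rewrite supercommutator_block; set A := (X in block_mx X _ _ _).
set B := (X in block_mx _ X _ _); set C := (X in block_mx _ _ X _).
set D := (X in block_mx _ _ _ X).
have trB (u v : 'M[F]_m) : (u - v)^T = u^T - v^T by rewrite linearB.
have trD (u v : 'M[F]_m) : (u + v)^T = u^T + v^T by rewrite linearD.
have trN (u : 'M[F]_m) : (- u)^T = - u^T by rewrite linearN.
have -> : D = - A^T.
  rewrite /D /A trD trB trD !trmx_mul -sb -sb' cT cT' opprD opprB opprD.
  by rewrite !mulNmx !mulmxN !opprK [c' *m b + _]addrC.
rewrite -/(pmx A B C) mem_pmx; apply/and3P; split; apply/eqP.
- rewrite /A mxtraceD raddfB /= mxtrace_mulC subrr add0r mxtraceD !tr0 ?addr0 //.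
- rewrite /B !mulmxN !opprK trD trD trB !trmx_mul trN !trmx_mul trmxK -sb -sb'.
  by rewrite !trmxK; congr (_ + _); exact: addrC.
rewrite /C !mulNmx !opprK !(trD, trN, trB) !trmx_mul !trmxK cT cT'.
by rewrite ?mulNmx ?mulmxN ?opprD ?opprK; congr (_ + _); exact: addrC.
Qed.
End PClosed.

Section GammaPlGrading.
Variables (F : fieldType) (l : nat).
Hypothesis charF0 : [pchar F] =i pred0.
Local Notation T := (T_l l).
Local Notation beta := (@beta_l F l).
Variables A B : {set T}.
Hypothesis AB : isotropic_decomposition beta A B.
Local Notation X := (@X_mx F (T_l l) beta B).
Local Notation p := #|B|.
Variable k : nat.
Local Notation m := (k * p)%N.
Local Notation G := (group_l l k).
Local Notation Gam := (@Gamma_Pl l k F A B m).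
Local Notation P := (P_space F m).
Local Notation M_comp :=
  (@M_component F (T_l l) beta A B G (@deg_T l k) k (@gam_l l k) (e0_l l k) m).
Local Notation elem := (@elem F l B k).
Local Notation blk := (@blk F l B k).
Implicit Types (a b s t : T) (g h : G) (e : bool) (lam : 'rV[F]_k).

Definition nonzero_row lam := forall i, lam 0 i != 0.

(** The character of the grading group that pairs T with s, sends e_i to lam_i and e_0 to 1. The
    value at e_0 can be fixed because on degrees of level 0 the last coordinate is determined by the
    Z^k coordinate. *)
Definition weight lam s g : F := beta s g.1.1 * \prod_i lam 0 i ^ (g.1.2 0 i).

Lemma weightD lam s g h : nonzero_row lam ->
  weight lam s (g + h) = weight lam s g * weight lam s h.
Proof.
move=> lam0; rewrite /weight betaDr mulrACA -big_split; congr (_ * _).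
by apply: eq_bigr => i _; rewrite mxE expfzDr.
Qed.

Lemma weight0 lam s : weight lam s 0 = 1.
Proof.
by rewrite /weight beta0r mul1r big1 // => i _; rewrite mxE expr0z.
Qed.

Lemma weight_neq0 lam s g : nonzero_row lam -> weight lam s g != 0.
Proof.
move=> lam0; apply/eqP => w0; have := weight0 lam s.
by rewrite -(subrr g) weightD // w0 mul0r => /esym/eqP; rewrite oner_eq0.
Qed.

Lemma weightN lam s g : nonzero_row lam -> weight lam s (- g) = (weight lam s g)^-1.
Proof.
move=> lam0; apply: (mulfI (weight_neq0 s g lam0)); rewrite mulfV ?weight_neq0 //.
by rewrite -weightD // subrr weight0.
Qed.

Lemma weight_gam lam s i : weight lam s (gam_l l i) = lam 0 i.
Proof.
rewrite /weight beta0r mul1r (bigD1 i) //= mxE !eqxx expr1z big1 ?mulr1 // => j ji.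
by rewrite mxE (negbTE ji) andbF expr0z.
Qed.

Lemma weight_e0 lam s : weight lam s (e0_l l k) = 1.
Proof. by rewrite /weight beta0r mul1r big1 // => i _; rewrite mxE expr0z. Qed.

Lemma weight_T lam s t : weight lam s (deg_T k t) = beta s t.
Proof. by rewrite /weight big1 ?mulr1 // => i _; rewrite mxE expr0z. Qed.

Definition theta lam a b : 'M[F]_m := diag_mx lam *t X a b.

Definition inv_row lam : 'rV[F]_k := \row_i (lam 0 i)^-1.

Lemma thetaV lam a b : nonzero_row lam -> b \in B ->
  theta lam a b *m (diag_mx (inv_row lam) *t (X a b)^T) = 1%:M.
Proof.
move=> lam0 bB; rewrite /theta tensmx_mul (X_unitary AB) // mulmx_diag -[RHS]tens_1.
congr (_ *t _); apply/matrixP => i j; rewrite !mxE.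
by have [_ | //] := eqVneq i j; rewrite mulfV ?mulr1n.
Qed.

Lemma theta_unit lam a b : nonzero_row lam -> b \in B -> theta lam a b \in unitmx.
Proof. by move=> lam0 bB; exact: (mulmx1_unit (thetaV a lam0 bB)).1. Qed.

Lemma theta_inv lam a b : nonzero_row lam -> b \in B ->
  invmx (theta lam a b) = diag_mx (inv_row lam) *t (X a b)^T.
Proof.
move=> lam0 bB; apply: (can_inj (mulKmx (theta_unit a lam0 bB))).
by rewrite thetaV // mulmxV // theta_unit.
Qed.

(** The left factor by which Ad x acts on block row e; the right factor on a block column is
    expressed by the same function, so that the four blocks are treated at once. *)
Definition row_factor (x : 'M[F]_m) e : 'M[F]_m := if e then (invmx x)^T else x.

Lemma Ad_blk x e e' N :
  Ad x (blk e e' N) = blk e e' (row_factor x e *m N *m (row_factor (invmx x)^T e')^T).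
Proof.
by case: e e' => [] [] /=; rewrite Ad_block !mulmx0 !mul0mx ?trmxK ?trmx_inv ?trmxK
  ?invmxK ?trmxK.
Qed.

Lemma blkZ c e e' N : blk e e' (c *: N) = c *: blk e e' N.
Proof. by case: e e' => [] [] /=; rewrite scale_block_mx !scaler0. Qed.

Lemma Ad_theta lam a b g x : nonzero_row lam -> a \in A -> b \in B ->
  x \in M_comp g -> Ad (theta lam a b) x = weight lam (a + b) g *: x.
Proof.
move=> lam0 aA bB; move: x; apply: M_ind => [|x y Ex Ey|c x Ex|e e' i j a' b' aA' bB' <-].
- by rewrite linear0 scaler0.
- by rewrite linearD /= Ex Ey scalerDr.
- by rewrite linearZ /= Ex !scalerA mulrC.
rewrite Ad_blk -blkZ; congr blk.
pose pw e1 : 'rV[F]_k := if e1 then inv_row lam else lam.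
have rE e1 : row_factor (theta lam a b) e1 = diag_mx (pw e1) *t X a b.
  case: e1 => //=; rewrite theta_inv // trmx_tens trmxK tr_diag_mx //.
have rE' e1 : (row_factor (invmx (theta lam a b))^T e1)^T =
    diag_mx (pw (~~ e1)) *t (X a b)^T.
  case: e1 => /=; last by rewrite trmxK theta_inv.
  by rewrite trmx_inv trmxK invmxK trmx_tens tr_diag_mx.
rewrite rE rE' /elem tensmx_mul tensmx_mul diag_delta_diag (X_conj AB) //.
rewrite tens_scale_l tens_scale_r scalerA; congr (_ *: _).
rewrite /blk_deg !weightD // weightN // weight_T.
have wE i1 e1 : weight lam (a + b) (row_deg l i1 e1) = pw e1 0 i1.
  case: e1 => /=; last by rewrite weight_gam.
  by rewrite weightD // weightN // weight_gam weight_e0 mul1r mxE.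
rewrite !wE mulrAC; congr (_ * _ * _).
by case: e' => /=; rewrite mxE ?invrK.
Qed.

Implicit Types (i j : 'I_k).

Lemma Gamma_Pl_P g x : x \in Gam g -> x \in M_comp g /\ x \in P.
Proof. by rewrite memv_cap => /andP. Qed.

(** A homomorphism to the integers with kernel G_(l): every [row_deg] has level 1, so the difference
    of two of them has level 0. *)
Definition level g : int := \sum_i g.1.2 0 i + g.2 *+ 2.

Lemma levelD g h : level (g + h) = level g + level h.
Proof.
rewrite /level /= mulrnDl [RHS]addrACA -big_split; congr (_ + _).
by apply: eq_bigr => i _; rewrite mxE.
Qed.

Lemma levelN g : level (- g) = - level g.
Proof.
apply/eqP; rewrite -addr_eq0 addrC -levelD subrr /level big1 ?add0r // => i _.
by rewrite mxE.
Qed.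

Lemma level_row_deg i e : level (row_deg l i e) = 1.
Proof.
have lg : level (gam_l l i) = 1.
  rewrite /level (bigD1 i) //= mxE !eqxx big1 ?addr0 // => j ji.
  by rewrite mxE (negbTE ji) andbF.
case: e => //=; rewrite levelD levelN lg /level big1 ?add0r // => j _.
by rewrite mxE.
Qed.

Lemma level_blk_deg e e' i j a b : level (blk_deg e e' i j a b) = 0.
Proof.
rewrite /blk_deg !levelD levelN !level_row_deg /level big1 => [|r _].
  by rewrite mul0rn !addr0 subrr.
by rewrite mxE.
Qed.

Lemma M_level g x : x \in M_comp g -> x != 0 -> level g = 0.
Proof.
move=> xg x0; apply: NNPP => gl; case/eqP: x0; move: x xg.
apply: M_ind => // [x y -> ->|c x ->|e e' i j a b _ _ dg].
- by rewrite addr0.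
- by rewrite scaler0.
by case: gl; rewrite -dg level_blk_deg.
Qed.

(** In characteristic 0 the element 2 has infinite multiplicative order, so its powers tell integer
    exponents apart. *)
Lemma expz2_inj : injective (fun z : int => 2 ^ z : F).
Proof.
have n20 : (2 : F) != 0 by rewrite (pcharf0P _).1.
have pos (r : nat) : (2 : F) ^+ r = 1 -> r = 0%N.
  case: r => // r /eqP; rewrite -natrX -subr_eq0.
  have -> : ((2 ^ r.+1)%:R - 1 : F) = (2 ^ r.+1 - 1)%:R.
    by rewrite natrB // expn_gt0.
  rewrite (pcharf0P _).1 // subn_eq0 leqNgt => /negP[].
  by rewrite -[X in (X < _)%N](expn0 2) ltn_exp2l.
move=> z z' /eqP /= zz; apply/eqP; rewrite -subr_eq0.
have : (2 : F) ^ (z - z') == 1.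
  by rewrite expfzDr // (eqP zz) -expfzDr // subrr expr0z.
case: (z - z') => r => [/eqP/pos -> //|].
rewrite NegzE -exprnN invr_eq1 => /eqP/pos //.
Qed.

(** If the T components differ, nondegeneracy of beta separates them; if the Z^k components differ
    at i, take lam with entry 2 at i and 1 elsewhere. Otherwise level 0 forces the last components
    to be equal. *)
Lemma weight_separates g h : level g = 0 -> level h = 0 -> g != h ->
  exists lam a b, [/\ nonzero_row lam, a \in A, b \in B
    & weight lam (a + b) g != weight lam (a + b) h].
Proof.
move=> lg lh gh.
have [tt | tt] := eqVneq g.1.1 h.1.1; last first.
  have [s sE] : exists s, beta s g.1.1 != beta s h.1.1.
    apply: NNPP => nos; case/eqP: tt; apply/eqP; rewrite -subr_eq0; apply/eqP.
    apply: (beta_nondegenerate charF0) => s; rewrite betaC T_opp betaDr.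
    have [-> | sE] := eqVneq (beta s g.1.1) (beta s h.1.1); first exact: beta_sq.
    by case: nos; exists s.
  have [a [b [aA bB sab]]] := T_decomposition AB s.
  exists (const_mx 1), a, b; split=> // [i|]; first by rewrite mxE oner_eq0.
  rewrite -sab /weight !big1 ?mulr1 // => i _; by rewrite mxE exp1rz.
have [zz | zz] := eqVneq g.1.2 h.1.2.
  case/eqP: gh; move: tt zz lg lh; case: g => -[t z] c; case: h => -[t' z'] c' /= -> ->.
  rewrite /level /= => e1 e2; congr (_, _, _).
  by have /addrI/eqP := etrans e1 (esym e2); rewrite eqr_pMn2r // => /eqP.
have [i zi] : exists i, g.1.2 0 i != h.1.2 0 i.
  apply: NNPP => noi; case/eqP: zz; apply/rowP => i.
  by apply/eqP; apply: contraT => gi; case: noi; exists i.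
exists (\row_j (if j == i then 2 else 1)), 0, 0; split.
- move=> j; rewrite mxE; case: (j == i); last by rewrite oner_eq0.
  by rewrite (pcharf0P _).1.
- exact: (A_0 AB).
- exact: (B_0 AB).
rewrite /weight !addr0 !beta0l !mul1r.
have prodE (z : 'rV[int]_k) :
    \prod_j (\row_j (if j == i then 2 else 1 : F)) 0 j ^ z 0 j = 2 ^ z 0 i.
  rewrite (bigD1 i) //= mxE eqxx big1 ?mulr1 // => j /negbTE ji.
  by rewrite mxE ji exp1rz.
by rewrite !prodE (inj_eq expz2_inj).
Qed.

Hypothesis k_gt0 : (0 < k)%N.

Lemma m_neq0 : m%:R != 0 :> F.
Proof.
rewrite (pcharf0P _).1 // muln_eq0 negb_or -!lt0n k_gt0 /=.
by apply/card_gt0P; exists 0; exact: (B_0 AB).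
Qed.

(** A finite list containing the support; it may be larger, since a and b range over all of T. *)
Definition degrees : seq G := undup [seq
  blk_deg q.1.1.1.1.1 q.1.1.1.1.2 q.1.1.1.2 q.1.1.2 q.1.2 q.2 |
  q <- enum {: bool * bool * 'I_k * 'I_k * T * T}].

Lemma mem_degrees e e' i j a b : blk_deg e e' i j a b \in degrees.
Proof.
rewrite mem_undup; apply/mapP; exists (e, e', i, j, a, b) => //.
by rewrite mem_enum.
Qed.

Lemma M_degrees g x : x \in M_comp g -> x != 0 -> g \in degrees.
Proof.
move=> xg x0; apply: contraT => gd; case/eqP: x0; move: x xg.
apply: M_ind => // [x y -> ->|c x ->|e e' i j a b _ _ dg].
- by rewrite addr0.
- by rewrite scaler0.
by case/negP: gd; rewrite -dg mem_degrees.
Qed.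

Local Notation W := (\sum_(g <- degrees) Gam g)%VS.

Lemma Gamma_Pl_sub g x : x \in Gam g -> x \in W.
Proof.
move=> xg; have [-> | x0] := eqVneq x 0; first exact: mem0v.
have gd := M_degrees (Gamma_Pl_P xg).1 x0.
by rewrite (big_rem g) //=; apply: (subvP (addvSl _ _)).
Qed.

(** Degrees on the odd blocks are symmetric in i and j, so symmetrizing or skew-symmetrizing inside
    these blocks preserves homogeneity. *)
Lemma blk_sym_deg e i j a b : blk_deg e (~~ e) i j a b = blk_deg e (~~ e) j i a b.
Proof.
have swap (V : zmodType) (x y z w : V) : x + w - (z - y) = y + w - (z - x).
  by rewrite !opprB [x + w]addrC [y + w]addrC -!addrA [x + (y - z)]addrCA.
have swapN (V : zmodType) (x y z w : V) : z - x + w - y = z - y + w - x.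
  by rewrite [z - x + w]addrAC [z - y + w]addrAC; exact: addrAC.
by case: e; [exact: swapN | exact: swap].
Qed.

Lemma pmx_blk_even i j a b : pmx (elem i j a b) 0 0 =
  blk false false (elem i j a b) + blk true true (- (elem i j a b)^T).
Proof. by rewrite /blk /pmx add_block_mx !addr0 add0r. Qed.

Lemma even_in_M i j a b : a \in A -> b \in B ->
  pmx (elem i j a b) 0 0 \in M_comp (blk_deg false false i j a b).
Proof.
move=> aA bB; rewrite pmx_blk_even; apply: memvD; first exact: blk_in_M.
rewrite elem_trmx -scaleNr blkZ memvZ //.
have -> : blk_deg false false i j a b = blk_deg true true j i a b.
  by rewrite /blk_deg /row_deg opprB [RHS]addrC !addrA subrK addrAC.
exact: blk_in_M.
Qed.

Lemma sym_in_M i j a b : a \in A -> b \in B ->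
  pmx 0 (elem i j a b + (elem i j a b)^T) 0 \in M_comp (blk_deg false true i j a b).
Proof.
move=> aA bB.
have -> : pmx 0 (elem i j a b + (elem i j a b)^T) 0 =
    blk false true (elem i j a b) + beta a b *: blk false true (elem j i a b).
  by rewrite -blkZ -elem_trmx /blk /pmx add_block_mx !addr0 trmx0 oppr0.
apply: memvD; first exact: blk_in_M.
by apply: memvZ; rewrite (blk_sym_deg false); exact: blk_in_M.
Qed.

Lemma skew_in_M i j a b : a \in A -> b \in B ->
  pmx 0 0 (elem i j a b - (elem i j a b)^T) \in M_comp (blk_deg true false i j a b).
Proof.
move=> aA bB.
have -> : pmx 0 0 (elem i j a b - (elem i j a b)^T) =
    blk true false (elem i j a b) - beta a b *: blk true false (elem j i a b).
  by rewrite -blkZ -elem_trmx /blk /pmx opp_block_mx add_block_mx !oppr0 !addr0 trmx0 oppr0.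
apply: memvB; first exact: blk_in_M.
by apply: memvZ; rewrite (blk_sym_deg true); exact: blk_in_M.
Qed.

Lemma elem_trace i j a b : a \in A -> b \in B ->
  (i, a, b) != (j, 0, 0) -> \tr (elem i j a b) = 0.
Proof.
move=> aA bB ijab; rewrite /elem tens_trace.
have [ij | ij] := eqVneq i j; last first.
  rewrite [\tr _]big1 ?mul0r // => r _; rewrite mxE.
  by case: eqP => //= ->; rewrite (negbTE ij).
rewrite (X_trace charF0 AB) ?mulr0 //; apply: contra ijab => /eqP ab0.
by have [-> ->] := decomposition_eq0 AB aA bB ab0; rewrite ij.
Qed.

Lemma blk_deg_diag e i a b : blk_deg e e i i a b = deg_T k (a + b).
Proof. by rewrite /blk_deg addrAC addrN add0r. Qed.

Lemma sum_elem_1 : \sum_i elem i i 0 0 = 1%:M.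
Proof.
have E : 1%:M = \sum_i delta_mx i i :> 'M[F]_k.
  by rewrite scalar_mx_sum_delta; apply: eq_bigr => i _; rewrite scale1r.
rewrite -tens_1 E (big_morph (fun N => N *t (1%:M : 'M[F]_p))
  (fun x y => tens_add_l x y _) (tens0mx _)).
by apply: eq_bigr => i _; rewrite /elem X_1.
Qed.

Lemma W_ind_pmx (f : 'M[F]_m -> 'M[F]_(m + m)) :
    f 0 = 0 -> (forall x y, f (x + y) = f x + f y) -> (forall c x, f (c *: x) = c *: f x) ->
    (forall i j a b, a \in A -> b \in B -> f (elem i j a b) \in W) ->
  forall x, f x \in W.
Proof.
move=> f0 fD fZ fE; apply: (elem_ind charF0 AB) => [|x y Wx Wy|c x Wx|//].
- by rewrite f0 mem0v.
- by rewrite fD memvD.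
- by rewrite fZ memvZ.
Qed.

Lemma Gamma_Pl_grading : is_grading (@supercommutator F m) (@P_part F m) Gam.
Proof.
split; last 2 first.
- move=> g; apply/eqP; rewrite eqEsubv subv_add !capvSl /= andbT.
  apply/subvP => x xg; have [xM xP] := Gamma_Pl_P xg.
  have -> : x = parity_part false x + parity_part true x.
    rewrite -{1}[x]submxK /parity_part add_block_mx !addr0 !add0r.
    by [].
  have [a [b [c [xE ta sb sc]]]] := P_spaceP _ xP.
  have p0 : parity_part false x = pmx a 0 0.
    by rewrite xE /parity_part block_mxKul block_mxKdr.
  have p1 : parity_part true x = pmx 0 b c.
    by rewrite xE /parity_part block_mxKur block_mxKdl /pmx trmx0 oppr0.
  have P0 : pmx a 0 0 \in P_part F m false by apply/P_evenP; exists a.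
  have P1 : pmx 0 b c \in P_part F m true by apply/P_oddP; exists b, c.
  apply: memv_add; rewrite memv_cap ?p0 ?p1 ?P0 ?P1 andbT memv_cap.
    by rewrite -{1}p0 (M_parity _ xM) //= (subvP (P_part_sub _ _ _) _ P0).
  by rewrite -{1}p1 (M_parity _ xM) //= (subvP (P_part_sub _ _ _) _ P1).
- move=> g h x y xg yh; have [xM xP] := Gamma_Pl_P xg; have [yM yP] := Gamma_Pl_P yh.
  rewrite memv_cap P_closed // andbT /supercommutator.
  apply: memv_suml => i _; apply: memv_suml => j _; rewrite memvB ?memvZ //.
    by apply: (M_mul AB); exact: M_parity.
  by rewrite addrC; apply: (M_mul AB); exact: M_parity.
exists degrees; split.
- exact: undup_uniq.
- move=> g; rewrite unfold_in => g0.
  have /Gamma_Pl_P[xM _] := memv_pick (Gam g).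
  by apply: M_degrees xM _; rewrite vpick0.
- apply/directv_seqP; first exact: undup_uniq.
  move=> x xG x0 g gd; have [//|xg0] := eqVneq (x g) 0.
  (* Components of different degrees are independent because some [Ad (theta lam a b)] acts on them
     by different weights. *)
  apply: (eigenvectors_independent _ (undup_uniq _) gd x0) => h hg xh0.
  rewrite eq_sym in hg.
  have [lam [a [b [lam0 aA bB sep]]]] := weight_separates
    (M_level (Gamma_Pl_P (xG g)).1 xg0) (M_level (Gamma_Pl_P (xG h)).1 xh0) hg.
  exists (Ad (theta lam a b)), (weight lam (a + b)); split=> // i.
  by apply: Ad_theta => //; exact: (Gamma_Pl_P (xG i)).1.
rewrite total_P; apply/eqP; rewrite eqEsubv; apply/andP; split.
  rewrite big_seq; apply: (big_ind (fun U : {vspace _} => (U <= P)%VS)) => //.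
  - exact: sub0v.
  - by move=> U U' UP U'P; rewrite subv_add UP.
  by move=> g _; exact: capvSr.
apply/subvP => x /P_spaceP[a [b [c [-> ta sb sc]]]].
have -> : pmx a b c = pmx a 0 0 + pmx 0 b 0 + pmx 0 0 c.
  by rewrite !pmxD !addr0 !add0r.
have n2 : (2 : F) != 0 := natF_neq0 charF0 1.
apply: memvD; first apply: memvD.
- have sc0 : (0 : F)%:M = 0 :> 'M[F]_m by apply/matrixP => i j; rewrite !mxE mul0rn.
  (* Induction over [elem] runs through all matrices, so a is replaced by its traceless part, a
     linear function of an arbitrary matrix. The diagonal elements with a = b = 0 are corrected by
     the identity, which also has degree 0. *)
  pose f N := pmx (N - (\tr N / m%:R)%:M) 0 0 : 'M[F]_(m + m).
  have -> : pmx a 0 0 = f a by rewrite /f ta mul0r sc0 subr0.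
  have fE N : \tr N = 0 -> f N = pmx N 0 0 by rewrite /f => ->; rewrite mul0r sc0 subr0.
  apply: W_ind_pmx => [|y z|z y|i j a' b' aA bB].
  + by rewrite fE ?mxtrace0 // pmx0.
  + rewrite /f pmxD !addr0 mxtraceD mulrDl; congr (pmx _ 0 0).
    by rewrite addrACA -opprD; congr (_ - _); apply/matrixP => i j; rewrite !mxE mulrnDl.
  + rewrite /f pmxZ !scaler0 mxtraceZ -mulrA; congr (pmx _ 0 0).
    by rewrite scalerBr scale_scalar_mx.
  have [ijab | /(elem_trace aA bB) tr0] := eqVneq (i, a', b') (j, 0, 0); last first.
    rewrite fE //; apply: (Gamma_Pl_sub (g := blk_deg false false i j a' b')).
    by rewrite memv_cap even_in_M //= mem_pmx tr0 !trmx0 oppr0 !eqxx.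
  case: ijab => -> -> ->; apply: (Gamma_Pl_sub (g := 0)); rewrite memv_cap.
  have deg0 (r : 'I_k) : blk_deg false false r r (0 : T) 0 = 0.
    by rewrite blk_deg_diag addr0.
  have M0 r : pmx (elem r r 0 0) 0 0 \in M_comp 0.
    by rewrite -(deg0 r); apply: even_in_M; [exact: (A_0 AB) | exact: (B_0 AB)].
  have -> : f (elem j j 0 0) =
      pmx (elem j j 0 0) 0 0 - (\tr (elem j j 0 0) / m%:R) *: pmx 1%:M 0 0.
    rewrite -scaleNr pmxZ pmxD !scaler0 !addr0 /f scaleNr; congr (pmx (_ - _) 0 0).
    by rewrite scale_scalar_mx mulr1.
  apply/andP; split; last first.
    rewrite -scaleNr pmxZ pmxD !scaler0 addr0 mem_pmx !trmx0 oppr0 !eqxx !andbT.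
    by rewrite mxtraceD mxtraceZ mxtrace1 mulNr divfK ?subrr // m_neq0.
  rewrite memvB // memvZ // -sum_elem_1.
  rewrite (big_morph (fun N => pmx N 0 0) (id1 := 0) (op1 := +%R)) ?pmx0 //; last first.
    by move=> y z; rewrite pmxD !addr0.
  by apply: memv_suml => r _; exact: M0.
(* Likewise twice a symmetric b is N + N^T with N = b, which is linear in an arbitrary N. *)
- rewrite -[pmx 0 b 0]scale1r -(mulVf n2) -scalerA memvZ //.
  have -> : 2 *: pmx 0 b 0 = pmx 0 (b + b^T) 0 :> 'M[F]_(m + m).
    by rewrite -sb pmxZ !scaler0 scaler_nat mulr2n.
  apply: (W_ind_pmx (f := fun N => pmx 0 (N + N^T) 0)) => [|y z|z y|i j a' b' aA bB].
  + by rewrite trmx0 addr0 pmx0.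
  + by rewrite linearD /= addrACA pmxD !addr0.
  + by rewrite linearZ /= -scalerDr pmxZ !scaler0.
  apply: (Gamma_Pl_sub (g := blk_deg false true i j a' b')).
  rewrite memv_cap sym_in_M //= mem_pmx mxtrace0 [(_ + _)^T]linearD /= trmxK addrC.
  by rewrite trmx0 oppr0 !eqxx.
rewrite -[pmx 0 0 c]scale1r -(mulVf n2) -scalerA memvZ //.
have -> : 2 *: pmx 0 0 c = pmx 0 0 (c - c^T) :> 'M[F]_(m + m).
  by rewrite -sc pmxZ !scaler0 scaler_nat mulr2n.
apply: (W_ind_pmx (f := fun N => pmx 0 0 (N - N^T))) => [|y z|z y|i j a' b' aA bB].
- by rewrite trmx0 subr0 pmx0.
- by rewrite linearD /= opprD addrACA pmxD !addr0.
- by rewrite linearZ /= -scalerBr pmxZ !scaler0.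
apply: (Gamma_Pl_sub (g := blk_deg true false i j a' b')).
rewrite memv_cap skew_in_M //= mem_pmx mxtrace0 [(_ - _)^T]linearB /= trmxK opprB.
by rewrite trmx0 !eqxx.
Qed.

Lemma theta_elem lam a' b' i j a b : nonzero_row lam -> a' \in A -> b' \in B ->
    a \in A -> b \in B ->
  theta lam a' b' *m elem i j a b =
    weight lam (a' + b') (blk_deg false false i j a b) *:
      (elem i j a b *m theta lam a' b').
Proof.
move=> lam0 aA' bB' aA bB; have uth := theta_unit a' lam0 bB'.
have := Ad_theta lam0 aA' bB' (even_in_M i j aA bB).
rewrite Ad_pmx pmxZ => /pmx_inj[e _ _].
by rewrite scalemxAl -e mulmxKV.
Qed.

(** Otherwise tr(x y) = 0 for all y, in particular for the inverse of x, while m is nonzero in F. *)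
Lemma trace_form_neq0 (x : 'M[F]_m) : x \in unitmx ->
  exists i j a b, [/\ a \in A, b \in B & \tr (x *m elem i j a b) != 0].
Proof.
move=> ux; apply: NNPP => noE.
have x0 y : \tr (x *m y) = 0.
  move: y; apply: (elem_ind charF0 AB) => [|y z ty tz|c y ty|i j a b aA bB].
  - by rewrite mulmx0 mxtrace0.
  - by rewrite mulmxDr mxtraceD ty tz addr0.
  - by rewrite -scalemxAr mxtraceZ ty mulr0.
  by apply/eqP; apply: contraT => tE; case: noE; exists i, j, a, b.
have /eqP := x0 (invmx x); rewrite mulmxV // mxtrace1.
by rewrite (negbTE m_neq0).
Qed.

Definition ones_row : 'rV[F]_k := const_mx 1.

Lemma ones_nonzero : nonzero_row ones_row.
Proof. by move=> i; rewrite mxE oner_eq0. Qed.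

Lemma theta_ones a b : theta ones_row a b = 1%:M *t X a b.
Proof. by rewrite /theta diag_const_mx. Qed.

Lemma theta_mulC lam a b mu a' b' : nonzero_row lam -> nonzero_row mu ->
    a \in A -> b \in B -> a' \in A -> b' \in B ->
  theta lam a b *m theta mu a' b' =
    beta (a + b) (a' + b') *: (theta mu a' b' *m theta lam a b).
Proof.
move=> lam0 mu0 aA bB aA' bB'; rewrite /theta [in LHS]tensmx_mul [in RHS]tensmx_mul.
rewrite diag_mxC -tens_scale_r; congr (_ *t _).
have [uX _] := mulmx1_unit (X_unitary AB a bB).
apply: (can_inj (mulmxK (etrans (unitmx_tr _) uX))).
rewrite [LHS](X_conj AB aA bB aA' bB') -scalemxAl -mulmxA.
by rewrite [X in _ *: (_ *m X)](X_unitary AB a bB) mulmx1.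
Qed.

(** A matrix y commuting with all 1 (x) X_ab commutes with 1 (x) M_p, so it has the form N (x) 1;
    commuting with all diag(lam) (x) 1, it commutes with the E_ii (x) 1, so N is diagonal. *)
Lemma diag_tens_commutant (y : 'M[F]_m) :
    (forall lam a b, nonzero_row lam -> a \in A -> b \in B ->
       y *m theta lam a b = theta lam a b *m y) ->
  exists mu, y = diag_mx mu *t 1%:M.
Proof.
move=> yC; have [j0 _] := enumB_index (B_0 AB).
have yX N : y *m (1%:M *t N) = (1%:M *t N) *m y.
  move: N; apply: (X_ind charF0 AB) => [|N N' e e'|c N e|a b aA bB].
  - by rewrite tensmx0 mulmx0 mul0mx.
  - by rewrite tens_add_r mulmxDr mulmxDl e e'.
  - by rewrite tens_scale_r -scalemxAr -scalemxAl e.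
  by rewrite -theta_ones; apply: yC => //; exact: ones_nonzero.
have yD i : y *m (delta_mx i i *t 1%:M) = (delta_mx i i *t 1%:M) *m y.
  (* E_ii is the difference of two invertible diagonal matrices, to which the hypothesis applies. *)
  pose lam : 'rV[F]_k := \row_j (if j == i then 2 else 1).
  have lam0 : nonzero_row lam.
    move=> j; rewrite mxE; case: (j == i); last by rewrite oner_eq0.
    by rewrite (pcharf0P _).1.
  have -> : delta_mx i i *t 1%:M = theta lam 0 0 - theta ones_row 0 0.
    rewrite /theta X_1 -scaleN1r -tens_scale_l -tens_add_l; congr (_ *t _).
    apply/matrixP => r s; rewrite !mxE [s == i]eq_sym.
    have [-> | rs] := eqVneq r s.
      rewrite !mulr1n eq_sym andbb; case: eqP => _; first by rewrite mulN1r addrK.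
      by rewrite mulN1r subrr.
    rewrite !mulr0n mulr0 addr0; case: eqP => //= ri.
    by rewrite -ri (negbTE rs).
  by rewrite mulmxBr mulmxBl !yC //; [exact: ones_nonzero|..];
    solve [exact: (A_0 AB) | exact: (B_0 AB)].
have yE i c d : y *m delta_mx (mxtens_index (i, c)) (mxtens_index (i, d)) =
    delta_mx (mxtens_index (i, c)) (mxtens_index (i, d)) *m y.
  have -> : delta_mx (mxtens_index (i, c)) (mxtens_index (i, d)) =
      (delta_mx i i *t 1%:M) *m (1%:M *t delta_mx c d) :> 'M[F]_m.
    by rewrite tensmx_mul mulmx1 mul1mx tens_delta.
  by rewrite mulmxA yD -mulmxA yX mulmxA.
exists (\row_i y (mxtens_index (i, j0)) (mxtens_index (i, j0))).
apply/matrixP => u v; case: (mxtens_indexP u) => i c; case: (mxtens_indexP v) => j d.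
rewrite tensmxE !mxE.
have /matrixP/(_ (mxtens_index (i, c)) (mxtens_index (j, j0))) := yE j d j0.
rewrite mxE (bigD1 (mxtens_index (j, d))) //= mxE !eqxx mulr1 big1 => [|w wd]; last first.
  by rewrite mxE (negbTE wd) mulr0.
rewrite addr0 => ->; rewrite mxE (bigD1 (mxtens_index (j, j0))) //= big1 => [|w wd].
  rewrite addr0 mxE eqxx andbT (inj_eq (can_inj (@mxtens_indexK _ _))) xpair_eqE.
  by case: (eqVneq i j) => [-> | _]; case: (c == d);
    rewrite /= ?mulr0n ?mulr1n ?mul1r ?mulr1 ?mul0r ?mulr0.
by rewrite mxE (negbTE wd) andbF mul0r.
Qed.

(** Choose E = [elem i j a b] with tr(x E) <> 0. Conjugation by theta scales x by a sign and E by
    its weight and preserves the trace, so all weights of E are signs. An entry 2 in lam excludes i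
    <> j, since 2 is neither 1 nor -1, and x then has the same commutation signs as theta for lam =
    1 and (a, b). The quotient commutes with every theta, so it is diag(mu) (x) 1. *)
Lemma theta_centralizer (x : 'M[F]_m) : x \in unitmx ->
    (forall lam a b, nonzero_row lam -> a \in A -> b \in B ->
       sign_commute x (theta lam a b)) ->
  exists mu a b, [/\ nonzero_row mu, a \in A, b \in B & x = theta mu a b].
Proof.
move=> ux xS; have [i [j [a [b [aA bB tr0]]]]] := trace_form_neq0 ux.
have n20 : (2 : F) != 0 by rewrite (pcharf0P _).1.
have wS lam a' b' : nonzero_row lam -> a' \in A -> b' \in B ->
    let w := weight lam (a' + b') (blk_deg false false i j a b) in
    (w = 1 \/ w = -1) /\ x *m theta lam a' b' = w *: (theta lam a' b' *m x).
  move=> lam0 aA' bB' w; set th := theta lam a' b'.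
  have uth : th \in unitmx := theta_unit a' lam0 bB'.
  have [eps [epsE xth]] : exists eps, (eps = 1 \/ eps = -1) /\
      x *m th = eps *: (th *m x).
    case: (xS lam a' b' lam0 aA' bB') => e.
      by exists 1; rewrite scale1r; split; [left | exact: e].
    by exists (-1); rewrite scaleN1r; split; [right | exact: e].
  have epsq : eps * eps = 1 by case: epsE => ->; rewrite ?mulrNN mulr1.
  have thx : th *m x = eps *: (x *m th) by rewrite xth scalerA epsq scale1r.
  have trE : \tr (x *m elem i j a b) = eps * w * \tr (x *m elem i j a b).
    have e : th *m (x *m elem i j a b) = (eps * w) *: (x *m elem i j a b *m th).
      rewrite mulmxA thx -scalemxAl -scalerA; congr (eps *: _).
      have te := theta_elem i j lam0 aA' bB' aA bB.
      by rewrite -[LHS](mulmxA x th) [X in x *m X]te -scalemxAr mulmxA.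
    by rewrite -{1}(mulKmx uth (x *m _)) e -scalemxAr mxtraceZ mxtrace_mulC mulmxK.
  have ew : w = eps.
    have /eqP := trE; rewrite -subr_eq0 -{1}[\tr _]mul1r -mulrBl mulf_eq0.
    rewrite (negbTE tr0) orbF subr_eq0 => /eqP e1.
    by rewrite -[w]mul1r -epsq -mulrA -e1 mulr1.
  by rewrite ew.
have ij : i = j.
  apply/eqP; apply: contraT => nij.
  pose lam : 'rV[F]_k := \row_j (if j == i then 2 else 1).
  have lam0 : nonzero_row lam.
    move=> r; rewrite mxE; case: (r == i); last by rewrite oner_eq0.
    by rewrite (pcharf0P _).1.
  have [] := wS lam 0 0 lam0 (A_0 AB) (B_0 AB).
  rewrite /blk_deg !weightD // weightN // weight_T /= !weight_gam addr0 beta0l mulr1.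
  rewrite !mxE eqxx eq_sym (negbTE nij) invr1 mulr1 => w1 _.
  case: w1 => /eqP; rewrite -subr_eq0 ?opprK.
    have -> : (2 - 1 : F) = 1 by rewrite -[2]/(1 + 1) addrK.
    by rewrite oner_eq0.
  have -> : (2 + 1 : F) = 3%:R by rewrite -(natrD _ 2 1).
  by rewrite (pcharf0P _).1.
have {}wS lam a' b' : nonzero_row lam -> a' \in A -> b' \in B ->
    x *m theta lam a' b' = beta (a' + b') (a + b) *: (theta lam a' b' *m x).
  move=> lam0 aA' bB'; have [_ ->] := wS lam a' b' lam0 aA' bB'.
  by rewrite ij blk_deg_diag weight_T.
pose th1 := theta ones_row a b; have u1 : th1 \in unitmx.
  by apply: theta_unit => //; exact: ones_nonzero.
have [mu yE] : exists mu, x *m invmx th1 = diag_mx mu *t 1%:M.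
  apply: diag_tens_commutant => lam a' b' lam0 aA' bB'.
  have c1 := theta_mulC lam0 ones_nonzero aA' bB' aA bB.
  apply: (can_inj (mulmxK u1)); rewrite -!mulmxA mulVmx // mulmx1.
  rewrite c1 -!scalemxAr mulKmx // wS // scalerA beta_sq scale1r.
  by [].
have xE : x = theta mu a b.
  by rewrite -[x](mulmxKV u1) yE /th1 theta_ones tensmx_mul mulmx1 mul1mx.
exists mu, a, b; split=> // r; apply/eqP => mur.
have [j0 _] := enumB_index (B_0 AB).
have : delta_mx (0 : 'I_1) (mxtens_index (r, j0)) *m x = 0.
  rewrite xE -rowE; apply/rowP => s; case: (mxtens_indexP s) => s1 s2.
  rewrite mxE tensmxE !mxE mur.
  by rewrite mul0rn mul0r.
move/(congr1 (fun z => z *m invmx x)); rewrite mulmxK // mul0mx.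
move/matrixP/(_ 0 (mxtens_index (r, j0))); rewrite !mxE !eqxx => /eqP.
by rewrite oner_eq0.
Qed.

Lemma elem_neq0 i j a b : b \in B -> elem i j a b != 0.
Proof.
move=> bB; apply/eqP => e0.
have : \tr (elem i j a b *m (delta_mx j i *t (X a b)^T)) = p%:R.
  rewrite /elem tensmx_mul mul_delta_mx (X_unitary AB) // tens_trace mxtrace1.
  rewrite [\tr _](bigD1 i) //= mxE !eqxx big1 ?addr0 ?mul1r // => r ri.
  by rewrite mxE (negbTE ri).
rewrite e0 mul0mx mxtrace0 => /esym/eqP.
by apply/negP; apply: contra m_neq0 => /eqP; rewrite natrM => ->; rewrite mulr0.
Qed.

Lemma support_mem g x : x \in M_comp g -> x \in P -> x != 0 -> in_support Gam g.
Proof.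
move=> xM xP x0; rewrite /in_support; apply: contra x0 => /eqP g0.
by have : x \in Gam g; [rewrite memv_cap xM | rewrite g0 memv0].
Qed.

Lemma support_even i j a b : a \in A -> b \in B -> (i, a, b) != (j, 0, 0) ->
  in_support Gam (blk_deg false false i j a b).
Proof.
move=> aA bB ijab; apply: (support_mem (even_in_M i j aA bB)).
  by rewrite mem_pmx (elem_trace aA bB ijab) !trmx0 oppr0 !eqxx.
apply: contra (elem_neq0 i j a bB) => /eqP; rewrite -pmx0 => /pmx_inj[-> _ _].
by [].
Qed.

Lemma support_sym i : in_support Gam (blk_deg false true i i 0 0).
Proof.
have [a0 b0] : 0 \in A /\ 0 \in B := conj (A_0 AB) (B_0 AB).
apply: (support_mem (sym_in_M i i a0 b0)).
  by rewrite mem_pmx mxtrace0 [(_ + _)^T]linearD /= trmxK addrC trmx0 oppr0 !eqxx.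
apply: contra (elem_neq0 i i 0 b0) => /eqP; rewrite -pmx0 => /pmx_inj[_ + _].
rewrite elem_trmx beta0l scale1r -mulr2n -scaler_nat => /eqP.
by rewrite scaler_eq0 (pcharf0P _).1.
Qed.

Lemma level_subgroup : subgroup (fun g => level g = 0).
Proof.
split=> [|g h lg lh]; last by rewrite levelD levelN lg lh subrr.
by rewrite /level big1 ?mul0rn // => i _; rewrite mxE.
Qed.

Lemma level_sym i : level (gam_l l i *+ 2 - e0_l l k) = 0.
Proof.
have d0 : deg_T k (0 + 0 : T) = 0 by rewrite addr0.
by rewrite -(level_blk_deg false true i i 0 0) /blk_deg /row_deg opprB d0 addr0 mulr2n -addrA.
Qed.

Lemma sym_multiple i (c : int) :
  (gam_l l i *+ 2 - e0_l l k) *~ c = (0, delta_mx 0 i *~ (c *+ 2), - c).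
Proof.
have pE g : g = (g.1.1, g.1.2, g.2) by case: g => -[].
rewrite [LHS]pE; congr (_, _, _).
- by rewrite !(raddfMz fst, raddfB fst, raddfMn fst) /= mul0rn subr0 mul0rz.
- rewrite (raddfMz fst) (raddfMz snd) (raddfB fst) (raddfMn fst) /=.
  by rewrite subr0 mulr2n mulrzDl mulrzDr.
by rewrite (raddfMz snd) (raddfB snd) (raddfMn snd) /= mul0rn sub0r mulNrz intz.
Qed.

(** Subtracting the multiple of 2e_1 - e_0 that removes the last coordinate leaves a Z^k coordinate
    whose sum is the level. *)
Lemma G_l_level u : G_l u <-> level u = 0.
Proof.
split=> [[t [z [c [i [z0 i1 ->]]]]] | ].
  rewrite levelD (subgroupMz _ level_subgroup (level_sym i)) addr0.
  by rewrite /level /= z0 mul0rn addr0.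
case: u => -[t z] c; rewrite /level /= => lu; pose i0 : 'I_k := Ordinal k_gt0.
exists t, (z + delta_mx 0 i0 *~ (c *+ 2)), (- c), i0; split=> //.
  apply: etrans lu; transitivity (\sum_i z 0 i + \sum_i (delta_mx 0 i0 *~ (c *+ 2) : 'rV[int]_k) 0 i).
    by rewrite -big_split; apply: eq_bigr => i _; rewrite mxE.
  congr (_ + _); rewrite (bigD1 i0) //= big1 => [|i ii0]; rewrite -scaler_int !mxE.
    by rewrite !eqxx mulr1 intz addr0.
  by rewrite (negbTE ii0) andbF mulr0.
rewrite sym_multiple opprK; congr (_, _, _); rewrite ?addr0 ?add0r //.
by rewrite mulNrn mulrNz addrK.
Qed.

Lemma level0_decomposition i0 u : level u = 0 ->
  u = deg_T k u.1.1 + \sum_i (gam_l l i - gam_l l i0) *~ u.1.2 0 i +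
      (gam_l l i0 *+ 2 - e0_l l k) *~ - u.2.
Proof.
case: u => -[t z] c; rewrite /level /= => lu.
pose inZ (x : 'rV[int]_k) : G := (0, x, 0).
have inZD x y : inZ (x + y) = inZ x + inZ y by congr (_, _, _); rewrite ?addr0.
have inZB x y : inZ (x - y) = inZ x - inZ y by congr (_, _, _); rewrite ?subr0.
have inZMz x (d : int) : inZ x *~ d = inZ (x *~ d).
  have inZMn (r : nat) : inZ x *+ r = inZ (x *+ r).
    by elim: r => [|r IH] //; rewrite !mulrS IH inZD.
  case: d => r; first exact: inZMn.
  by rewrite !NegzE !mulrNz -!pmulrn inZMn; congr (_, _, _); rewrite ?oppr0.
have -> : \sum_i (gam_l l i - gam_l l i0) *~ z 0 i =
    inZ (z - delta_mx 0 i0 *~ (\sum_i z 0 i)).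
  transitivity (\sum_i inZ ((delta_mx 0 i - delta_mx 0 i0) *~ z 0 i)).
    by apply: eq_bigr => i _; rewrite -inZMz inZB.
  rewrite -(big_morph inZ inZD (erefl _)); congr inZ.
  rewrite [X in _ = X - _]row_sum_delta mulrz_sumr -sumrB.
  by apply: eq_bigr => i _; rewrite mulrzBl -scaler_int intz.
rewrite sym_multiple opprK; congr (_, _, _); last by rewrite /= !add0r.
  by rewrite /= !addr0.
have -> : \sum_i z 0 i = - (c *+ 2) by apply/eqP; rewrite -addr_eq0 lu.
by rewrite /= add0r mulrNz opprK mulNrn mulrNz addrK.
Qed.

(** Generators come from the even degrees t <> 0 and e_i - e_1 and from the odd degree 2e_1 - e_0;
    conversely the support has level 0. *)
Lemma Gamma_Pl_support_generates u : G_l u <-> exists w, free_eval (Gam := Gam) w = u.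
Proof.
rewrite G_l_level; pose H u := exists w, free_eval (Gam := Gam) w = u.
have sH : subgroup H := free_eval_image_subgroup Gam.
have Hs g : in_support Gam g -> H g.
  by move=> g0; exists << exist _ g g0 >>; rewrite free_eval1.
split=> [lu | [w <-]].
  pose i0 : 'I_k := Ordinal k_gt0.
  have d0 : deg_T k (0 + 0 : T) = 0 by rewrite addr0.
  have HT t : H (deg_T k t).
    have [-> | t0] := eqVneq t 0; first exact: sH.1.
    have [a [b [aA bB tab]]] := T_decomposition AB t.
    have := support_even (i := i0) (j := i0) aA bB; rewrite blk_deg_diag -tab.
    move=> supp; apply: Hs; apply: supp; rewrite !xpair_eqE eqxx /=.
    by apply: contra t0 => /andP[/eqP a0 /eqP b0]; rewrite tab a0 b0 addr0.
  have Hgam i : H (gam_l l i - gam_l l i0).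
    have [-> | ii0] := eqVneq i i0; first by rewrite subrr; exact: sH.1.
    have := support_even (i := i) (j := i0) (A_0 AB) (B_0 AB).
    rewrite !xpair_eqE (negbTE ii0) /blk_deg d0 addr0 => supp.
    by apply: Hs; exact: supp.
  have Hsym : H (gam_l l i0 *+ 2 - e0_l l k).
    apply: Hs; have := support_sym i0.
    by rewrite /blk_deg d0 addr0 opprB addrA mulr2n.
  have -> : u = deg_T k u.1.1 + \sum_i (gam_l l i - gam_l l i0) *~ u.1.2 0 i +
      (gam_l l i0 *+ 2 - e0_l l k) *~ - u.2.
    exact: level0_decomposition.
  apply: (subgroupD sH); last exact: (subgroupMz _ sH).
  apply: (subgroupD sH); first exact: HT.
  by apply: big_ind => [|x y Hx Hy|i _]; [exact: sH.1 | exact: (subgroupD sH) | exact: (subgroupMz _ sH)].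
rewrite /free_eval; apply: (big_ind (fun g => level g = 0)) => [|x y xl yl|s _].
- exact: level_subgroup.1.
- by rewrite levelD xl yl.
apply: (@subgroupMz _ _ _ _ level_subgroup).
have := valP s; rewrite /in_support -vpick0 => v0.
exact: M_level (Gamma_Pl_P (memv_pick _)).1 v0.
Qed.

End GammaPlGrading.

Lemma Ad_inverse_image (F : fieldType) (m : nat) (N : 'M[F]_m)
    (U : {vspace 'M[F]_(m + m)}) v : N \in unitmx ->
  (v \in (linfun (Ad (invmx N)) @: U)%VS) = (Ad N v \in U).
Proof.
move=> uN; apply/memv_imgP/idP => [[u uU ->] | NvU].
  by rewrite lfunE /= AdVK.
by exists (Ad N v); rewrite // lfunE /= AdK.
Qed.

(** * Classification *)

Section GradingsOnP.
Variables (F : closedFieldType) (m : nat).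
Hypotheses (charF0 : [pchar F] =i pred0) (m_gt1 : (1 < m)%N).
Local Notation bracket := (@supercommutator F m).
Local Notation P := (@P_part F m).
Variables (G : zmodType) (Gam : G -> {vspace 'M[F]_(m + m)}).
Hypothesis gradG : is_grading bracket P Gam.

(** Stated for m > 1 instead of [n.+1], so as to apply to m = k * #|B|. *)
Lemma multiplicative_acts c :
    (forall g, (Gam g != 0)%VS -> c g != 0) -> multiplicative_on bracket Gam c ->
  exists2 x, x \in unitmx & acts_by Gam x c.
Proof.
move: m_gt1 Gam gradG; case: m => [//|n] n1 Gam' gradG'.
exact: (character_acts charF0 n1 gradG').
Qed.

Lemma scalar_on_sign_commute x y : x \in unitmx -> y \in unitmx ->
  scalar_on Gam x -> scalar_on Gam y -> sign_commute x y.
Proof.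
move: m_gt1 Gam gradG x y; case: m => [//|n] n1 Gam' gradG' x y ux uy.
exact: (scalar_on_commute charF0 gradG').
Qed.

Lemma grading_separators : exists Q : seq 'M[F]_m,
  [/\ {in Q, forall x, x \in unitmx /\ exists c, acts_by Gam x c},
      {in Q, forall x, diagonalizable x},
      {in Q &, forall x y, sign_commute x y} &
  forall g h, (Gam g != 0)%VS -> (Gam h != 0)%VS -> g != h ->
    exists2 x, x \in Q & forall c, acts_by Gam x c -> c g != c h].
Proof.
have comm := scalar_on_sign_commute; move: comm.
move: m_gt1 Gam gradG; case: m => [//|n] n1 Gam' gradG' comm.
have [Q [QP Qsep]] := separating_matrices charF0 n1 gradG'.
exists Q; split=> // [x /QP[ux [c xc]] | x y xQ yQ].
  exact: acts_diagonalizable ux xc.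
have [ux [c xc]] := QP x xQ; have [uy [d yd]] := QP y yQ.
by apply: comm => //; [exact: acts_by_scalar_on xc | exact: acts_by_scalar_on yd].
Qed.

(** The homogeneous parts of a joint eigenvector are eigenvectors with the same eigenvalues, so by
    separation at most one of them is nonzero, and its degree is the same throughout U. *)
Lemma joint_eigenspace_component (Q : seq 'M[F]_m) (U : {vspace 'M[F]_(m + m)}) :
    {in Q, forall x, x \in unitmx /\ exists c, acts_by Gam x c} ->
    (forall g h, (Gam g != 0)%VS -> (Gam h != 0)%VS -> g != h ->
       exists2 x, x \in Q & forall c, acts_by Gam x c -> c g != c h) ->
    (U <= P_space F m)%VS -> U != 0%VS ->
    {in Q, forall x, exists w, forall v, v \in U -> Ad x v = w *: v} ->
  exists g, (U <= Gam g)%VS.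
Proof.
move=> QP Qsep UP U0 Qw; have [S [pr [uS prG prS prid _]]] := grading_projections gradG.
have USum v : v \in U -> v = \sum_(g <- S) pr g v.
  by move=> vU; apply: prS; rewrite total_P (subvP UP).
have prW x c w v g : acts_by Gam x c -> v \in U -> Ad x v = w *: v ->
    pr g v != 0 -> c g = w.
  move=> xc vU xv pv0; have := congr1 (pr g) xv.
  rewrite {1}(USum v vU) linear_sum /= linear_sum /= linearZ /=.
  have -> : \sum_(h <- S) pr g (Ad x (pr h v)) = c g *: pr g v.
    rewrite {2}(USum v vU) linear_sum scaler_sumr; apply: eq_bigr => h _.
    rewrite (xc _ _ (prG h v)) linearZ /= (prid h g _ (prG h v)).
    by have [-> //| _] := eqVneq g h; rewrite !mulr0n !scaler0.
  by move/eqP; rewrite -subr_eq0 -scalerBl scaler_eq0 (negbTE pv0) orbF subr_eq0 => /eqP.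
have [g ug] : exists g, pr g (vpick U) != 0.
  apply: NNPP => no; move: U0; rewrite -vpick0 => /eqP[].
  rewrite (USum _ (memv_pick U)) big1 // => g _.
  by apply/eqP; apply: contraT => g0; case: no; exists g.
have nz h v : pr h v != 0 -> (Gam h != 0)%VS.
  by apply: contra => /eqP h0; have := prG h v; rewrite h0 memv0.
exists g; apply/subvP => v vU.
have pr0 h : h != g -> pr h v = 0.
  move=> hg; apply/eqP; apply: contraT => hv.
  have [x xQ sep] := Qsep h g (nz h v hv) (nz g _ ug) hg.
  have [_ [c xc]] := QP x xQ; have [w xw] := Qw x xQ.
  have := sep c xc; rewrite (prW x c w v h xc vU (xw v vU) hv).
  by rewrite (prW x c w _ g xc (memv_pick U) (xw _ (memv_pick U)) ug) eqxx.
have [vg0 | gv] := eqVneq (pr g v) 0.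
  have -> : v = 0; last exact: mem0v.
  rewrite (USum v vU) big1 // => h _.
  by have [-> //|] := eqVneq h g; exact: pr0.
suff -> : v = pr g v by exact: prG.
have gS : g \in S.
  apply: contraT => gS; case/eqP: gv.
  rewrite (USum v vU) linear_sum big1_seq // => h /andP[_ hS].
  rewrite /= (prid h g _ (prG h v)); have [gh | _] := eqVneq g h; last by rewrite mulr0n.
  by rewrite gh hS in gS.
by rewrite {1}(USum v vU) (bigD1_seq g) //= big1 ?addr0 // => h; exact: pr0.
Qed.

(** The transported components of Del exhaust the support of Gam because together they span the
    whole space: the projection to a missed degree would vanish. *)
Lemma equivalent_components (K : zmodType) (Del : K -> {vspace 'M[F]_(m + m)}) (N : 'M[F]_m) :
    is_grading bracket P Del -> N \in unitmx ->
    (forall k, (Del k != 0)%VS -> exists2 g, (Gam g != 0)%VS &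
       (linfun (Ad (invmx N)) @: Del k)%VS = Gam g) ->
  equivalent bracket P Gam Del.
Proof.
move=> gradD uN imD.
have imP (t : Defs.support Del) : exists s : Defs.support Gam,
    (linfun (Ad (invmx N)) @: Del (val t))%VS = Gam (val s).
  have [g g0 e] := imD _ (valP t).
  by exists (exist _ g g0).
pose b t := proj1_sig (constructive_indefinite_description _ (imP t)).
have bE t : (linfun (Ad (invmx N)) @: Del (val t))%VS = Gam (val (b t)).
  by rewrite /b; case: constructive_indefinite_description.
have mem_b t v : (v \in Gam (val (b t))) = (Ad N v \in Del (val t)).
  by rewrite -bE Ad_inverse_image.
have b_inj : injective b.
  move=> t t' tt'; apply: val_inj; have := valP t; rewrite /in_support -vpick0 => v0.
  apply: (grading_homogeneous gradD (memv_pick _) _ v0).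
  by rewrite -[vpick _](AdVK uN) -mem_b -tt' mem_b AdVK // memv_pick.
have b_surj s : exists t, b t = s.
  apply: NNPP => nob; have [S [pr [_ _ _ prid _]]] := grading_projections gradG.
  have pr0 : {in total_space P, forall v, pr (val s) (Ad (invmx N) v) = 0}.
    apply: (grading_ind gradD) => [|u v u0 v0|k v vk].
    - by rewrite !linear0.
    - by rewrite !linearD /= u0 v0 addr0.
    have [-> | v0] := eqVneq v 0; first by rewrite !linear0.
    have k0 : in_support Del k.
      by rewrite /in_support; apply: contra v0 => /eqP k0; rewrite k0 memv0 in vk.
    pose t : Defs.support Del := exist _ k k0.
    rewrite (prid (val (b t))); last by rewrite mem_b AdVK.
    by rewrite (inj_eq val_inj); case: eqP => [e|_]; [case: nob; exists t | rewrite mulr0n].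
  have := valP s; rewrite /in_support -vpick0 => /eqP[].
  have vs := memv_pick (Gam (val s)); rewrite -{1}[vpick _](AdK uN).
  rewrite -[LHS]mulr1n -[1%N]/(nat_of_bool true) -(eqxx (val s)) -(prid _ _ _ _).
    rewrite pr0 // total_P Ad_P // -total_P.
    exact: subvP (grading_sub gradG (val s)) _ vs.
  by rewrite AdK.
pose alpha s := proj1_sig (constructive_indefinite_description _ (b_surj s)).
have alphaK : cancel alpha b.
  by move=> s; rewrite /alpha; case: constructive_indefinite_description.
exists (linfun (Ad N)), alpha; split.
- exact: Ad_automorphism.
- exists b => // t; apply: b_inj; exact: alphaK.
move=> s; rewrite -{1}(alphaK s) -bE; apply/vspaceP => v.
by rewrite -{1}(invmxK N) !Ad_inverse_image ?unitmx_inv // AdVK.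
Qed.

(** An equivalence is realized by some Ad x, so the group of matrices acting by scalars is, up to
    conjugation, an invariant of the equivalence class. *)
Lemma equivalent_conjugation (K : zmodType) (Del : K -> {vspace 'M[F]_(m + m)}) :
  equivalent bracket P Gam Del ->
  exists2 x, x \in unitmx & forall y, y \in unitmx ->
    (scalar_on Gam y <-> scalar_on Del (x *m y *m invmx x)).
Proof.
move=> [phi [alpha [phiA [b alphaK bK] phiE]]].
have [x ux xE] : exists2 x, x \in unitmx & {in P_space F m, forall v, phi v = Ad x v}.
  move: m_gt1 phi phiA {phiE alphaK}; case: m => [//|n] n1 phi phiA.
  exact: (automorphism_Ad charF0 n1 phiA).
exists x => // y uy.
have GP s v : v \in Gam s -> v \in P_space F m.
  by rewrite -total_P; apply: (subvP (grading_sub gradG _)).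
have memD s v : v \in Gam (val s) -> Ad x v \in Del (val (alpha s)).
  by move=> vs; rewrite -phiE -xE ?(GP _ _ vs) // memv_img.
have memG s v : v \in Del (val (alpha s)) -> exists2 u, u \in Gam (val s) & v = Ad x u.
  rewrite -phiE => /memv_imgP[u us ->]; exists u => //.
  by rewrite xE // (GP _ _ us).
have conj v : Ad (x *m y *m invmx x) (Ad x v) = Ad x (Ad y v).
  by rewrite !AdM ?unitmx_mul ?ux ?uy ?unitmx_inv // mulmxKV.
split=> yS.
  move=> k; have [k0 | k0] := eqVneq (Del k) 0%VS.
    by exists 0 => v; rewrite k0 memv0 => /eqP ->; rewrite linear0 scaler0.
  pose t : Defs.support Del := exist _ k k0.
  have [c yc] := yS (val (b t)); exists c => v vk.
  have [u us ->] : exists2 u, u \in Gam (val (b t)) & v = Ad x u.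
    by apply: memG; rewrite bK.
  by rewrite conj yc // linearZ.
move=> g; have [g0 | g0] := eqVneq (Gam g) 0%VS.
  by exists 0 => v; rewrite g0 memv0 => /eqP ->; rewrite linear0 scaler0.
pose s : Defs.support Gam := exist _ g g0.
have [c yc] := yS (val (alpha s)); exists c => v vg.
have := yc _ (memD s v vg); rewrite conj -linearZ => /(can_inj (AdK ux)).
by [].
Qed.

End GradingsOnP.

(** * Fineness and the universal group of Gamma_P(l) *)

Section GammaPlFine.
Variables (F : closedFieldType) (l : nat).
Hypothesis charF0 : [pchar F] =i pred0.
Local Notation T := (T_l l).
Local Notation beta := (@beta_l F l).
Variables A B : {set T}.
Hypothesis AB : isotropic_decomposition beta A B.
Variable k : nat.
Local Notation m := (k * #|B|)%N.
Local Notation Gam := (@Gamma_Pl l k F A B m).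
Local Notation bracket := (@supercommutator F m).
Local Notation P := (@P_part F m).
Local Notation theta := (@theta F l B k).
Hypothesis m_gt1 : (1 < m)%N.

Lemma Gamma_Pl_rank_gt0 : (0 < k)%N.
Proof. by case: (k) m_gt1. Qed.

Local Notation gradG := (Gamma_Pl_grading charF0 AB Gamma_Pl_rank_gt0).

Lemma theta_scalar_on lam a b : nonzero_row lam -> a \in A -> b \in B ->
  scalar_on Gam (theta lam a b).
Proof.
move=> lam0 aA bB g; exists (weight lam (a + b) g) => v /Gamma_Pl_P[vM _].
exact: (Ad_theta AB lam0 aA bB vM).
Qed.

Lemma refinement_scalar_on (K : zmodType) (Del : K -> {vspace 'M[F]_(m + m)}) x :
  refinement Del Gam -> scalar_on Gam x -> scalar_on Del x.
Proof.
move=> ref xS h; have [g hg] := ref h; have [c xc] := xS g.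
by exists c => v vh; apply: xc; exact: subvP hg _ vh.
Qed.

(** The theta matrices also act by scalars on the finer grading, so x commutes with them up to sign
    and [theta_centralizer] applies. With Del = Gam this describes the whole quasitorus. *)
Lemma refinement_scalar_on_theta (K : zmodType) (Del : K -> {vspace 'M[F]_(m + m)}) x :
    is_grading bracket P Del -> refinement Del Gam -> x \in unitmx -> scalar_on Del x ->
  exists lam a b, [/\ nonzero_row lam, a \in A, b \in B & x = theta lam a b].
Proof.
move=> gradD ref ux xS.
apply: (theta_centralizer charF0 AB Gamma_Pl_rank_gt0 ux) => lam a b lam0 aA bB.
apply: (scalar_on_sign_commute charF0 m_gt1 gradD) => //; first exact: (theta_unit AB).
exact: refinement_scalar_on ref (theta_scalar_on lam0 aA bB).
Qed.

(** The separators of a refinement are theta matrices, hence act by scalars on the original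
    components; so every nonzero original component lies in a component of the refinement. *)
Lemma Gamma_Pl_fine : fine bracket P Gam.
Proof.
split; first exact: gradG; move=> K Del gradD [ref [h [g [h0 hg /negP hg']]]].
have [Q [QP _ _ Qsep]] := grading_separators charF0 m_gt1 gradD.
have [v vh v0] : exists2 v, v \in Del h & v != 0.
  by exists (vpick (Del h)); rewrite ?memv_pick // vpick0.
have [h' gh'] : exists h', (Gam g <= Del h')%VS.
  apply: (joint_eigenspace_component gradD QP Qsep); first exact: capvSr.
    apply: contraNneq v0 => g0; rewrite -memv0 -g0; exact: subvP hg _ vh.
  move=> x xQ; have [ux [c xc]] := QP x xQ.
  have [lam [a [b [lam0 aA bB ->]]]] :=
    refinement_scalar_on_theta gradD ref ux (acts_by_scalar_on xc).
  exact: theta_scalar_on.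
have hh' : h = h'.
  by apply: (grading_homogeneous gradD vh _ v0); exact: subvP gh' _ (subvP hg _ vh).
by apply: hg'; rewrite eqEsubv hg hh'.
Qed.

(** Every multiplicative function on the support is a weight, and weights are defined on the whole
    grading group; this is the extension property that [universal_group_kernel] requires. *)
Lemma Gamma_Pl_universal : is_universal_group bracket Gam (@G_l l k).
Proof.
split; first exact: (Gamma_Pl_support_generates charF0 AB Gamma_Pl_rank_gt0).
apply: (universal_group_kernel charF0 (@supercommutator0l F m) (@supercommutator0r F m) gradG).
move=> c c0 cM; have [x ux xc] := multiplicative_acts charF0 m_gt1 gradG c0 cM.
have [|lam [a [b [lam0 aA bB xE]]]] :=
  refinement_scalar_on_theta gradG _ ux (acts_by_scalar_on xc).
  by move=> g; exists g.
exists (weight lam (a + b)); split=> [g | g h | g g0].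
- exact: weight_neq0.
- exact: weightD.
have /eqP : (c g - weight lam (a + b) g) *: vpick (Gam g) = 0.
  have vg := memv_pick (Gam g); rewrite scalerBl -(xc _ _ vg) xE.
  by rewrite (Ad_theta AB lam0 aA bB (Gamma_Pl_P vg).1) subrr.
by rewrite scaler_eq0 vpick0 (negbTE g0) orbF subr_eq0 => /eqP.
Qed.

(* The matrices acting by scalars on every component form a group whose
   commutator form recovers [(T, beta)]. *)
Lemma Gamma_Pl_quasitorus : exists R : T -> 'M[F]_m -> Prop,
  [/\ forall s, exists x, R s x,
      forall s x, R s x -> x \in unitmx /\ scalar_on Gam x,
      forall x, x \in unitmx -> scalar_on Gam x -> exists s, R s x
    & forall s t x y, R s x -> R t y -> x *m y = beta s t *: (y *m x)].
Proof.
exists (fun s x => exists lam a b,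
  [/\ nonzero_row lam, a \in A, b \in B, s = a + b & x = theta lam a b]).
split.
- move=> s; have [a [b [aA bB sab]]] := T_decomposition AB s.
  by exists (theta (ones_row F k) a b), (ones_row F k), a, b; split=> //; exact: ones_nonzero.
- move=> s x [lam [a [b [lam0 aA bB _ ->]]]].
  by split; [exact: (theta_unit AB) | exact: theta_scalar_on].
- move=> x ux xS; have [|lam [a [b [lam0 aA bB xE]]]] :=
    refinement_scalar_on_theta gradG _ ux xS; first by move=> g; exists g.
  by exists (a + b), lam, a, b.
move=> s t x y [lam [a [b [lam0 aA bB -> ->]]]] [mu [a' [b' [mu0 aA' bB' -> ->]]]].
exact: (theta_mulC AB).
Qed.

(** Describes theta on rows in the form in which [frame_basis] describes the frame elements, so that
    the next lemma can identify the two. *)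
Lemma theta_row lam a b (N : 'M[F]_m) s j : b \in B ->
  exists j', enum_val j' = enum_val j + b /\
   row (mxtens_index (s, j)) (theta lam a b *m N) =
     (lam 0 s * beta a (enum_val j)) *: row (mxtens_index (s, j')) N.
Proof.
move=> bB; have jB := enum_valP j.
have [j' j'E] := enumB_index (B_closedD AB jB bB).
exists j'; split=> //.
rewrite row_mul [row _ N]rowE scalemxAl; congr (_ *m N).
apply/rowP => u; case: (mxtens_indexP u) => s' i.
rewrite mxE tensmxE !mxE eqxx /= (inj_eq (can_inj (@mxtens_indexK _ _))) xpair_eqE.
have -> : (enum_val j == b + enum_val i) = (i == j').
  rewrite -(inj_eq enum_val_inj) j'E -[enum_val j + b]addrC.
  apply/eqP/eqP => [-> | ->]; first by rewrite addrA T_addxx add0r.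
  by rewrite addrA T_addxx add0r.
case: (eqVneq s s') => _; last by rewrite mulr0n mul0r mulr0.
rewrite mulr1n /=; case: eqP => [-> | _]; last by rewrite !mulr0.
by rewrite mulr1 mulr1n j'E addrCA T_addxx addr0.
Qed.

Lemma frame_row_scalar_on (N q : 'M[F]_m) (lam : 'rV[F]_k) a b :
    N \in unitmx -> q \in unitmx -> a \in A -> b \in B ->
    (forall s j j', enum_val j' = enum_val j + b ->
       row (mxtens_index (s, j)) N *m q =
         (lam 0 s * beta a (enum_val j)) *: row (mxtens_index (s, j')) N) ->
  scalar_on Gam (N *m q *m invmx N).
Proof.
move=> uN uq aA bB Nq.
have lam0 : nonzero_row lam.
  move=> s; apply/eqP => lam0.
  have [j0 _] := enumB_index (B_0 AB).
  have [j' j'E] := enumB_index (B_closedD AB (enum_valP j0) bB).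
  have := Nq s j0 j' j'E; rewrite lam0 mul0r scale0r rowE.
  move/(congr1 (fun y => y *m invmx q *m invmx N)); rewrite mulmxK // mulmxK // !mul0mx.
  move/matrixP/(_ 0 (mxtens_index (s, j0))); rewrite !mxE !eqxx => /eqP.
  by rewrite oner_eq0.
have -> : N *m q *m invmx N = theta lam a b.
  apply: (can_inj (mulmxK uN)); rewrite mulmxKV //.
  apply/row_matrixP => u; case: (mxtens_indexP u) => s j.
  have [j' [j'E ->]] := theta_row lam a N s j bB.
  by rewrite row_mul (Nq s j j' j'E).
exact: theta_scalar_on.
Qed.

End GammaPlFine.

Section GammaPlTransport.
Variables (F : closedFieldType) (l : nat).
Hypothesis charF0 : [pchar F] =i pred0.
Local Notation T := (T_l l).
Variables A B : {set T}.
Hypothesis AB : isotropic_decomposition (@beta_l F l) A B.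
Variables (k m : nat).
Hypotheses (em : (k * #|B|)%N = m) (m_gt1 : (1 < m)%N).
Local Notation Gam := (@Gamma_Pl l k F A B m).

Lemma Gamma_Pl_fine_at : fine (@supercommutator F m) (@P_part F m) Gam.
Proof. by move: m_gt1; rewrite -em => m1; exact: Gamma_Pl_fine. Qed.

Lemma Gamma_Pl_universal_at :
  is_universal_group (@supercommutator F m) Gam (@G_l l k).
Proof. by move: m_gt1; rewrite -em => m1; exact: Gamma_Pl_universal. Qed.

Lemma Gamma_Pl_quasitorus_at : exists R : T -> 'M[F]_m -> Prop,
  [/\ forall s, exists x, R s x,
      forall s x, R s x -> x \in unitmx /\ scalar_on Gam x,
      forall x, x \in unitmx -> scalar_on Gam x -> exists s, R s x
    & forall s t x y, R s x -> R t y -> x *m y = beta_l F s t *: (y *m x)].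
Proof. by move: m_gt1; rewrite -em => m1; exact: Gamma_Pl_quasitorus. Qed.

(** N is rectangular only in its type: k * #|B| and m are equal, and after substitution N' is N. *)
Lemma frame_rows_scalar_on (N : 'M[F]_(k * #|B|, m)) : row_free N -> row_full N ->
  exists2 N' : 'M[F]_m, N' \in unitmx &
  forall q (lam : 'rV[F]_k) a b, q \in unitmx -> a \in A -> b \in B ->
    (forall s j j', enum_val j' = enum_val j + b ->
       row (mxtens_index (s, j)) N *m q =
         (lam 0 s * beta_l F a (enum_val j)) *: row (mxtens_index (s, j')) N) ->
  scalar_on Gam (N' *m q *m invmx N').
Proof.
move: m_gt1 N; rewrite -em => m1 N fN _; exists N; first by rewrite -row_free_unit.
move=> q lam a b; apply: (frame_row_scalar_on AB).
by rewrite -row_free_unit.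
Qed.

End GammaPlTransport.

Section GradingAd.
Variables (F : fieldType) (m : nat) (G : zmodType) (Gam : G -> {vspace 'M[F]_(m + m)}).
Local Notation bracket := (@supercommutator F m).
Local Notation P := (@P_part F m).

Lemma grading_Ad x : x \in unitmx -> is_grading bracket P Gam ->
  is_grading bracket P (fun g => (linfun (Ad x) @: Gam g)%VS).
Proof.
move=> ux; have [AdL _] := Ad_automorphism ux.
have img (U : {vspace 'M[F]_(m + m)}) v : (v \in (linfun (Ad x) @: U)%VS) = (Ad (invmx x) v \in U).
  by rewrite -{1}(invmxK x) Ad_inverse_image ?unitmx_inv.
case=> [[S [uS SG dS sumS]] gradL gradM]; split.
- exists S; split=> //.
  + move=> g g0; apply: SG; move: g0; rewrite !unfold_in; apply: contraNneq => ->.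
    by rewrite limg0.
  + apply/directv_seqP => // y yG y0 g gS.
    have uxV : invmx x \in unitmx by rewrite unitmx_inv.
    apply: (can_inj (AdK uxV)); rewrite linear0.
    move/(directv_seqP _ uS): dS => dS.
    apply: (dS (fun h => Ad (invmx x) (y h))) gS => [h|]; first by rewrite -img.
    by rewrite -linear_sum y0 linear0.
  have -> : (\sum_(g <- S) linfun (Ad x) @: Gam g)%VS = (linfun (Ad x) @: \sum_(g <- S) Gam g)%VS.
    by rewrite limg_sum.
  by rewrite sumS /total_space limgD !AdL.
- move=> g; rewrite {1}gradL limgD; congr (_ + _)%VS; apply/vspaceP => v.
    by rewrite memv_cap !img memv_cap -!img AdL.
  by rewrite memv_cap !img memv_cap -!img AdL.
move=> g h y z; rewrite !img => yg zh.
by rewrite Ad_supercommutator ?unitmx_inv //; exact: gradM.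
Qed.

End GradingAd.

(** * Every fine grading is equivalent to exactly one Gamma_P(l) *)

Section Classification.
Variables (F : closedFieldType) (charF0 : [pchar F] =i pred0) (n : nat) (n_gt0 : (0 < n)%N).
Local Notation m := n.+1.
Local Notation bracket := (@supercommutator F m).
Local Notation P := (@P_part F m).
Variables A B : forall l : nat, {set T_l l}.
Hypothesis AB : forall l : nat, isotropic_decomposition (@beta_l F l) (A l) (B l).
Local Notation Gamma l k := (@Gamma_Pl l k F (A l) (B l) m).

Let m_gt1 : (1 < m)%N. Proof. by []. Qed.

(** The rank of the frame of the separators becomes l. In the adapted basis each separator is some
    theta, so it acts by scalars on the components of Gamma_P(l), each of which therefore falls into
    one component of Gam. *)
Lemma coarsened_Gamma_Pl (G : zmodType) (Gam : G -> {vspace 'M[F]_(m + m)}) :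
    is_grading bracket P Gam ->
  exists l k (N : 'M[F]_m), [/\ (k * #|B l|)%N = m, N \in unitmx
    & forall g, (Gamma l k g != 0)%VS ->
        exists h, (linfun (Ad (invmx N)) @: Gamma l k g <= Gam h)%VS].
Proof.
move=> gradG; have [Q [QP Qd Qc Qsep]] := grading_separators charF0 m_gt1 gradG.
have QP' : {in Q, forall q, q \in unitmx /\ diagonalizable q}.
  by move=> q qQ; split; [case: (QP q qQ) | exact: Qd].
have [r [X [Y [Z [fXY ZC ZP ZXY QZ]]]]] := frame_structure charF0 QP' Qc.
have [u [v [uv vD uA [vI cB]]]] := lagrangian_coordinates charF0 (AB r).
(* The adapted basis is indexed by B, identified with F_2^r, to match the rows of the X_ab. *)
pose om (j : 'I_#|B r|) := v (enum_val j).
have om_bij : bijective om.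
  apply: inj_card_bij => [j j' /vI e|]; first by apply: enum_val_inj; apply: e; exact: enum_valP.
  by rewrite card_ord cB card_mx card_Fp // mul1n.
have Zd : {in Z, forall x, diagonalizable x} by move=> x /ZP[].
have [k [N [[fN uN] NZ NX NY]]] := frame_basis charF0 fXY om_bij ZC Zd ZXY.
have em := free_full_size fN uN.
have [N' uN' N'S] := frame_rows_scalar_on (AB r) em m_gt1 fN uN.
have QS q : q \in Q -> scalar_on (Gamma r k) (N' *m q *m invmx N').
  move=> qQ; have [uq _] := QP' q qQ.
  have [z [u0 [v0 [c [zZ qE]]]]] := QZ q qQ; have [lam zlam] := NZ z zZ.
  have [a aA au] := uA u0; have [omV omK omVK] := om_bij.
  have bB := enum_valP (omV v0).
  apply: (N'S q (c *: lam) a (enum_val (omV v0))) => // s j j' j'E.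
  have omj : om j' = om j + v0.
    by rewrite -[v0 in RHS]omVK /om j'E vD // enum_valP.
  rewrite qE -scalemxAr [row _ _ *m (z *m _)]mulmxA zlam -scalemxAl mulmxA NX -scalemxAl (NY _ _ _ _ omj).
  by rewrite !scalerA mxE (uv a) ?enum_valP // au -/(om j) -!mulrA.
exists r, k, N'; split=> // g g0.
apply: (joint_eigenspace_component gradG QP Qsep).
- apply/subvP => y; rewrite Ad_inverse_image // => /(subvP (capvSr _ _)).
  by rewrite Ad_P.
- apply: contra g0 => /eqP U0; rewrite -subv0; apply/subvP => y yg.
  have : Ad (invmx N') y \in (linfun (Ad (invmx N')) @: Gamma r k g)%VS.
    by rewrite Ad_inverse_image // AdVK.
  rewrite U0 !memv0 => /eqP y0; apply/eqP; apply: (can_inj (AdK (x := invmx N') _)).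
    by rewrite unitmx_inv.
  by rewrite y0 linear0.
move=> q qQ; have [w qw] := QS q qQ g; exists w => y.
rewrite Ad_inverse_image // => /qw; have [uq _] := QP' q qQ.
rewrite !AdM ?unitmx_mul ?unitmx_inv ?uN' ?uq // mulmxKV // -AdM // -linearZ.
by move/(can_inj (AdK uN')).
Qed.

(** The transported Gamma_P(l) refines Gam, and fineness turns the inclusions of nonzero components
    into equalities. *)
Lemma fine_equivalent_Gamma_Pl (G : zmodType) (Gam : G -> {vspace 'M[F]_(m + m)}) :
    fine bracket P Gam ->
  exists l k, (k * #|B l|)%N = m /\ equivalent bracket P Gam (Gamma l k).
Proof.
move=> [gradG fineG]; have [l [k [N [em uN ref]]]] := coarsened_Gamma_Pl gradG.
exists l, k; split=> //; have [gradD _] := Gamma_Pl_fine_at charF0 (AB l) em m_gt1.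
apply: (equivalent_components gradG gradD uN) => g g0.
have [h gh] := ref g g0.
have im0 : (linfun (Ad (invmx N)) @: Gamma l k g != 0)%VS.
  apply: contra g0 => /eqP U0; rewrite -subv0; apply/subvP => y yg.
  have : Ad (invmx N) y \in (linfun (Ad (invmx N)) @: Gamma l k g)%VS.
    by rewrite Ad_inverse_image // AdVK.
  rewrite U0 !memv0 => /eqP y0; apply/eqP; apply: (can_inj (AdK (x := invmx N) _)).
    by rewrite unitmx_inv.
  by rewrite y0 linear0.
have uNV : invmx N \in unitmx by rewrite unitmx_inv.
have imE : (linfun (Ad (invmx N)) @: Gamma l k g)%VS = Gam h.
  apply/eqP; apply: contraT => ne; case: (fineG _ _ (grading_Ad uNV gradD)).
  split; last by exists g, h.
  (* Zero components must also be contained in some component; degree 0 serves for them. *)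
  move=> g'; have [g'0 | g'0] := eqVneq (Gamma l k g') 0%VS; last exact: ref.
  by exists 0; rewrite g'0 limg0 sub0v.
by exists h => //; rewrite -imE.
Qed.

(** Conjugation by y sends some matrix of class s to one of class f s. Comparing commutators, f
    preserves beta; chosen pointwise, it is injective by nondegeneracy, and counting gives the
    inequality. *)
Lemma conjugate_quasitorus_leq l l' k k' (y : 'M[F]_m) :
    (k * #|B l|)%N = m -> (k' * #|B l'|)%N = m -> y \in unitmx ->
    (forall x, x \in unitmx -> scalar_on (Gamma l k) x ->
       scalar_on (Gamma l' k') (y *m x *m invmx y)) ->
  (l <= l')%N.
Proof.
move=> em em' uy yS.
have [R [R_ex R_S _ R_C]] := Gamma_Pl_quasitorus_at charF0 (AB l) em m_gt1.
have [R' [_ R'_S R'_ex R'_C]] := Gamma_Pl_quasitorus_at charF0 (AB l') em' m_gt1.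
have f_ex s : exists t, exists2 x, R s x & R' t (y *m x *m invmx y).
  have [x sx] := R_ex s; have [ux xS] := R_S s x sx.
  have uyx : y *m x *m invmx y \in unitmx by rewrite !unitmx_mul uy ux unitmx_inv.
  have [t tx] := R'_ex _ uyx (yS x ux xS).
  by exists t, x.
pose f s := proj1_sig (constructive_indefinite_description _ (f_ex s)).
have fE s : exists2 x, R s x & R' (f s) (y *m x *m invmx y).
  by rewrite /f; case: constructive_indefinite_description.
have fbeta s t : beta_l F s t = beta_l F (f s) (f t).
  have [x sx fsx] := fE s; have [z tz ftz] := fE t.
  have [ux _] := R_S s x sx; have [uz _] := R_S t z tz.
  have := R'_C _ _ _ _ fsx ftz.
  have conj p q : y *m p *m invmx y *m (y *m q *m invmx y) = y *m (p *m q) *m invmx y.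
    by rewrite !mulmxA mulmxKV.
  rewrite !conj (R_C _ _ _ _ sx tz) -scalemxAr -scalemxAl.
  set M := y *m _ *m _ => /eqP; rewrite -subr_eq0 -scalerBl scaler_eq0 subr_eq0.
  have uM : M \in unitmx by rewrite !unitmx_mul uy uz ux unitmx_inv.
  case/orP => [/eqP // | /eqP M0].
  have := mulmxV uM; rewrite M0 mul0mx => /matrixP/(_ 0 0).
  by rewrite !mxE => /esym/eqP; rewrite oner_eq0.
have f_inj : injective f.
  move=> s t fst; apply/eqP; rewrite -subr_eq0; apply/eqP.
  apply: (beta_nondegenerate charF0) => w.
  by rewrite T_opp betaDl !fbeta fst beta_sq.
by have := leq_card f f_inj; rewrite !card_T leq_exp2l // leq_pmul2l.
Qed.

(** Gam links the two gradings: a matrix acting by scalars on one is carried back to Gam and then to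
    the other. Applied in both directions, this makes l unique. *)
Lemma equivalent_Gamma_Pl_leq (G : zmodType) (Gam : G -> {vspace 'M[F]_(m + m)}) l l' k k' :
    is_grading bracket P Gam -> (k * #|B l|)%N = m -> (k' * #|B l'|)%N = m ->
    equivalent bracket P Gam (Gamma l k) -> equivalent bracket P Gam (Gamma l' k') ->
  (l <= l')%N.
Proof.
move=> gradG em em' /(equivalent_conjugation charF0 m_gt1 gradG)[x ux xS].
move/(equivalent_conjugation charF0 m_gt1 gradG) => [x' ux' xS'].
apply: (conjugate_quasitorus_leq em em' (y := x' *m invmx x)) => [|z uz zS].
  by rewrite unitmx_mul ux' unitmx_inv.
pose w := invmx x *m z *m x.
have uw : w \in unitmx by rewrite !unitmx_mul unitmx_inv ux uz.
have wS : scalar_on Gam w by apply/(xS w uw); rewrite /w !mulmxA mulmxV // mul1mx mulmxK.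
have := (xS' w uw).1 wS; rewrite /w invmxM ?unitmx_inv // invmxK.
by rewrite !mulmxA.
Qed.

End Classification.

Theorem theorem6p11 (F : closedFieldType) (charF0 : [pchar F] =i pred0)
    (n : nat) (hn : (2 <= n)%N)
    (A B : forall l : nat, {set T_l l})
    (AB : forall l : nat, isotropic_decomposition (@beta_l F l) (A l) (B l)) :
  let P := @P_part F n.+1 in
  let bracket := @supercommutator F n.+1 in
  let GammaP (l : nat) := @Gamma_Pl l (n.+1 %/ 2 ^ l) F (A l) (B l) n.+1 in
  (forall (G : zmodType) (Gam : G -> {vspace 'M[F]_(n.+1 + n.+1)}),
     fine bracket P Gam ->
     exists! l : nat, (2 ^ l %| n.+1)%N /\ equivalent bracket P Gam (GammaP l))
  /\ (forall l : nat, (2 ^ l %| n.+1)%N ->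
        fine bracket P (GammaP l) /\
        is_universal_group bracket (GammaP l) (@G_l l (n.+1 %/ 2 ^ l))).
Proof.
move=> P bracket GammaP; have n_gt0 : (0 < n)%N := ltnW hn.
(* The size of B turns k * #|B| = n + 1 into k = (n + 1) / 2^l. *)
have cB l : #|B l| = (2 ^ l)%N.
  by have [u [v [_ _ _ [_ ->]]]] := lagrangian_coordinates charF0 (AB l).
have kE l k : (k * #|B l|)%N = n.+1 -> k = (n.+1 %/ 2 ^ l)%N.
  by rewrite cB => <-; rewrite mulnK ?expn_gt0.
have em l : (2 ^ l %| n.+1)%N -> (n.+1 %/ 2 ^ l * #|B l|)%N = n.+1.
  by move=> dv; rewrite cB divnK.
split=> [G Gam fG | l dv]; last first.
  split; first exact: (Gamma_Pl_fine_at charF0 (AB l) (em l dv)).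
  exact: (Gamma_Pl_universal_at charF0 (AB l) (em l dv)).
have [l [k [kB eq_l]]] := fine_equivalent_Gamma_Pl charF0 n_gt0 AB fG.
move: kB eq_l (kE l k kB) => + + kEl; rewrite {k}kEl => kB eq_l.
exists l; split; first by split; rewrite // -kB cB dvdn_mull.
move=> l' [dv' eq_l']; have [gradG _] := fG; apply/eqP; rewrite eqn_leq.
by rewrite (equivalent_Gamma_Pl_leq charF0 n_gt0 AB gradG kB (em l' dv') eq_l eq_l')
  (equivalent_Gamma_Pl_leq charF0 n_gt0 AB gradG (em l' dv') kB eq_l' eq_l).
Qed.
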